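(* Let $\mathfrak g$ be a symmetrizable Kac–Moody Lie algebra with index set $I$ and let $\underline i=(i_1,\dots,i_r)$ be a reduced word in $I$. Let $\underline a=(a_1,\dots,a_r)\in L_{\underline i}$ and put $f_{\underline i}^{(\underline a)}=f_{i_1}^{(a_1)}\cdots f_{i_r}^{(a_r)}\in U_q^-(\mathfrak g)$. Assume that $(f_{\underline i}^{(\underline a)},f_{\underline i}^{(\underline a)})\in 1+qA$. Then $f_{\underline i}^{(\underline a)}$ is an element of the canonical basis $\mathcal B(\infty)$ of $U_q^-(\mathfrak g)$.
   Context: The root datum consists of a finite set $I$, simple roots $\alpha_i$, simple coroots $h_i$, a weight lattice containing fundamental weights $\varpi_i$ ($\langle h_i,\varpi_j\rangle=\delta_{ij}$), and a symmetric form with $(\alpha_i,\alpha_i)\in2\mathbb Z_{>0}$ and $\langle h_i,\lambda\rangle=2(\alpha_i,\lambda)/(\alpha_i,\alpha_i)$. Put $q_i=q^{(\alpha_i,\alpha_i)/2}$, $[n]_i=(q_i^n-q_i^{-n})/(q_i-q_i^{-1})$. $U_q^-(\mathfrak g)$ is the $\mathbb Q(q)$-algebra generated by $f_i$ ($i\in I$) with the quantum Serre relations; $f_i^{(n)}=f_i^n/[n]_i!$; $U_{\mathbb Z}^-(\mathfrak g)$ is the $\mathbb Z[q,q^{-1}]$-subalgebra generated by all $f_i^{(n)}$ and $U_{\mathbb Q}^-=\mathbb Q\otimes U_{\mathbb Z}^-$. The bar involution is the $\mathbb Q$-algebra automorphism with $\overline{f_i}=f_i$, $\overline q=q^{-1}$.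 $A\subset\mathbb Q(q)$ is the subring of rational functions regular at $q=0$. The operators $e_i'$ on $U_q^-(\mathfrak g)$ satisfy $e_i'(1)=0$, $e_i'f_j=q_i^{-\langle h_i,\alpha_j\rangle}f_je_i'+\delta_{ij}$ ($f_j$ acting by left multiplication), and $(\cdot,\cdot)$ is the unique non-degenerate symmetric $\mathbb Q(q)$-valued bilinear form with $(1,1)=1$, $(f_iu,v)=(u,e_i'v)$. Canonical basis: $U_q^-(\mathfrak g)=\bigoplus_{n\ge0}f_i^{(n)}\ker e_i'$; set $\tilde f_i(f_i^{(n)}u)=f_i^{(n+1)}u$, $\tilde e_i(f_i^{(n)}u)=f_i^{(n-1)}u$ for $u\in\ker e_i'$. $L(\infty)$ is the $A$-submodule generated by all $\tilde f_{i_1}\cdots\tilde f_{i_r}1$, $B(\infty)\subset L(\infty)/qL(\infty)$ the set of images of these vectors, $G$ the inverse of the natural isomorphism $U_{\mathbb Q}^-\cap L(\infty)\cap\overline{L(\infty)}\to L(\infty)/qL(\infty)$, and $\mathcal B(\infty)=G(B(\infty))$. Tight monomial cone: $L_{\underline i}$ is the set of $(a_1,\dots,a_r)\in\mathbb Z_{\ge0}^r$ such that $a_p+a_s+\sum_{p<k<s}\langle h_i,\alpha_{i_k}\rangle a_k\le0$ for every pair $p<s$ with $i_p=i_s=:i$. A word is reduced if $s_{i_1}\cdots s_{i_r}$ is a reduced expression in the Weyl group. *)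

(* Defs.v *)
From HB Require Import structures.
From mathcomp Require Import all_boot all_order all_algebra.
From mathcomp Require Import boolp classical_sets.
From mathcomp Require Import monalg.

Set Implicit Arguments.
Unset Strict Implicit.
Unset Printing Implicit Defensive.

Import Order.TTheory GRing.Theory Num.Theory.

Local Open Scope ring_scope.
Local Open Scope quotient_scope.
Local Open Scope classical_set_scope.

(* The existence of [half_norm] says that (alpha_i, alpha_i) is an even
   positive integer.  <h_i, alpha_i> = 2 follows from [coroot_form], and
   symmetrizability of the Cartan matrix from [coroot_form] together with the
   symmetry of [wform]. *)
Record root_datum := RootDatum {
  index :> finType;
  weight : zmodType;
  weight_free : exists (n : nat) (b : 'I_n -> weight),
    forall x, exists! c : {ffun 'I_n -> int}, x = \sum_(k < n) b k *~ c k;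
  alpha : index -> weight;
  coroot : index -> {additive weight -> int};
  varpi : index -> weight;
  coroot_varpi : forall i j, coroot i (varpi j) = (i == j)%:R;
  wform : weight -> weight -> rat;
  wform_sym : forall x y, wform x y = wform y x;
  wformD : forall x y z, wform (x + y) z = wform x z + wform y z;
  half_norm : index -> nat;
  half_norm_gt0 : forall i, (0 < half_norm i)%N;
  wform_alpha : forall i, wform (alpha i) (alpha i) = (2 * half_norm i)%:R;
  coroot_form : forall i x,
    (coroot i x)%:~R = 2 * wform (alpha i) x / wform (alpha i) (alpha i);
  coroot_alpha_le0 : forall i j, i != j -> coroot i (alpha j) <= 0
}.

Section WeylGroup.
Variable D : root_datum.

Definition simple_reflection (i : D) (x : weight D) : weight D :=
  x - alpha i *~ coroot i x.

Definition weyl_act (w : seq D) (x : weight D) : weight D :=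
  foldr simple_reflection x w.

(* The Weyl group is the group of operators on the weight lattice generated by
   the simple reflections. *)
Definition reduced (w : seq D) : Prop :=
  forall w' : seq D, weyl_act w' =1 weyl_act w -> (size w <= size w')%N.

Definition tight_cone (r : nat) (i : r.-tuple D) : set (r.-tuple nat) :=
  [set a | forall p s : 'I_r, (p < s)%N -> tnth i p = tnth i s ->
     (tnth a p)%:Z + (tnth a s)%:Z
       + \sum_(k < r | (p < k)%N && (k < s)%N)
           coroot (tnth i p) (alpha (tnth i k)) * (tnth a k)%:Z <= 0].

End WeylGroup.

Notation ratfun := {fraction {poly rat}}.

Definition q : ratfun := tofrac 'X.

(* The ring A of rational functions regular at q = 0. *)
Definition regular0 : set ratfun :=
  [set c | exists2 p : {poly rat} * {poly rat}, p.2.[0] != 0 &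
     c = tofrac p.1 / tofrac p.2].

Definition one_plus_qA : set ratfun :=
  [set c | exists2 d, regular0 d & c = 1 + q * d].

(* The ring Z[q, q^-1]. *)
Definition laurentZ : set ratfun :=
  [set c | exists (p : {poly int}) (n : nat),
     c = tofrac (map_poly intr p) / q ^+ n].

(* The field of constants Q in Q(q). *)
Definition ratconst (c : rat) : ratfun := tofrac c%:P.

Section QuantumIntegers.
Variable D : root_datum.

Definition qi (i : D) : ratfun := q ^+ half_norm i.

Definition qint (i : D) (n : nat) : ratfun :=
  (qi i ^+ n - qi i ^- n) / (qi i - (qi i)^-1).

Definition qfact (i : D) (n : nat) : ratfun := \prod_(1 <= k < n.+1) qint i k.

End QuantumIntegers.

Lemma malg_scaleAr (K : monomType) (R : comNzRingType) (a : R)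
  (x y : {malg R[K]}) : a *: (x * y) = x * (a *: y).
Proof.
suff ax : malgC a * x = x * malgC a by rewrite -!mul_malgC !mulrA ax.
rewrite !malgM_def fgmulUg fgmulgU; apply: eq_bigr => k _.
by rewrite mulrC mul1m mulm1.
Qed.

Section SerreIdeal.
Variable D : root_datum.

Local Notation free_alg := {malg ratfun[{fmonom D}]}.

Definition free_gen (i : D) : free_alg := mkmalgU (fmu i) 1.

Definition free_divpow (i : D) (n : nat) : free_alg :=
  (qfact i n)^-1 *: free_gen i ^+ n.

(* The exponent is 1 - <h_i, alpha_j>, which is nonnegative for i != j. *)
Definition serre_rel (i j : D) : free_alg :=
  let b := `|1 - coroot i (alpha j)|%N in
  \sum_(k < b.+1) (-1) ^+ k *:
    (free_divpow i k * free_gen j * free_divpow i (b - k)).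

Inductive serre_ideal : free_alg -> Prop :=
| SerreGen i j x y : i != j -> serre_ideal (x * serre_rel i j * y)
| Serre0 : serre_ideal 0
| SerreD x y : serre_ideal x -> serre_ideal y -> serre_ideal (x + y).

Definition in_serre : pred free_alg := fun x => `[< serre_ideal x >].

Lemma serre_idealMl a x : serre_ideal x -> serre_ideal (a * x).
Proof.
elim=> [i j u v ij||u v _ IHu _ IHv].
- by rewrite !mulrA -(mulrA (a * u)) mulrA; apply: SerreGen.
- by rewrite mulr0; apply: Serre0.
- by rewrite mulrDr; apply: SerreD.
Qed.

Lemma serre_idealMr a x : serre_ideal x -> serre_ideal (x * a).
Proof.
elim=> [i j u v ij||u v _ IHu _ IHv].
- by rewrite -!mulrA mulrA; apply: SerreGen.
- by rewrite mul0r; apply: Serre0.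
- by rewrite mulrDl; apply: SerreD.
Qed.

Lemma in_serre_zmod_closed : zmod_closed in_serre.
Proof.
split=> [|x y]; first by apply/asboolP; apply: Serre0.
move=> /asboolP xI /asboolP yI; apply/asboolP; apply: SerreD xI _.
by rewrite -mulN1r; apply: serre_idealMl.
Qed.

HB.instance Definition _ := GRing.isZmodClosed.Build free_alg in_serre
  in_serre_zmod_closed.

Lemma mcoeff_gen i : mcoeff (@mone {fmonom D}) (free_gen i) = 0.
Proof.
rewrite mcoeffU; case: eqP => // /(congr1 (fun m => size (fmonom_val m))).
by rewrite fmU fm1.
Qed.

Lemma serre_ideal_neq1 : ~ serre_ideal 1.
Proof.
suff aug x : serre_ideal x -> mcoeff (@mone {fmonom D}) x = 0.
  by move=> /aug /eqP; rewrite rmorph1 oner_eq0.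
elim=> [i j u v ij||u v _ IHu _ IHv]; last 2 first.
- exact: raddf0.
- by rewrite raddfD /= IHu IHv addr0.
suff aug0 : mcoeff (@mone {fmonom D}) (serre_rel i j) = 0.
  by rewrite !rmorphM /= aug0 mulr0 mul0r.
rewrite raddf_sum big1 // => k _.
by rewrite /= mcoeffZ !rmorphM /= mcoeff_gen mulr0 mul0r mulr0.
Qed.

End SerreIdeal.

Section NegativePart.
Variable D : root_datum.
Local Notation free_alg := {malg ratfun[{fmonom D}]}.

Definition Uminus : Type :=
  Quotient.quot (GRing.ZmodClosed.clone _ (@in_serre D) _).

HB.instance Definition _ := GRing.Zmodule.on Uminus.
HB.instance Definition _ := EqQuotient.on Uminus.

Local Notation proj := (\pi_Uminus : free_alg -> Uminus).

Lemma projP (x y : free_alg) : proj x = proj y <-> serre_ideal (x - y).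
Proof.
split=> [/eqP|xy]; [|apply/eqP]; rewrite -Quotient.idealrBE.
  by move/(@asboolP (serre_ideal (x - y))).
exact/(@asboolP (serre_ideal (x - y))).
Qed.

Lemma projD (x y : free_alg) : proj (x + y) = proj x + proj y.
Proof. exact: Quotient.pi_add. Qed.

Definition umul (x y : Uminus) : Uminus := proj (repr x * repr y).

Definition uscale (c : ratfun) (x : Uminus) : Uminus := proj (c *: repr x).

Lemma serre_repr (x : free_alg) : serre_ideal (repr (proj x) - x).
Proof. by apply/projP; rewrite reprK. Qed.

Lemma projM (x y : free_alg) : proj (x * y) = umul (proj x) (proj y).
Proof.
apply/esym/projP; set x' := repr _; set y' := repr _.
have -> : x' * y' - x * y = (x' - x) * y' + x * (y' - y).
  by rewrite mulrBl mulrBr addrA subrK.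
apply: SerreD; first exact/serre_idealMr/serre_repr.
exact/serre_idealMl/serre_repr.
Qed.

Lemma projZ c (x : free_alg) : proj (c *: x) = uscale c (proj x).
Proof.
apply/esym/projP; rewrite -scalerBr -mul_malgC.
exact/serre_idealMl/serre_repr.
Qed.

Lemma proj_ind (P : Uminus -> Prop) : (forall x, P (proj x)) -> forall u, P u.
Proof. by move=> Pproj u; rewrite -[u]reprK; apply: Pproj. Qed.

Lemma umulA : associative umul.
Proof.
elim/proj_ind=> x; elim/proj_ind=> y; elim/proj_ind=> z.
by rewrite -!projM mulrA.
Qed.

Lemma umul1 : left_id (proj 1) umul.
Proof. by elim/proj_ind=> x; rewrite -projM mul1r. Qed.

Lemma umulr1 : right_id (proj 1) umul.
Proof. by elim/proj_ind=> x; rewrite -projM mulr1. Qed.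

Lemma umulDl : left_distributive umul +%R.
Proof.
elim/proj_ind=> x; elim/proj_ind=> y; elim/proj_ind=> z.
by rewrite -projD -!projM -projD mulrDl.
Qed.

Lemma umulDr : right_distributive umul +%R.
Proof.
elim/proj_ind=> x; elim/proj_ind=> y; elim/proj_ind=> z.
by rewrite -projD -!projM -projD mulrDr.
Qed.

Lemma umul_neq0 : proj 1 != 0.
Proof.
apply/eqP=> /= p10; apply: (@serre_ideal_neq1 D).
rewrite -[1]subr0; apply/projP; rewrite p10.
by apply: (addrI (proj 0)); rewrite -projD !addr0.
Qed.

HB.instance Definition _ := GRing.Zmodule_isNzRing.Build Uminus
  umulA umul1 umulr1 umulDl umulDr umul_neq0.

Lemma uscaleA a b (v : Uminus) : uscale a (uscale b v) = uscale (a * b) v.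
Proof. by elim/proj_ind: v => x; rewrite -!projZ scalerA. Qed.

Lemma uscale1 : left_id 1 uscale.
Proof. by elim/proj_ind=> x; rewrite -projZ scale1r. Qed.

Lemma uscaleDr : right_distributive uscale +%R.
Proof.
move=> c; elim/proj_ind=> x; elim/proj_ind=> y.
by rewrite -projD -!projZ -projD scalerDr.
Qed.

Lemma uscaleDl (v : Uminus) : {morph uscale^~ v : a b / a + b}.
Proof. by elim/proj_ind: v => x a b; rewrite -!projZ -projD scalerDl. Qed.

HB.instance Definition _ := GRing.Zmodule_isLmodule.Build ratfun Uminus
  uscaleA uscale1 uscaleDr uscaleDl.

Lemma uscaleAl (a : ratfun) (u v : Uminus) : a *: (u * v) = (a *: u) * v.
Proof.
elim/proj_ind: u => x; elim/proj_ind: v => y.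
change (uscale a (umul (proj x) (proj y)) = umul (uscale a (proj x)) (proj y)).
by rewrite -projM -!projZ -projM scalerAl.
Qed.

HB.instance Definition _ := GRing.Lmodule_isLalgebra.Build ratfun Uminus
  uscaleAl.

Lemma uscaleAr (a : ratfun) (u v : Uminus) : a *: (u * v) = u * (a *: v).
Proof.
elim/proj_ind: u => x; elim/proj_ind: v => y.
change (uscale a (umul (proj x) (proj y)) = umul (proj x) (uscale a (proj y))).
by rewrite -projM -!projZ -projM malg_scaleAr.
Qed.

HB.instance Definition _ := GRing.Lalgebra_isAlgebra.Build ratfun Uminus
  uscaleAr.

Definition fgen (i : D) : Uminus := proj (free_gen i).

End NegativePart.

Section CanonicalBasis.
Variable D : root_datum.
Local Notation U := (Uminus D).

Definition divpow (i : D) (n : nat) : U := (qfact i n)^-1 *: fgen i ^+ n.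

Definition monomial (r : nat) (i : r.-tuple D) (a : r.-tuple nat) : U :=
  \prod_(k < r) divpow (tnth i k) (tnth a k).

Inductive integral_form : set U :=
| IntGen i n : integral_form (divpow i n)
| Int1 : integral_form 1
| IntD x y : integral_form x -> integral_form y -> integral_form (x + y)
| IntM x y : integral_form x -> integral_form y -> integral_form (x * y)
| IntZ c x : laurentZ c -> integral_form x -> integral_form (c *: x).

(* The S-submodule generated by X, for S a subring of Q(q). *)
Definition submodule_gen (S : set ratfun) (X : set U) : set U :=
  [set u | exists2 s : seq (ratfun * U),
     (forall p, p \in s -> S p.1 /\ X p.2) & u = \sum_(p <- s) p.1 *: p.2].

Definition rational_form : set U := submodule_gen (range ratconst) integral_form.

(* Q-linearity is automatic for a ring morphism, and the image of q then
   determines the action on all scalars of Q(q). *)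
Definition is_bar (bar : {rmorphism U -> U}) : Prop :=
  [/\ bijective bar, bar q%:A = q^-1%:A & forall i, bar (fgen i) = fgen i].

Definition is_eprime (e' : D -> {linear U -> U}) : Prop :=
  (forall i, e' i 1 = 0) /\
  (forall i j u, e' i (fgen j * u) =
     qi i ^ (- coroot i (alpha j)) *: (fgen j * e' i u) + u *+ (i == j)).

(* The last two conditions are symmetry and non-degeneracy; the first two
   already determine the form. *)
Definition is_kashiwara_form (e' : D -> {linear U -> U}) (form : {biscalar U}) :
    Prop :=
  [/\ form 1 1 = 1,
      forall i u v, form (fgen i * u) v = form u (e' i v),
      forall u v, form u v = form v u &
      forall u, (forall v, form u v = 0) -> u = 0].

(* As U is the direct sum of the f_i^(n) ker e'_i, this determines ft i. *)
Definition is_ftilde (e' ft : D -> {linear U -> U}) : Prop :=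
  forall i n u, e' i u = 0 -> ft i (divpow i n * u) = divpow i n.+1 * u.

Section Lattice.
Variables (ft : D -> {linear U -> U}) (bar : {rmorphism U -> U}).

Definition ftilde_word (w : seq D) : U := foldr (fun i u => ft i u) 1 w.

Definition Linf : set U := submodule_gen regular0 (range ftilde_word).

(* The class of x in L(oo) / q L(oo), as the coset x + q L(oo) in U. *)
Definition Lclass (x : U) : set U := [set y | exists2 z, Linf z & y = x + q *: z].

Definition Binf : set (set U) := range (Lclass \o ftilde_word).

Definition balanced : set U := rational_form `&` Linf `&` (bar @` Linf).

(* The graph of G: [global b x] means G(b) = x, where G is inverse to the map
   x |-> Lclass x from [balanced] to L(oo) / q L(oo). *)
Definition global (b : set U) (x : U) : Prop := balanced x /\ Lclass x = b.

Definition canonical_basis : set U := [set x | exists2 b, Binf b & global b x].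

End Lattice.

End CanonicalBasis.

(* Main.v *)
Require Import Defs.
From HB Require Import structures.
From mathcomp Require Import all_boot all_order all_algebra.
From mathcomp Require Import boolp classical_sets.
From mathcomp Require Import ring lra zify.
From mathcomp Require Import monalg.

Set Implicit Arguments.
Unset Strict Implicit.
Unset Printing Implicit Defensive.

Import Order.TTheory GRing.Theory Num.Theory.

Local Open Scope ring_scope.

(* The vectors ft_w 1 span L(oo) by definition, and Kashiwara's grand loop shows
   that two of them are, modulo q L(oo), either orthogonal or equal up to sign,
   each having norm 1 at q = 0; hence L(oo) is the lattice of vectors of regular
   norm.  Here the loop is run degree by degree: if e'_i kills y together with
   its mirror image under the anti-involution [st] fixing every f_i, then
   f_i^(a) y f_i^(b) can be compared with iterated q-commutators of f_i and y,
   which shows that L(oo) is stable under [st] and that ft_i nearly commutes with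
   the mirror ft*_i = st ft_i st.

   For a monomial m = f_i^(a) x with a > 0, write x = sum_n f_i^(n) u_n with e'_i u_n = 0.
   Then (m, m) is the sum of the squared q-binomials [a + n choose n]_i^2 times the
   norms of f_i^(a + n) u_n.  All summands have a positive leading coefficient at
   q = 0 and the q-binomials have a pole there as soon as n > 0.  In particular
   the norm of a monomial never lies in qA, and (m, m) in 1 + qA puts u_n in
   q L(oo) for n > 0; integrality of the norms then gives (x, x) in 1 + qA.
   By induction m is congruent to a vector ft_w 1; as m is bar-invariant and lies
   in the integral form, it is the corresponding element of the canonical basis. *)

(** * Valuations at q = 0 *)

(** The obstacle is circular: norms in degree h + 1 are controlled through the mirrored operators,
    and these are known to preserve L(oo) there only once it is stable under [st]. What degree h
    gives is ft_i ft*_i g = ft*_i g' + q t with t merely in L + st L. Still, this puts L inside st L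
    + q L; as the lattice is finitely generated, some q^m maps st L into L, and m iterations give st
    L inside L.

    Let y have weight c and be killed by e'_i and its mirror. The Serre relations make high powers
    of f_i times y right divisible by f_i, which forces c = n >= 0. For a + b <= n the vectors
    f_i^(a) y f_i^(b) and the q-commutators z_a f_i^(b) agree modulo q, triangularly; for a + b > n
    all of them are in the image of ft_i and of ft*_i, without error term. These are the two cases
    of the arguments with equal indices.

    Integrality is used in the same way for word vectors and for monomials: when a norm of value 1
    at q = 0 is a sum of two nonnegative parts, one of integer value, one part has value 0. *)

(* Q(q) near q = 0: [reg] is A, [zint] consists of the functions whose Laurent
   series at 0 has integer coefficients, and [ev] is the value at 0, which is
   meaningful on [reg] only. *)
Record valued (K : fieldType) := Valued {
  vq : K;
  reg : subringClosed K;
  zint : subringClosed K;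
  ev : K -> rat;
  vq_neq0 : vq != 0;
  vq_reg : vq \in reg;
  ev1 : ev 1 = 1;
  ev_vq : ev vq = 0;
  evD : {in reg &, {morph ev : a b / a + b}};
  evM : {in reg &, {morph ev : a b / a * b}};
  reg_divq : forall a, a \in reg -> ev a = 0 -> a / vq \in reg;
  regV : forall a, a \in reg -> ev a != 0 -> a^-1 \in reg;
  val_exists : forall c, c != 0 ->
    exists m a, [/\ a \in reg, ev a != 0 & c = vq ^ m * a];
  vq_zint : vq \in zint;
  vqV_zint : vq^-1 \in zint;
  zint_ev : forall a, a \in reg -> a \in zint -> ev a \is a Num.int;
  zintV : forall a, a \in reg -> a \in zint -> ev a = 1 -> a^-1 \in zint
}.

HB.lock Definition qnum (K : fieldType) (V : valued K) (d n : nat) : K :=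
  let Q := vq V ^+ d in (Q ^+ n - Q ^- n) / (Q - Q^-1).
HB.lock Definition qfac (K : fieldType) (V : valued K) (d n : nat) : K :=
  \prod_(1 <= k < n.+1) qnum V d k.
(* The q-integers rescaled by a power of q so as to have value 1 at q = 0. *)
HB.lock Definition snum (K : fieldType) (V : valued K) (d n : nat) : K :=
  \sum_(k < n) ((vq V ^+ d) ^+ 2) ^+ k.
HB.lock Definition sfac (K : fieldType) (V : valued K) (d n : nat) : K :=
  \prod_(1 <= k < n.+1) snum V d k.
HB.lock Definition qbin (K : fieldType) (V : valued K) (d m n : nat) : K :=
  qfac V d (m + n) / (qfac V d m * qfac V d n).
HB.lock Definition sbin (K : fieldType) (V : valued K) (d m n : nat) : K :=
  sfac V d (m + n) / (sfac V d m * sfac V d n).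

Section Valued.
Variables (K : fieldType) (V : valued K).
Local Notation q := (vq V).
Local Notation A := (reg V).
Local Notation ev := (ev V).

Definition qreg (c : K) : Prop := c / q \in A.

Definition unit1 (c : K) : Prop := c \in A /\ ev c = 1.

(** Poles are allowed: only the sign of the leading coefficient at q = 0 counts. In sums of such
    elements leading terms never cancel. *)
Definition pos (c : K) : Prop :=
  c = 0 \/ exists m a, [/\ a \in A, 0 < ev a & c = q ^ m * a].

Lemma ev0 : ev 0 = 0.
Proof.
have : ev (0 + 0) = ev 0 + ev 0 by rewrite evD ?rpred0.
by rewrite addr0 => /eqP; rewrite -subr_eq0 opprD addNKr oppr_eq0 => /eqP.
Qed.

Lemma evN a : a \in A -> ev (- a) = - ev a.
Proof.
move=> Aa; apply/eqP; rewrite -addr_eq0 addrC -evD ?rpredN //.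
by rewrite subrr ev0.
Qed.

Lemma evB : {in A &, {morph ev : a b / a - b}}.
Proof. by move=> a b Aa Ab; rewrite evD ?rpredN ?evN. Qed.

Lemma qregP c : qreg c <-> c \in A /\ ev c = 0.
Proof.
split=> [h|[Ac c0]]; last exact: reg_divq.
have -> : c = c / q * q by rewrite divfK // vq_neq0.
by rewrite rpredM ?vq_reg // evM ?vq_reg // ev_vq mulr0.
Qed.

Lemma qreg_reg c : qreg c -> c \in A. Proof. by case/qregP. Qed.
Lemma qreg_ev c : qreg c -> ev c = 0. Proof. by case/qregP. Qed.

Lemma qreg0 : qreg 0. Proof. by rewrite /qreg mul0r rpred0. Qed.

Lemma qregD a b : qreg a -> qreg b -> qreg (a + b).
Proof. by rewrite /qreg mulrDl; exact: rpredD. Qed.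

Lemma qregN a : qreg a -> qreg (- a).
Proof. by rewrite /qreg mulNr rpredN. Qed.

Lemma qregMl a b : a \in A -> qreg b -> qreg (a * b).
Proof. by rewrite /qreg -mulrA; exact: rpredM. Qed.

Lemma qregMr a b : qreg a -> b \in A -> qreg (a * b).
Proof. by move=> ha hb; rewrite mulrC; apply: qregMl. Qed.

Lemma qregq : qreg q.
Proof. by rewrite /qreg divff ?vq_neq0 ?rpred1. Qed.

Lemma qregXq n : (0 < n)%N -> qreg (q ^+ n).
Proof.
case: n => // n _; rewrite exprS; apply: qregMr; first exact: qregq.
by rewrite rpredX // vq_reg.
Qed.

Lemma qreg_sum (I : Type) (s : seq I) (P : pred I) (F : I -> K) :
  (forall i, P i -> qreg (F i)) -> qreg (\sum_(i <- s | P i) F i).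
Proof. by move=> h; apply: (big_ind qreg) => //; [exact: qreg0|exact: qregD]. Qed.

Lemma ev_eq a b : a \in A -> qreg (a - b) -> b \in A /\ ev b = ev a.
Proof.
move=> Aa /qregP[Aab eab].
have -> : b = a - (a - b) by rewrite opprB addrC subrK.
by rewrite rpredB // evB // eab subr0.
Qed.

Lemma unit1_1 : unit1 1. Proof. by split; rewrite ?rpred1 ?ev1. Qed.

Lemma unit1M a b : unit1 a -> unit1 b -> unit1 (a * b).
Proof. by move=> [ha ea] [hb eb]; split; rewrite ?rpredM ?evM ?ea ?eb ?mulr1. Qed.

Lemma unit1V a : unit1 a -> unit1 a^-1.
Proof.
move=> [ha ea]; have hV : a^-1 \in A by apply: regV; rewrite ?ea.
have a0 : a != 0 by apply: contra_eqN ea => /eqP->; rewrite ev0.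
split=> //; have := evM ha hV; rewrite mulfV // ev1 ea mul1r //.
Qed.

Lemma unit1_reg a : unit1 a -> a \in A. Proof. by case. Qed.

Lemma unit1_neq0 a : unit1 a -> a != 0.
Proof. by move=> [_ ea]; apply: contra_eqN ea => /eqP->; rewrite ev0. Qed.

Lemma unit1_prod (I : Type) (s : seq I) (P : pred I) (F : I -> K) :
  (forall i, P i -> unit1 (F i)) -> unit1 (\prod_(i <- s | P i) F i).
Proof. by move=> h; apply: (big_ind unit1) => //; [exact: unit1_1|exact: unit1M]. Qed.

Lemma unit1_qreg a : qreg a -> unit1 (1 + a).
Proof.
move=> /qregP[Aa ea]; split; first by rewrite rpredD ?rpred1.
by rewrite evD ?rpred1 // ea ev1 addr0.
Qed.

Lemma unit1B1 a b : unit1 a -> unit1 b -> qreg (a - b).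
Proof.
move=> [ha ea] [hb eb]; apply/qregP; rewrite rpredB // evB // ea eb subrr.
by split.
Qed.

Lemma reg_expz m : 0 <= m -> q ^ m \in A.
Proof. by case: m => // n _; rewrite -exprnP rpredX // vq_reg. Qed.

Lemma qreg_expz m : 0 < m -> qreg (q ^ m).
Proof. by case: m => // n n0; rewrite -exprnP; apply: qregXq. Qed.

Lemma expz_reg m a : a \in A -> ev a != 0 -> q ^ m * a \in A -> 0 <= m.
Proof.
move=> Aa ea h; rewrite leNgt; apply/negP => m0.
have a0 : a != 0 by apply: contraNneq ea => ->; rewrite ev0.
have : qreg (q ^ (- m) * (q ^ m * a)).
  by apply: qregMr => //; apply: qreg_expz; rewrite oppr_gt0.
rewrite mulrA -expfzDr ?vq_neq0 // addNr expr0z mul1r => /qreg_ev e0.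
by rewrite e0 eqxx in ea.
Qed.

Lemma expz_qreg m a : a \in A -> ev a != 0 -> qreg (q ^ m * a) -> 0 < m.
Proof.
move=> Aa ea; rewrite /qreg mulrAC -exprN1 -expfzDr ?vq_neq0 //.
by move/(expz_reg Aa ea); rewrite subr_ge0; lia.
Qed.

Lemma pos0 : pos 0. Proof. by left. Qed.

Lemma posP c : c \in A -> (0 < ev c) \/ c = 0 -> pos c.
Proof.
by move=> Ac [e0|->]; [right; exists 0, c; rewrite expr0z mul1r|left].
Qed.

Lemma posMq m c : pos c -> pos (q ^ m * c).
Proof.
case=> [->|[n [a [Aa ea ->]]]]; first by rewrite mulr0; left.
by right; exists (m + n), a; rewrite mulrA -expfzDr ?vq_neq0.
Qed.

Lemma posMu a c : unit1 a -> pos c -> pos (a * c).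
Proof.
move=> [Aa ea] [->|[n [b [Ab eb ->]]]]; first by rewrite mulr0; left.
right; exists n, (a * b); split; rewrite ?rpredM ?evM ?ea ?mul1r //.
by rewrite mulrCA.
Qed.

(** Leading terms of the same sign cannot cancel, so the valuation of c + d is at most that of c.
    Stated for any property [Q] that passes to larger valuations, so as to give [posD], [posD_reg]
    and [posD_qreg] at once. *)
Lemma posD_aux c d (Q : K -> Prop) :
    (forall m a, a \in A -> 0 < ev a -> Q (q ^ m * a) ->
       forall k b, b \in A -> m <= k -> Q (q ^ k * b)) ->
    Q 0 -> pos c -> pos d ->
  pos (c + d) /\ (Q (c + d) -> Q c).
Proof.
move=> HQ Q0 [->|[m [a [Aa ea ->]]]] [->|[n [b [Ab eb ->]]]].
- by rewrite addr0; split=> //; left.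
- by rewrite add0r; split=> //; right; exists n, b.
- by rewrite addr0; split=> //; right; exists m, a.
have key : exists l s, [/\ s \in A, 0 < ev s, l <= m &
    q ^ m * a + q ^ n * b = q ^ l * s].
  case: (lerP m n) => [le_mn|/ltW le_nm].
    exists m, (a + q ^ (n - m) * b).
    have nm : q ^ (n - m) \in A by apply: reg_expz; rewrite subr_ge0.
    split=> //; first by rewrite rpredD // rpredM.
      rewrite evD ?rpredM // ltr_wpDr // evM //.
      rewrite mulr_ge0 ?(ltW eb) //.
      have [->|] := eqVneq n m; first by rewrite subrr expr0z ev1.
      move=> nem; rewrite qreg_ev //; apply: qreg_expz.
      by rewrite subr_gt0 lt_neqAle eq_sym nem.
    by rewrite mulrDr mulrA -expfzDr ?vq_neq0 // [m + _]addrC subrK.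
  exists n, (q ^ (m - n) * a + b).
  have nm : q ^ (m - n) \in A by apply: reg_expz; rewrite subr_ge0.
  split=> //; first by rewrite rpredD // rpredM.
    rewrite evD ?rpredM // ltr_wpDl // evM //.
    rewrite mulr_ge0 ?(ltW ea) //.
    have [->|] := eqVneq n m; first by rewrite subrr expr0z ev1.
    move=> nem; rewrite qreg_ev //; apply: qreg_expz.
    by rewrite subr_gt0 lt_neqAle nem.
  by rewrite mulrDr mulrA -expfzDr ?vq_neq0 // [n + _]addrC subrK.
case: key => l [s [As es lm ->]]; split; first by right; exists l, s.
by move=> Qs; apply: (HQ l s).
Qed.

Lemma posD c d : pos c -> pos d -> pos (c + d).
Proof.
by move=> pc pd; have [] := @posD_aux c d (fun=> True) (fun _ _ _ _ _ _ _ _ _ => I).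
Qed.

Lemma posD_reg c d : pos c -> pos d -> c + d \in A -> c \in A.
Proof.
move=> pc pd; apply: (@posD_aux c d (fun x => x \in A) _ _ pc pd).2; last exact: rpred0.
move=> m a Aa ea h k b Ab mk; rewrite rpredM // reg_expz // (le_trans _ mk) //.
by apply: (expz_reg Aa) h; rewrite gt_eqF.
Qed.

Lemma posD_qreg c d : pos c -> pos d -> qreg (c + d) -> qreg c.
Proof.
move=> pc pd; apply: (@posD_aux c d qreg _ _ pc pd).2; last exact: qreg0.
move=> m a Aa ea h k b Ab mk; apply: qregMr => //.
apply: qreg_expz; apply: lt_le_trans mk.
by apply: (expz_qreg Aa) h; rewrite gt_eqF.
Qed.

Lemma pos_sum (I : Type) (s : seq I) (P : pred I) (F : I -> K) :
  (forall i, P i -> pos (F i)) -> pos (\sum_(i <- s | P i) F i).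
Proof. by move=> h; apply: (big_ind pos) => //; [exact: pos0|exact: posD]. Qed.

Lemma pos_sum_reg n (F : 'I_n -> K) : (forall i, pos (F i)) ->
  \sum_i F i \in A -> forall i, F i \in A.
Proof.
move=> pF hs i; move: hs; rewrite (bigD1 i) //=; apply: posD_reg => //.
by apply: pos_sum.
Qed.

Lemma pos_sum_qreg n (F : 'I_n -> K) : (forall i, pos (F i)) ->
  qreg (\sum_i F i) -> forall i, qreg (F i).
Proof.
move=> pF hs i; move: hs; rewrite (bigD1 i) //=; apply: posD_qreg => //.
by apply: pos_sum.
Qed.

Lemma pos_ev c : pos c -> c \in A -> 0 <= ev c.
Proof.
case=> [->|[m [a [Aa ea ->]]] h]; first by rewrite ev0.
have m0 : 0 <= m by apply: expz_reg h; rewrite ?gt_eqF.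
rewrite evM ?reg_expz // mulr_ge0 ?(ltW ea) //.
have [->|m1] := eqVneq m 0; first by rewrite expr0z ev1.
by rewrite qreg_ev //; apply: qreg_expz; rewrite lt_neqAle eq_sym m1.
Qed.

Lemma ev_sum n (F : 'I_n -> K) : (forall i, F i \in A) ->
  ev (\sum_i F i) = \sum_i ev (F i).
Proof.
elim: n F => [|n IH] F AF; first by rewrite !big_ord0 ev0.
by rewrite !big_ord_recl evD ?IH //; apply: rpred_sum.
Qed.

Lemma expz_zint m : q ^ m \in zint V.
Proof.
case: m => n; first by rewrite -exprnP rpredX // vq_zint.
by rewrite NegzE -exprz_inv -exprnP rpredX // vqV_zint.
Qed.

(** * q-integers and q-binomials near q = 0 *)

Section QInt.
Variables (d : nat) (d_gt0 : (0 < d)%N).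
Local Notation qnum := (qnum V d).
Local Notation qfac := (qfac V d).
Local Notation snum := (snum V d).
Local Notation sfac := (sfac V d).
Local Notation qbin := (qbin V d).
Local Notation sbin := (sbin V d).
Local Notation Q := (q ^+ d).

Lemma Q_neq0 : Q != 0. Proof. by rewrite expf_neq0 ?vq_neq0. Qed.

Lemma Q_expz (m : int) : Q ^ m = q ^ (d%:Z * m).
Proof. by rewrite exprnP exprz_exp. Qed.

Lemma reg_Q m : 0 <= m -> Q ^ m \in A.
Proof. by move=> m0; rewrite Q_expz reg_expz // mulr_ge0. Qed.

Lemma qreg_Q m : 0 < m -> qreg (Q ^ m).
Proof. by move=> m0; rewrite Q_expz; apply: qreg_expz; rewrite mulr_gt0. Qed.

Lemma zint_Q m : Q ^ m \in zint V.
Proof. by rewrite Q_expz expz_zint. Qed.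

Lemma QzD m n : Q ^ (m + n) = Q ^ m * Q ^ n.
Proof. by rewrite expfzDr ?Q_neq0. Qed.

Lemma unit1_1BQ m : 0 < m -> unit1 (1 - Q ^ m).
Proof. by move=> m0; apply/unit1_qreg/qregN/qreg_Q. Qed.

Lemma Q2_neq1 : 1 - Q ^+ 2 != 0.
Proof. by apply: unit1_neq0; apply: (@unit1_1BQ 2). Qed.

Lemma QBV_neq0 : Q - Q^-1 != 0.
Proof.
apply: contraNneq Q2_neq1 => h.
have -> : 1 - Q ^+ 2 = - Q * (Q - Q^-1).
  by rewrite mulrBr mulNr mulNr mulfV ?Q_neq0 // opprK addrC expr2.
by rewrite h mulr0.
Qed.

Lemma snumE n : (1 - Q ^+ 2) * snum n = 1 - (Q ^+ 2) ^+ n.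
Proof. by rewrite -opprB mulNr snum.unlock -subrX1 opprB. Qed.

Lemma qnumE n : qnum n.+1 = Q ^ (- n%:Z) * snum n.+1.
Proof.
apply: (mulfI Q2_neq1); rewrite [RHS]mulrCA snumE qnum.unlock /=.
rewrite -exprnN; have := QBV_neq0; have := Q_neq0; move: Q => x x0 xV.
rewrite [in RHS]exprAC.
have xn : x ^+ n != 0 by rewrite expf_neq0.
rewrite !exprS; move: (x ^+ n) xn => y y0. field.
have -> : x * x - 1 = x * (x - x^-1) by rewrite mulrBr mulfV.
by rewrite x0 y0 mulf_neq0.
Qed.

Lemma qnumD m n : qnum (m + n) = Q ^+ m * qnum n + Q ^- n * qnum m.
Proof.
rewrite qnum.unlock /= !mulrA -mulrDl; congr (_ / _).
have Q0 := Q_neq0; have h1 := expf_neq0 m Q0; have h2 := expf_neq0 n Q0.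
by rewrite exprD invfM; ring.
Qed.

Lemma unit1_snum n : (0 < n)%N -> unit1 (snum n).
Proof.
case: n => // n _; rewrite snum.unlock big_ord_recl /= expr0.
apply/unit1_qreg/qreg_sum => k _; rewrite -exprM.
by rewrite -exprM; apply: qregXq; rewrite muln_gt0 d_gt0.
Qed.

Lemma zint_snum n : snum n \in zint V.
Proof. by rewrite snum.unlock rpred_sum // => k _; rewrite !rpredX // vq_zint. Qed.

Lemma snum_neq0 n : (0 < n)%N -> snum n != 0.
Proof. by move=> n0; apply/unit1_neq0/unit1_snum. Qed.

Lemma qnum_neq0 n : qnum n.+1 != 0.
Proof. by rewrite qnumE mulf_neq0 ?expfz_neq0 ?Q_neq0 ?snum_neq0. Qed.

Lemma qfac0 : qfac 0 = 1. Proof. by rewrite qfac.unlock big_geq. Qed.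
Lemma sfac0 : sfac 0 = 1. Proof. by rewrite sfac.unlock big_geq. Qed.

Lemma qfacS n : qfac n.+1 = qfac n * qnum n.+1.
Proof. by rewrite qfac.unlock big_nat_recr. Qed.

Lemma sfacS n : sfac n.+1 = sfac n * snum n.+1.
Proof. by rewrite sfac.unlock big_nat_recr. Qed.

Lemma qfac_neq0 n : qfac n != 0.
Proof.
elim: n => [|n IH]; first by rewrite qfac0 oner_neq0.
by rewrite qfacS mulf_neq0 ?qnum_neq0.
Qed.

Lemma unit1_sfac n : unit1 (sfac n).
Proof.
elim: n => [|n IH]; first by rewrite sfac0; exact: unit1_1.
by rewrite sfacS; apply: unit1M => //; apply: unit1_snum.
Qed.

Lemma sfac_neq0 n : sfac n != 0. Proof. exact/unit1_neq0/unit1_sfac. Qed.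

Lemma zint_snumV n : (snum n.+1)^-1 \in zint V.
Proof. by have [//|h1 h2] := @unit1_snum n.+1; apply: zintV; rewrite ?zint_snum. Qed.

Lemma zint_qnumV n : (qnum n.+1)^-1 \in zint V.
Proof. by rewrite qnumE invfM rpredM ?zint_snumV // invr_expz zint_Q. Qed.

(** Up to a power of q, the q-factorial has constant term 1, hence an inverse with integral
    expansion. Divided powers therefore do not spoil the integrality of the form. *)
Lemma zint_qfacV n : (qfac n)^-1 \in zint V.
Proof.
elim: n => [|n IH]; first by rewrite qfac0 invr1 rpred1.
by rewrite qfacS invfM rpredM ?zint_qnumV.
Qed.

(** The q-binomial has a pole of order exactly d m n, since [sbin] has value 1 at 0. This exponent
    is balanced against the q-commutator expansion in [coef_qreg], and it governs the norms of
    monomials. *)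
Lemma qbinE m n : qbin m n = Q ^ (- (m * n)%N%:Z) * sbin m n.
Proof.
rewrite qbin.unlock sbin.unlock; elim: n => [|n IH].
  by rewrite addn0 qfac0 sfac0 !mulr1 !divff ?qfac_neq0 ?sfac_neq0 ?muln0 ?expr0z ?mulr1.
rewrite addnS !qfacS !sfacS !qnumE.
have -> : Q ^ (- (m * n.+1)%N%:Z) = Q ^ (- (m * n)%N%:Z) * Q ^ (- m%:Z).
  by rewrite -QzD; congr (_ ^ _); lia.
have -> : Q ^ (- (m + n)%N%:Z) = Q ^ (- m%:Z) * Q ^ (- n%:Z).
  by rewrite -QzD; congr (_ ^ _); lia.
have h1 := qfac_neq0 m; have h2 := qfac_neq0 n; have h3 := sfac_neq0 m.
have h4 := sfac_neq0 n; have h5 := @snum_neq0 n.+1 isT.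
have h6 : Q ^ (- n%:Z) != 0 by rewrite expfz_neq0 // Q_neq0.
transitivity (qfac (m + n) / (qfac m * qfac n)
  * (Q ^ (- m%:Z) * snum (m + n).+1 / snum n.+1)).
  by field; rewrite h1 h2 h5 h6.
by rewrite IH; field; rewrite h3 h4 h5.
Qed.

Lemma unit1_sbin m n : unit1 (sbin m n).
Proof.
by rewrite sbin.unlock; apply: unit1M; [|apply: unit1V; apply: unit1M]; apply: unit1_sfac.
Qed.

Lemma qbin_sym m n : qbin m n = qbin n m.
Proof. by rewrite qbin.unlock addnC mulrC [X in X^-1]mulrC mulrC. Qed.

Lemma qbin_neq0 m n : qbin m n != 0.
Proof. by rewrite qbin.unlock !(mulf_neq0, invr_eq0, qfac_neq0). Qed.

End QInt.
End Valued.

(** * Algebras with skew derivations *)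

(* What the loop uses of U_q^-: [bf] and [be] are f_i and e'_i, [st] is the
   anti-involution fixing every f_i, and [fnil] is the only trace left of the
   Serre relations. *)
Record boson := Boson {
  bK : fieldType;
  bV : valued bK;
  bI : finType;
  bU : algType bK;
  bd : bI -> nat;
  bd_gt0 : forall i, (0 < bd i)%N;
  cart : bI -> bI -> int;
  cart_diag : forall i, cart i i = 2;
  cart_sym : forall i j, (bd i)%:Z * cart i j = (bd j)%:Z * cart j i;
  bf : bI -> bU;
  be : bI -> {linear bU -> bU};
  st : {linear bU -> bU};
  form : bU -> bU -> bK;
  ft : bI -> {linear bU -> bU};
  be1 : forall i, be i 1 = 0;
  bef : forall i j u, be i (bf j * u) =
    (vq bV ^+ bd i) ^ (- cart i j) *: (bf j * be i u) + u *+ (i == j);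
  bgen : forall P : bU -> Prop, P 1 -> (forall j u, P u -> P (bf j * u)) ->
    (forall u v, P u -> P v -> P (u + v)) -> (forall a u, P u -> P (a *: u)) ->
    forall u, P u;
  stM : forall u v, st (u * v) = st v * st u;
  st1 : st 1 = 1;
  stf : forall i, st (bf i) = bf i;
  stK : forall u, st (st u) = u;
  form1 : form 1 1 = 1;
  formf : forall i u v, form (bf i * u) v = form u (be i v);
  formC : forall u v, form u v = form v u;
  formDl : forall u v w, form (u + v) w = form u w + form v w;
  formZl : forall a u v, form (a *: u) v = a * form u v;
  form_nondeg : forall u, (forall v, form u v = 0) -> u = 0;
  ftE : forall i n u, be i u = 0 ->
    ft i ((qfac bV (bd i) n)^-1 *: bf i ^+ n * u) =
    (qfac bV (bd i) n.+1)^-1 *: bf i ^+ n.+1 * u;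
  fnil : forall i u, exists C, forall N, exists u',
    bf i ^+ N * u = u' * bf i ^+ (N - C)
}.

(** * Spans with restricted scalars *)

Section Span.
Variables (K : fieldType) (U : lmodType K).

(** Inductive rather than by finite sums, so that stability under linear maps is an induction on
    membership; [combs_span] converts to the finite sums of the statement. *)
Inductive span (S : {pred K}) (X : U -> Prop) : U -> Prop :=
| span0 : span S X 0
| spanX u : X u -> span S X u
| spanD u v : span S X u -> span S X v -> span S X (u + v)
| spanZ a u : a \in S -> span S X u -> span S X (a *: u).

Lemma span_sum S X (J : Type) (s : seq J) (P : pred J) (F : J -> U) :
  (forall j, P j -> span S X (F j)) -> span S X (\sum_(j <- s | P j) F j).
Proof. by move=> h; apply: (big_ind (span S X)) => //; [exact: span0|exact: spanD]. Qed.

Lemma span_sub (S S' : {pred K}) X (Y : U -> Prop) u : {subset S <= S'} ->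
  (forall x, X x -> span S' Y x) -> span S X u -> span S' Y u.
Proof.
move=> sS sX; elim=> {u} [|u /sX //|u v _ hu _ hv|a u aS _ hu].
- exact: span0.
- exact: spanD.
- by apply: spanZ => //; apply: sS.
Qed.

Lemma spanN (S : subringClosed K) X u : span S X u -> span S X (- u).
Proof. by move=> h; rewrite -scaleN1r; apply: spanZ => //; rewrite rpredN rpred1. Qed.

Lemma spanB (S : subringClosed K) X u v :
  span S X u -> span S X v -> span S X (u - v).
Proof. by move=> hu hv; apply: spanD hu (spanN hv). Qed.

End Span.

Section SpanLinear.
Variables (K : fieldType) (U W : lmodType K) (g : {linear U -> W}).

Lemma span_linear (S : {pred K}) (X : U -> Prop) (Y : W -> Prop) u :
  (forall x, X x -> span S Y (g x)) -> span S X u -> span S Y (g u).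
Proof.
move=> sX; elim=> {u} [|u /sX //|u v _ hu _ hv|a u aS _ hu].
- rewrite linear0; exact: span0.
- rewrite linearD; exact: spanD.
- by rewrite linearZ; apply: spanZ.
Qed.

Lemma span_linear0 (S : {pred K}) (X : U -> Prop) u :
  (forall x, X x -> g x = 0) -> span S X u -> g u = 0.
Proof.
move=> sX; elim=> {u} [|u /sX //|u v _ hu _ hv|a u aS _ hu].
- exact: linear0.
- by rewrite linearD hu hv addr0.
- by rewrite linearZ /= hu scaler0.
Qed.

End SpanLinear.

HB.lock Definition fd (B : boson) (i : bI B) (n : nat) : bU B :=
  (qfac (bV B) (bd i) n)^-1 *: bf i ^+ n.

Section Boson.
Variable B : boson.
Local Notation K := (bK B).
Local Notation U := (bU B).
Local Notation I := (bI B).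
Local Notation A := (reg (bV B)).
Local Notation f := (@bf B).
Local Notation e := (@be B).
Local Notation st := (@st B).
Local Notation form := (@form B).
Local Notation ft := (@ft B).
Local Notation Q i := (vq (bV B) ^+ bd i).
Local Notation qn i := (qnum (bV B) (bd i)).
Local Notation qf i := (qfac (bV B) (bd i)).
Local Notation sn i := (snum (bV B) (bd i)).
Local Notation sf i := (sfac (bV B) (bd i)).
Local Notation qb i := (qbin (bV B) (bd i)).
Implicit Types (i j k : I) (u v x y z : U).

Definition fw (w : seq I) : U := foldr (fun i u => f i * u) 1 w.
Definition tw (w : seq I) : U := foldr (fun i u => ft i u) 1 w.
(** Right-handed counterparts: [er] is adjoint to right multiplication by f_i, see [formMf], and
    [fs] is ft*_i. *)
Definition er i u : U := st (e i (st u)).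
Definition fs i u : U := st (ft i (st u)).
(** The value of h_i on the weight of [fw w], which is minus the sum of the alpha_j. Weights are
    kept as functions on the index set, since only these values matter. *)
Definition wt (w : seq I) i : int := - \sum_(j <- w) cart i j.

Definition ht h : U -> Prop :=
  span (@predT K) (fun u => exists2 w, size w = h & u = fw w).
Definition hom h (c : I -> int) : U -> Prop :=
  span (@predT K) (fun u => exists2 w, size w = h /\ wt w =1 c & u = fw w).
Definition L h : U -> Prop :=
  span A (fun u => exists2 w, size w = h & u = tw w).
(** Scalars are enlarged from Z[q, q^-1] to [zint]: the form is then integral on this module,
    although its values involve inverse q-factorials. *)
Definition RU : U -> Prop :=
  span (zint (bV B)) (fun u => exists s : seq (I * nat),
     u = foldr (fun p u => fd p.1 p.2 * u) 1 s).

Definition lmul (u v : U) : U := u * v.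

Fact lmul_linear u : linear (lmul u).
Proof. by move=> a v w; rewrite /lmul mulrDr scalerAr. Qed.
HB.instance Definition _ u := GRing.isLinear.Build K U U _ (lmul u) (lmul_linear u).

Fact er_linear i : linear (er i).
Proof. by move=> a u v; rewrite /er !linearP. Qed.
HB.instance Definition _ i := GRing.isLinear.Build K U U _ (er i) (er_linear i).

Fact fs_linear i : linear (fs i).
Proof. by move=> a u v; rewrite /fs !linearP. Qed.
HB.instance Definition _ i := GRing.isLinear.Build K U U _ (fs i) (fs_linear i).

Lemma Qn0 i : Q i != 0. Proof. exact: Q_neq0. Qed.

Lemma Qz0 i m : Q i ^ m != 0. Proof. by rewrite expfz_neq0 ?Qn0. Qed.

Lemma QD i m n : Q i ^ (m + n) = Q i ^ m * Q i ^ n. Proof. exact: QzD. Qed.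

Lemma qn0 i n : qn i n.+1 != 0. Proof. exact/qnum_neq0/bd_gt0. Qed.

Lemma qf0 i n : qf i n != 0. Proof. exact/qfac_neq0/bd_gt0. Qed.

Lemma qnE i n : qn i n.+1 = Q i ^ (- n%:Z) * sn i n.+1.
Proof. exact/qnumE/bd_gt0. Qed.

Lemma fdE i n : fd i n = (qf i n)^-1 *: f i ^+ n.
Proof. by rewrite fd.unlock. Qed.

Lemma fd0 i : fd i 0 = 1.
Proof. by rewrite fd.unlock qfac0 invr1 scale1r expr0. Qed.

Lemma fd1 i : fd i 1 = f i.
Proof.
rewrite fd.unlock qfacS qfac0 mul1r qnE oppr0 expr0z mul1r snum.unlock big_ord1 expr0.
by rewrite invr1 scale1r expr1.
Qed.

Lemma f_fd i n : f i * fd i n = qn i n.+1 *: fd i n.+1.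
Proof.
rewrite fd.unlock -scalerAr -exprS scalerA qfacS invfM mulrCA mulfV ?qn0 //.
by rewrite mulr1.
Qed.

Lemma fd_f i n : fd i n * f i = qn i n.+1 *: fd i n.+1.
Proof. by rewrite -f_fd fd.unlock -scalerAr -scalerAl -exprSr -exprS. Qed.

Lemma fdM i m n : fd i m * fd i n = qb i m n *: fd i (m + n).
Proof.
rewrite fd.unlock -scalerAr -scalerAl -exprD !scalerA; congr (_ *: _).
rewrite qbin.unlock; move: (qf0 i (m + n)) (qf0 i m) (qf0 i n).
by move=> h1 h2 h3; field; rewrite h1 h2 h3.
Qed.

Lemma st_fd i n : st (fd i n) = fd i n.
Proof.
rewrite fd.unlock linearZ; congr (_ *: _); elim: n => [|n IH]; first exact: st1.
by rewrite [in LHS]exprS stM IH stf -exprSr.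
Qed.

Lemma st_fdM i n u : st (fd i n * u) = st u * fd i n.
Proof. by rewrite stM st_fd. Qed.

Lemma st_Mfd i n u : st (u * fd i n) = fd i n * st u.
Proof. by rewrite stM st_fd. Qed.

Lemma ftd i n u : e i u = 0 -> ft i (fd i n * u) = fd i n.+1 * u.
Proof. by rewrite fd.unlock; exact: ftE. Qed.

Lemma formDr u v w : form u (v + w) = form u v + form u w.
Proof. by rewrite formC formDl !(formC u). Qed.

Lemma formZr a u v : form u (a *: v) = a * form u v.
Proof. by rewrite formC formZl formC. Qed.

Lemma form0l u : form 0 u = 0.
Proof. by rewrite -[0 in LHS](scale0r u) formZl mul0r. Qed.

Lemma form0r u : form u 0 = 0. Proof. by rewrite formC form0l. Qed.

Lemma formNl u v : form (- u) v = - form u v.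
Proof. by rewrite -scaleN1r formZl mulN1r. Qed.

Lemma formNr u v : form u (- v) = - form u v.
Proof. by rewrite formC formNl formC. Qed.

Lemma formBl u v w : form (u - v) w = form u w - form v w.
Proof. by rewrite formDl formNl. Qed.

Lemma formBr u v w : form u (v - w) = form u v - form u w.
Proof. by rewrite formDr formNr. Qed.

Lemma form_suml (J : Type) (s : seq J) (P : pred J) (F : J -> U) v :
  form (\sum_(j <- s | P j) F j) v = \sum_(j <- s | P j) form (F j) v.
Proof.
apply: (big_ind2 (fun a b => form a v = b)) => // [|a b c d <- <-].
  exact: form0l.
exact: formDl.
Qed.

Lemma form_sumr (J : Type) (s : seq J) (P : pred J) (F : J -> U) v :
  form v (\sum_(j <- s | P j) F j) = \sum_(j <- s | P j) form v (F j).
Proof. by rewrite formC form_suml; apply: eq_bigr => j _; rewrite formC. Qed.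

Lemma eff i u : e i (f i * u) = Q i ^ (- 2 : int) *: (f i * e i u) + u.
Proof. by rewrite bef eqxx cart_diag. Qed.

Lemma e_fd i n u : e i (fd i n.+1 * u) =
  Q i ^ (- (2 * n.+1)%N%:Z) *: (fd i n.+1 * e i u) + Q i ^ (- n%:Z) *: (fd i n * u).
Proof.
elim: n u => [|n IH] u.
  by rewrite fd1 fd0 mul1r eff oppr0 expr0z scale1r.
apply: (scalerI (qn0 i n.+1)); rewrite -linearZ /= scalerAl -f_fd -mulrA eff IH.
rewrite mulrDr -!scalerAr !scalerDr !scalerA.
rewrite !(mulrA (f i)) !f_fd -!scalerAl !scalerA -addrA; congr (_ *: _ + _).
  by rewrite [RHS]mulrC -QD; congr (_ ^ _ * _); lia.
rewrite -[X in _ + X]scale1r -scalerDl; congr (_ *: _).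
rewrite -(addn1 n.+1) qnumD ?bd_gt0 // mulrDl.
have -> : qn i 1 = 1 by rewrite qnE oppr0 expr0z mul1r snum.unlock big_ord1 expr0.
rewrite mulr1 (exprnP (Q i) n.+1) -!QD subrr expr0z addrC; congr (_ + _).
rewrite expr1 mulrAC -[(Q i)^-1]exprN1 -QD.
by congr (_ ^ _ * _); lia.
Qed.

Lemma e_fd_ker i n u : e i u = 0 -> e i (fd i n.+1 * u) = Q i ^ (- n%:Z) *: (fd i n * u).
Proof. by move=> eu; rewrite e_fd eu mulr0 scaler0 add0r. Qed.

(** * Degrees and weights *)

Lemma wt_nil i : wt [::] i = 0. Proof. by rewrite /wt big_nil oppr0. Qed.

Lemma wt_cons j w i : wt (j :: w) i = wt w i - cart i j.
Proof. by rewrite /wt big_cons opprD addrC. Qed.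

Lemma hom_ht h c u : hom h c u -> ht h u.
Proof. by apply: span_sub => // x [w [hw _] ->]; apply: spanX; exists w. Qed.

Lemma hom_eq h c c' u : c =1 c' -> hom h c u -> hom h c' u.
Proof.
move=> cc'; apply: span_sub => // x [w [hw wc] ->].
by apply: spanX; exists w => //; split=> // i; rewrite wc.
Qed.

Lemma hom_fw w : hom (size w) (wt w) (fw w).
Proof. by apply: spanX; exists w. Qed.

Lemma hom1 : hom 0 (fun=> 0) 1.
Proof. by apply: spanX; exists [::] => //; split=> // i; rewrite wt_nil. Qed.

Lemma hom_f j h c u : hom h c u -> hom h.+1 (fun i => c i - cart i j) (f j * u).
Proof.
apply: (span_linear (g := lmul (f j))) => x [w [hw wc] ->].
apply: spanX; exists (j :: w) => //; split; first by rewrite /= hw.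
by move=> i; rewrite wt_cons wc.
Qed.

Lemma ht_f j h u : ht h u -> ht h.+1 (f j * u).
Proof.
apply: (span_linear (g := lmul (f j))) => x [w hw ->].
by apply: spanX; exists (j :: w); rewrite /= ?hw.
Qed.

Lemma homZ h c a u : hom h c u -> hom h c (a *: u). Proof. exact: spanZ. Qed.
Lemma homN h c u : hom h c u -> hom h c (- u).
Proof. by rewrite -scaleN1r; apply: homZ. Qed.
Lemma homB h c u v : hom h c u -> hom h c v -> hom h c (u - v).
Proof. by move=> hu hv; apply: spanD hu (homN hv). Qed.
Lemma htZ h a u : ht h u -> ht h (a *: u). Proof. exact: spanZ. Qed.
Lemma htN h u : ht h u -> ht h (- u).
Proof. by rewrite -scaleN1r; apply: htZ. Qed.
Lemma htB h u v : ht h u -> ht h v -> ht h (u - v).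
Proof. by move=> hu hv; apply: spanD hu (htN hv). Qed.

Lemma hom_e_fw i w : if w is _ :: w' then
  hom (size w') (fun k => wt w k + cart k i) (e i (fw w)) else e i (fw w) = 0.
Proof.
elim: w => [|j w IH]; first exact: be1.
rewrite /= bef; apply: spanD.
  apply: homZ; case: w IH => [|k w] IH; first by rewrite IH mulr0; exact: span0.
  by apply: hom_eq (hom_f j IH) => l; rewrite !wt_cons; lia.
case: eqP => [<-|_]; last exact: span0.
by rewrite mulr1n; apply: hom_eq (hom_fw w) => l; rewrite wt_cons subrK.
Qed.

Lemma hom_e i h c u : hom h.+1 c u -> hom h (fun k => c k + cart k i) (e i u).
Proof.
apply: span_linear => _ [w [hw wc] ->]; case: w hw wc => // j w [<-] wc.
by apply: hom_eq (hom_e_fw i (j :: w)) => k; rewrite wc.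
Qed.

Lemma hom_e0 i c u : hom 0 c u -> e i u = 0.
Proof.
by apply: span_linear0 => _ [w [/size0nil -> _] ->]; exact: be1.
Qed.

Lemma ht_e i h u : ht h.+1 u -> ht h (e i u).
Proof.
apply: span_linear => _ [w hw ->]; case: w hw => // j w [<-].
exact: hom_ht (hom_e_fw i (j :: w)).
Qed.

Lemma ht_e0 i u : ht 0 u -> e i u = 0.
Proof. by apply: span_linear0 => _ [w /size0nil -> ->]; exact: be1. Qed.

Lemma ht0P u : ht 0 u -> exists a, u = a *: 1.
Proof.
elim=> [|v [w /size0nil -> ->]|v w _ [a ->] _ [b ->]|a v _ _ [b ->]].
- by exists 0; rewrite scale0r.
- by exists 1; rewrite scale1r.
- by exists (a + b); rewrite scalerDl.
- by exists (a * b); rewrite scalerA.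
Qed.

Lemma hom_ind (P : U -> Prop) : (forall w, P (fw w)) ->
  (forall u v, P u -> P v -> P (u + v)) -> (forall a u, P u -> P (a *: u)) ->
  forall u, P u.
Proof.
move=> Pw PD PZ u.
suff [] : P u /\ (forall j, True) by [].
split=> //; suff : span (@predT K) (fun u => exists w, u = fw w) u.
  elim=> [|x [w ->] //|x y _ hx _ hy|a x _ _ hx]; [|exact: PD|exact: PZ].
  by rewrite -(scale0r (fw [::])); apply: PZ.
elim/(@bgen B): u => [|j u hu|u v hu hv|a u hu].
- by apply: spanX; exists [::].
- apply: (span_linear (g := lmul (f j))) hu => _ [w ->].
  by apply: spanX; exists (j :: w).
- exact: spanD.
- exact: spanZ.
Qed.

(** To reach the last letter, e'_i crosses all of w and picks up Q_i^(-<h_i, alpha_k>) at each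
    letter k, in total [Q i ^ wt w i]. This factor is why vectors must carry a weight below. *)
Lemma e_fw_f i j w : e i (fw w * f j) =
  e i (fw w) * f j + (Q i ^ wt w i *: fw w) *+ (i == j).
Proof.
elim: w => [|k w IH].
  by rewrite /= mul1r -[f j]mulr1 bef be1 mulr0 scaler0 mul0r !add0r wt_nil
     expr0z scale1r.
rewrite /= -mulrA !bef IH mulrDr scalerDr mulrDl -!addrA -scalerAl -mulrA.
congr (_ + _); rewrite addrC mulrnAl; congr (_ + _).
case: eqP => [_|_]; rewrite ?mulr0n ?mulr0 ?scaler0 // !mulr1n.
by rewrite -scalerAr scalerA -QD wt_cons addrC.
Qed.

Lemma e_f i j h c u : hom h c u ->
  e i (u * f j) = e i u * f j + (Q i ^ c i *: u) *+ (i == j).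
Proof.
elim=> {u} [|u [w [_ wc] ->]|u v _ hu _ hv|a u _ _ hu].
- by rewrite mul0r !linear0 mul0r ?scaler0 mul0rn addr0.
- by rewrite e_fw_f wc.
- by rewrite mulrDl !(linearD (e i)) hu hv mulrDl /= scalerDr mulrnDl addrACA.
- rewrite -scalerAl !(linearZ_LR (e i)) /= hu /= scalerDr -scalerAl; congr (_ + _).
  by rewrite -scalerMnr !scalerA mulrC.
Qed.

Lemma e_f_neq i j u : i != j -> e i (u * f j) = e i u * f j.
Proof.
move=> ij; elim/hom_ind: u => [w|u v hu hv|a u hu].
- by rewrite e_fw_f (negPf ij) addr0.
- by rewrite mulrDl !linearD hu hv mulrDl.
- by rewrite -scalerAl !linearZ hu -scalerAl.
Qed.

Lemma st_fw w : st (fw w) = fw (rev w).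
Proof.
elim: w => [|j w IH]; first exact: st1.
rewrite /= stM IH stf rev_cons; elim: (rev w) => [|k s IHs] /=.
  by rewrite mul1r mulr1.
by rewrite -mulrA IHs.
Qed.

Lemma hom_st h c u : hom h c u -> hom h c (st u).
Proof.
apply: span_linear => _ [w [hw wc] ->]; rewrite st_fw.
apply: spanX; exists (rev w) => //; rewrite size_rev; split=> // i.
by rewrite -wc /wt; congr (- _); apply: perm_big; rewrite perm_rev.
Qed.

Lemma ht_st h u : ht h u -> ht h (st u).
Proof.
apply: span_linear => _ [w hw ->]; rewrite st_fw.
by apply: spanX; exists (rev w) => //; rewrite size_rev.
Qed.

Lemma hom_Mf j h c u : hom h c u -> hom h.+1 (fun i => c i - cart i j) (u * f j).
Proof. by move=> /hom_st /(hom_f j) /hom_st; rewrite stM stK stf. Qed.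

Lemma er_f i j h c u : hom h c u ->
  er i (f j * u) = f j * er i u + (Q i ^ c i *: u) *+ (i == j).
Proof.
move=> /hom_st hu; rewrite /er stM stf (e_f _ _ hu) linearD stM stf.
by rewrite raddfMn /= linearZ stK.
Qed.

Lemma er_Mff i u : er i (u * f i) = Q i ^ (- 2 : int) *: (er i u * f i) + u.
Proof. by rewrite /er stM stf eff linearD linearZ /= stM stf stK. Qed.

Lemma er1 i : er i 1 = 0. Proof. by rewrite /er st1 be1 linear0. Qed.

Lemma Q_cart i j : Q i ^ (- cart i j) = Q j ^ (- cart j i).
Proof. by rewrite !Q_expz !mulrN cart_sym. Qed.

(** Comparing the two orders leaves the factors Q_i^(-a_ij) and Q_j^(a_ji) at a letter j; they
    cancel because the Cartan matrix is symmetrizable ([Q_cart]). *)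
Lemma e_er i j u : e i (er j u) = er j (e i u).
Proof.
elim/hom_ind: u => [w|u v hu hv|a u hu]; last 2 first.
- by rewrite !linearD /= hu hv.
- by rewrite !linearZ /= hu.
elim: w => [|k w IH]; first by rewrite er1 be1 !linear0.
have hk : hom (size w) (wt w) (fw w) := hom_fw w.
rewrite /= (er_f _ _ hk) !linearD !bef linearD linearZ /= IH.
rewrite !raddfMn /= linearZ /=.
have -> : er j (f k * e i (fw w)) = f k * er j (e i (fw w)) +
    (Q j ^ (wt w j + cart j i) *: e i (fw w)) *+ (j == k).
  case: w hk {IH} => [|l w] hk.
    by rewrite /= be1 mulr0 !linear0 mulr0 mul0rn addr0.
  by rewrite (er_f _ _ (hom_e_fw i (l :: w))).
rewrite scalerDr -!addrA; congr (_ + _); rewrite addrC; congr (_ + _).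
case: eqP => [->|_]; rewrite ?mulr0n ?scaler0 // !mulr1n scalerA.
by rewrite Q_cart -QD; congr (_ ^ _ *: _); lia.
Qed.

Lemma form1_ht h u : ht h.+1 u -> form 1 u = 0.
Proof.
elim=> {u} [|u [[|j w] // _ ->]|u v _ hu _ hv|a u _ _ hu].
- exact: form0r.
- by rewrite formC formf be1 form0r.
- by rewrite formDr hu hv addr0.
- by rewrite formZr hu mulr0.
Qed.

(** Peeling letters off the left of u reduces to u = 1, by [formf] and [e_er]. There only the part
    of v in degree 1 contributes, and [e] and [er] agree on it. *)
Lemma formMf i u v : form (u * f i) v = form u (er i v).
Proof.
elim/hom_ind: u v => [w|u u' hu hu'|a u hu] v; last 2 first.
- by rewrite mulrDl !formDl hu hu'.
- by rewrite -scalerAl !formZl hu.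
elim: w v => [|j w IH] v; last by rewrite /= -mulrA !formf IH e_er.
rewrite /= mul1r -[f i]mulr1 formf.
elim/hom_ind: v => [w|u u' hu hu'|a u hu]; last 2 first.
- by rewrite !linearD !formDr hu hu'.
- by rewrite !linearZ !formZr hu.
case: w => [|j w]; first by rewrite be1 er1.
rewrite bef (er_f _ _ (hom_fw w)) !formDr formZr.
rewrite [form 1 (f j * e i _)]formC [form 1 (f j * er i _)]formC !formf be1 !form0r.
rewrite mulr0 !add0r; case: eqP => _ //; rewrite ?mulr0n // !mulr1n formZr.
case: w => [|k w]; first by rewrite wt_nil expr0z mul1r.
by rewrite (form1_ht (h := size w)) ?mulr0 //; apply: hom_ht (hom_fw (k :: w)).
Qed.

Lemma form_st u v : form (st u) (st v) = form u v.
Proof.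
elim/hom_ind: u v => [w|u u' hu hu'|a u hu] v; last 2 first.
- by rewrite linearD !formDl hu hu'.
- by rewrite linearZ !formZl hu.
elim: w v => [|j w IH] v; last first.
  by rewrite /= stM stf formMf formf /er stK IH.
rewrite st1; elim/hom_ind: v => [w|u u' hu hu'|a u hu]; last 2 first.
- by rewrite linearD !formDr hu hu'.
- by rewrite linearZ !formZr hu.
case: w => [|k w]; first by rewrite st1.
have h := hom_ht (hom_fw (k :: w)).
by rewrite !(form1_ht (h := size w)) //; apply: ht_st.
Qed.

(** The closure properties used by the decomposition into f_i^(n) ker e'_i, so that it holds at once
    by degree ([ht]), by weight ([homs]) and over the integral form ([htRU]). The last one does not
    admit all scalars, hence only signs and powers of Q_i. *)
Definition efam i (X : nat -> U -> Prop) : Prop :=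
  [/\ forall n u v, X n u -> X n v -> X n (u + v),
      forall n m u, X n u -> X n (Q i ^ m *: u),
      forall n u, X n u -> X n (- u),
      forall (k n : nat) u, X k u -> X (k + n)%N (fd i n * u)
    & (forall n, X n 0) /\
      forall n u, X n u -> if n is n'.+1 then X n' (e i u) else e i u = 0].

(** Integrate e'_i u, decomposed by induction: on the kernel, e'_i f_i^(n+1) = Q_i^(-n) f_i^(n), so
    shifting each component with the factor Q_i^n gives a vector with the same image under e'_i, and
    the difference is the component n = 0. *)
Lemma ldec i X h u : efam i X -> X h u -> exists s : nat -> U,
  [/\ forall n, e i (s n) = 0, forall n, (n <= h)%N -> X (h - n)%N (s n) &
      u = \sum_(n < h.+1) fd i n * s n].
Proof.
move=> [XD XQ XN Xf [X0 Xe]]; elim: h u => [|h IH] u Xu.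
  exists (fun n => if n is 0%N then u else 0); split.
  - by case=> [|n]; rewrite ?linear0 //; apply: (Xe 0%N).
  - by case.
  - by rewrite big_ord1 fd0 mul1r.
have [s [es Xs eu]] := IH _ (Xe _ _ Xu).
pose u' := \sum_(n < h.+1) fd i n.+1 * (Q i ^ (n%:Z) *: s n).
have Xu' : X h.+1 u'.
  apply: (big_ind (X h.+1)) => [|x y|n _]; [exact: X0|exact: XD|].
  have nh : (n <= h)%N by rewrite -ltnS.
  have := Xf _ n.+1 _ (XQ _ n%:Z _ (Xs _ nh)).
  by rewrite -addSnnS -subSn // subnK // ltnW.
have eu' : e i u' = e i u.
  rewrite eu linear_sum /=; apply: eq_bigr => n _.
  rewrite e_fd_ker; last by rewrite linearZ /= es scaler0.
  by rewrite -scalerAr scalerA -QD addNr expr0z scale1r.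
exists (fun n => if n is n'.+1 then Q i ^ (n'%:Z) *: s n' else u - u'); split.
- case=> [|n]; first by rewrite linearB /= eu' subrr.
  by rewrite linearZ /= es scaler0.
- case=> [|n] nh; first by rewrite subn0; apply: XD Xu (XN _ _ Xu').
  by rewrite subSS; apply/XQ/Xs.
- by rewrite big_ord_recl fd0 mul1r subrK.
Qed.

Lemma ker_uniq i N (s : nat -> U) : (forall n, e i (s n) = 0) ->
  \sum_(n < N) fd i n * s n = 0 -> forall n, (n < N)%N -> s n = 0.
Proof.
elim: N s => // N IH s es s0.
have s1 n : (n < N)%N -> s n.+1 = 0.
  move=> nN; apply: (scalerI (Qz0 i (- n%:Z))); rewrite scaler0.
  apply: (IH (fun n => Q i ^ (- n%:Z) *: s n.+1)) => // [m|].
    by rewrite linearZ /= es scaler0.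
  have := congr1 (e i) s0; rewrite linear0 linear_sum big_ord_recl /=.
  rewrite fd0 mul1r es add0r => {2}<-; apply: eq_bigr => m _.
  by rewrite e_fd_ker // scalerAr.
case=> [_|n /s1 //]; move: s0; rewrite big_ord_recl fd0 mul1r big1 ?addr0 //.
by move=> m _; rewrite s1 ?mulr0.
Qed.

Lemma ft_sum i N (s : nat -> U) : (forall n, e i (s n) = 0) ->
  ft i (\sum_(n < N) fd i n * s n) = \sum_(n < N) fd i n.+1 * s n.
Proof. by move=> es; rewrite linear_sum; apply: eq_bigr => n _; apply: ftd. Qed.

Lemma hom_fd i n h c u : hom h c u ->
  hom (h + n) (fun l => c l - n%:Z * cart l i) (fd i n * u).
Proof.
move=> hu; rewrite fd.unlock -scalerAl; apply: homZ.
elim: n => [|n IH]; first by rewrite expr0 mul1r addn0; apply: hom_eq hu => l; lia.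
by rewrite exprS -mulrA addnS; apply: hom_eq (hom_f i IH) => l; lia.
Qed.

Lemma ht_fd i n h u : ht h u -> ht (h + n) (fd i n * u).
Proof.
move=> hu; rewrite fd.unlock -scalerAl; apply: htZ.
elim: n => [|n IH]; first by rewrite expr0 mul1r addn0.
by rewrite exprS -mulrA addnS; apply: ht_f.
Qed.

Lemma ht_Mfd i n h u : ht h u -> ht (h + n) (u * fd i n).
Proof. by move=> /ht_st /(ht_fd i n) /ht_st; rewrite st_fdM stK. Qed.

Lemma ht_efam i : efam i ht.
Proof.
split=> [n u v|n m u|n u|k n u|]; [exact: spanD|exact: htZ|exact: htN|exact: ht_fd|].
by split=> [n|[|n] u]; [exact: span0|exact: ht_e0|exact: ht_e].
Qed.

(** The weight left after removing h - k letters i from a vector of degree h and weight c; the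
    components given by [ldec] are of this type. *)
Definition homs i h (c : I -> int) (k : nat) : U -> Prop :=
  hom k (fun l => c l + (h%:Z - k%:Z) * cart l i).

Lemma homs_self i h c u : hom h c u -> homs i h c h u.
Proof. by apply: hom_eq => l; rewrite subrr mul0r addr0. Qed.

Lemma homs_efam i h c : efam i (homs i h c).
Proof.
split=> [n u v|n m u|n u|k n u|]; [exact: spanD|exact: homZ|exact: homN| |].
  by move=> /(hom_fd i n); apply: hom_eq => l; lia.
split=> [n|[|n] u]; [exact: span0|exact: hom_e0|].
by move=> /(hom_e i); apply: hom_eq => l; lia.
Qed.

Lemma RU_fd i n u : RU u -> RU (fd i n * u).
Proof.
apply: (span_linear (g := lmul (fd i n))) => _ [s ->].
by apply: spanX; exists ((i, n) :: s).
Qed.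

Lemma e_fd_neq i j n u : i != j ->
  e i (fd j n * u) = Q i ^ (- (n%:Z * cart i j)) *: (fd j n * e i u).
Proof.
move=> ij; rewrite fd.unlock -!scalerAl linearZ /= scalerA mulrC -scalerA.
congr (_ *: _); elim: n => [|n IH].
  by rewrite !expr0 !mul1r mul0r oppr0 expr0z scale1r.
rewrite exprS -!mulrA bef (negPf ij) addr0 IH -scalerAr scalerA -QD.
by congr (_ ^ _ *: _); lia.
Qed.

Lemma RU_e i u : RU u -> RU (e i u).
Proof.
apply: span_linear => _ [s ->]; elim: s => [|[j n] s IH] /=.
  by rewrite be1; exact: span0.
have hs : RU (foldr (fun p u => fd p.1 p.2 * u) 1 s) by apply: spanX; exists s.
have zQ m : Q i ^ m \in zint (bV B) by exact: zint_Q.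
have [<-{j}|ij] := eqVneq i j; last first.
  by rewrite e_fd_neq //; apply: spanZ (zQ _) (RU_fd _ _ IH).
case: n => [|n]; first by rewrite fd0 mul1r.
by rewrite e_fd; apply: spanD; apply: spanZ (zQ _) (RU_fd _ _ _).
Qed.

Definition htRU h u : Prop := ht h u /\ RU u.

Lemma htRU_efam i : efam i htRU.
Proof.
have [hD hQ hN hf [h0 he]] := ht_efam i.
split=> [n u v [? ?] [? ?]|n m u [? ?]|n u [? ?]|k n u [? ?]|].
- by split; [apply: hD|apply: spanD].
- by split; [apply: hQ|apply: spanZ => //; exact: zint_Q].
- by split; [apply: hN|apply: spanN].
- by split; [apply: hf|apply: RU_fd].
- split=> [n|n u [hu Ru]]; first by split; [exact: h0|exact: span0].
  by case: n hu => [|n] hu; [exact: (he 0%N)|split; [exact: (he n.+1)|exact: RU_e]].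
Qed.

(** Letters are moved across by adjunction, leaving inverse q-factorials, which lie in [zint]. A
    regular value of the form thus has an integer value at q = 0. *)
Lemma form_RU u v : RU u -> RU v -> form u v \in zint (bV B).
Proof.
elim=> {u} [|_ [s ->]|u u' _ hu _ hu'|a u aS _ hu] Rv.
- by rewrite form0l rpred0.
- elim: s v Rv => [|[i n] s IH] v Rv /=.
    elim: Rv => {v} [|_ [s ->]|u u' _ hu _ hu'|a u aS _ hu].
    + by rewrite form0r rpred0.
    + elim: s => [|[i n] s IH] /=; first by rewrite form1 rpred1.
      case: n => [|n]; first by rewrite fd0 mul1r.
      by rewrite formC fdE -scalerAl exprS -mulrA formZl formf be1 form0r
         mulr0 rpred0.
    + by rewrite formDr rpredD.
    + by rewrite formZr rpredM.
  rewrite fdE -scalerAl formZl rpredM //; first exact/zint_qfacV/bd_gt0.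
  elim: n v Rv => [|n IHn] v Rv; first by rewrite expr0 mul1r; apply: IH.
  by rewrite exprS -mulrA formf; apply/IHn/RU_e.
- by rewrite formDl rpredD ?hu ?hu'.
- by rewrite formZl rpredM ?hu.
Qed.

Lemma htRU_ft i h u : htRU h u -> htRU h.+1 (ft i u).
Proof.
move=> /(ldec (htRU_efam i)) [s [es hs ->]]; rewrite ft_sum //.
have [hD hQ hN hf [h0 he]] := htRU_efam i.
apply: (big_ind (htRU h.+1)) => [|x y|n _]; [exact: h0|exact: hD|].
have nh : (n <= h)%N by rewrite -ltnS.
by have := hf _ n.+1 _ (hs _ nh); rewrite -addSnnS -subSn // subnK // ltnW.
Qed.

Lemma htRU_tw w : htRU (size w) (tw w).
Proof.
elim: w => [|i w IH]; last exact: htRU_ft.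
by split; apply: spanX; exists [::].
Qed.

Lemma ht_ft i h u : ht h u -> ht h.+1 (ft i u).
Proof.
move=> /(ldec (ht_efam i)) [s [es hs ->]]; rewrite ft_sum //.
apply: span_sum => n _; have nh : (n <= h)%N by rewrite -ltnS.
by have := ht_fd i n.+1 (hs _ nh); rewrite -addSnnS -subSn // subnK // ltnW.
Qed.

Lemma hom_ft i h c u : hom h c u -> hom h.+1 (fun l => c l - cart l i) (ft i u).
Proof.
move=> hu; have [s [es hs ->]] := ldec (homs_efam i h c) (homs_self i hu).
rewrite ft_sum //; apply: span_sum => n _.
have nh : (n <= h)%N by rewrite -ltnS.
have := hom_fd i n.+1 (hs n nh); have -> : (h - n + n.+1 = h.+1)%N by lia.
have e1 : h%:Z - (h - n)%N%:Z = n%:Z by lia.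
by apply: hom_eq => l; rewrite e1; lia.
Qed.

Lemma hom_tw w : hom (size w) (wt w) (tw w).
Proof.
elim: w => [|i w IH]; first exact: hom_fw [::].
by apply: hom_eq (hom_ft i IH) => l; rewrite wt_cons.
Qed.

Lemma ht_L h u : L h u -> ht h u.
Proof.
apply: span_sub => // _ [w <- ->]; exact: (htRU_tw w).1.
Qed.

(* The right-handed versions are obtained by applying the anti-involution. *)
Lemma rdec i h u : ht h u -> exists s : nat -> U,
  [/\ forall n, er i (s n) = 0, forall n, (n <= h)%N -> ht (h - n)%N (s n) &
      u = \sum_(n < h.+1) s n * fd i n].
Proof.
move=> /ht_st /(ldec (ht_efam i)) [s [es hs us]].
exists (fun n => st (s n)); split=> [n|n /hs|].
- by rewrite /er stK es linear0.
- exact: ht_st.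
- by rewrite -[u]stK us linear_sum; apply: eq_bigr => n _; rewrite /= st_fdM.
Qed.

Lemma hom_rdec i h c u : hom h c u -> exists s : nat -> U,
  [/\ forall n, er i (s n) = 0, forall n, (n <= h)%N -> homs i h c (h - n) (s n) &
      u = \sum_(n < h.+1) s n * fd i n].
Proof.
move=> /hom_st /(homs_self i) /(ldec (homs_efam i h c)) [s [es hs us]].
exists (fun n => st (s n)); split=> [n|n /hs|].
- by rewrite /er stK es linear0.
- exact: hom_st.
- by rewrite -[u]stK us linear_sum; apply: eq_bigr => n _; rewrite /= st_fdM.
Qed.

Lemma fsd i n u : er i u = 0 -> fs i (u * fd i n) = u * fd i n.+1.
Proof.
move=> /(congr1 st); rewrite /er stK linear0 => eu.
by rewrite /fs st_Mfd ftd // st_fdM stK.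
Qed.

Lemma fs_sum i N (s : nat -> U) : (forall n, er i (s n) = 0) ->
  fs i (\sum_(n < N) s n * fd i n) = \sum_(n < N) s n * fd i n.+1.
Proof. by move=> es; rewrite linear_sum; apply: eq_bigr => n _; apply: fsd. Qed.

Lemma e_er0 i j u : er i u = 0 -> er i (e j u) = 0.
Proof. by move=> eu; rewrite -e_er eu linear0. Qed.

Lemma e_Mfd_neq i j n u : i != j -> e i (u * fd j n) = e i u * fd j n.
Proof.
move=> ij; rewrite fd.unlock -!scalerAr linearZ; congr (_ *: _) => /=.
elim: n u => [|n IH] u; first by rewrite !expr0 !mulr1.
by rewrite exprS !mulrA IH e_f_neq.
Qed.

Lemma e_fs i j h u : i != j -> ht h u -> e j (fs i u) = fs i (e j u).
Proof.
move=> ij /(rdec i) [s [es _ ->]]; rewrite fs_sum // !linear_sum /=.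
apply: eq_bigr => n _; rewrite !e_Mfd_neq 1?eq_sym // fsd //.
exact: e_er0.
Qed.

Lemma er_fd_neq i j n u : i != j -> er i (fd j n * u) = fd j n * er i u.
Proof. by move=> ij; rewrite /er st_fdM e_Mfd_neq // st_Mfd. Qed.

Lemma fd_fs i j n h u : i != j -> ht h u -> fs i (fd j n * u) = fd j n * fs i u.
Proof.
move=> ij /(rdec i) [s [es _ ->]]; rewrite fs_sum // !mulr_sumr linear_sum /=.
apply: eq_bigr => m _; rewrite !mulrA fsd // er_fd_neq // es mulr0.
by [].
Qed.

(** For i != j, e'_j commutes with right multiplication by f_i, so left and right operators commute
    exactly. The difficulty of the loop sits in i = j. *)
Lemma ft_fs i j h u : i != j -> ht h u -> ft j (fs i u) = fs i (ft j u).
Proof.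
move=> ij /(ldec (ht_efam j)) [s [es hs ->]]; rewrite ft_sum // !linear_sum /=.
apply: eq_bigr => n _; have nh : (n <= h)%N by rewrite -ltnS.
rewrite !(fd_fs _ ij (hs n nh)) ftd // (e_fs ij (hs n nh)) es linear0 //.
Qed.

Lemma form_f_ker i u v : e i v = 0 -> form (f i * u) v = 0.
Proof. by move=> ev; rewrite formf ev form0r. Qed.

(** Each adjunction produces Q_i^(-m) from e'_i and the inverse of [m + 1]_i from the divided power;
    the powers of Q_i cancel and leave a factor of value 1 at q = 0. This is the source of the
    isometry [form_ft]. *)
Lemma form_fd_ker i m n u v : e i u = 0 -> e i v = 0 ->
  form (fd i m * u) (fd i n * v) = (m == n)%:R * ((sf i m)^-1 * form u v).
Proof.
move=> eu ev; elim: m n => [|m IH] [|n].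
- by rewrite !fd0 !mul1r sfac0 invr1 !mul1r.
- rewrite fd0 mul1r formC mul0r fd.unlock exprS -scalerAl formZl -mulrA.
  by rewrite form_f_ker // mulr0.
- rewrite fd0 mul1r mul0r fd.unlock exprS -scalerAl formZl -mulrA.
  by rewrite form_f_ker // mulr0.
- apply: (mulfI (qn0 i m)); rewrite -formZl scalerAl -f_fd -mulrA formf.
  rewrite e_fd_ker // formZr IH eqSS; case: eqP => [<-|_]; last by rewrite !(mul0r, mulr0).
  rewrite !mul1r qnE sfacS.
  have := snum_neq0 (bV B) (bd_gt0 i) (isT : 0 < m.+1)%N.
  have := sfac_neq0 (bV B) (bd_gt0 i) m.
  move: (Q i ^ _) (sn i m.+1) (sf i m) (form u v) => a b c d c0 b0.
  by field; rewrite b0 c0.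
Qed.

Lemma form_sum_ker i N (c1 c2 : nat -> nat) (s t : nat -> U) :
    injective c1 -> c1 =1 c2 ->
    (forall n, e i (s n) = 0) -> (forall n, e i (t n) = 0) ->
  form (\sum_(n < N) fd i (c1 n) * s n) (\sum_(n < N) fd i (c2 n) * t n) =
  \sum_(n < N) (sf i (c1 n))^-1 * form (s n) (t n).
Proof.
move=> inj cc es ht; rewrite form_suml; apply: eq_bigr => n _.
rewrite form_sumr (bigD1 n) //= form_fd_ker // -cc eqxx mul1r big1 ?addr0 //.
move=> m mn; rewrite form_fd_ker // -cc (inj_eq inj) eq_sym.
by rewrite (val_eqE m n) (negPf mn) mul0r.
Qed.

Lemma form_ldec i N (s t : nat -> U) :
    (forall n, e i (s n) = 0) -> (forall n, e i (t n) = 0) ->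
  form (\sum_(n < N) fd i n * s n) (\sum_(n < N) fd i n * t n) =
  \sum_(n < N) (sf i n)^-1 * form (s n) (t n).
Proof. by move=> es et; apply: (@form_sum_ker i N id id). Qed.

Lemma form_ft_ldec i N (s t : nat -> U) :
    (forall n, e i (s n) = 0) -> (forall n, e i (t n) = 0) ->
  form (ft i (\sum_(n < N) fd i n * s n)) (ft i (\sum_(n < N) fd i n * t n)) =
  \sum_(n < N) (sf i n.+1)^-1 * form (s n) (t n).
Proof. by move=> es et; rewrite !ft_sum //; apply: (@form_sum_ker i N S S) => // ? ? []. Qed.

Lemma ker_split i X h u : efam i X -> X h.+1 u -> exists u0 u',
  [/\ e i u0 = 0, X h.+1 u0, X h u' & u = u0 + ft i u'].
Proof.
move=> Xi /(ldec Xi) [s [es Xs us]]; have [XD XQ XN Xf [X0 Xe]] := Xi.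
exists (s 0%N), (\sum_(n < h.+1) fd i n * s n.+1); split=> //.
- by rewrite -[h.+1]subn0; apply: Xs.
- apply: (big_ind (X h)) => [|x y|n _]; [exact: X0|exact: XD|].
  have nh : (n <= h)%N by rewrite -ltnS.
  by have := Xf _ n _ (Xs n.+1 nh); rewrite subSS subnK.
- by rewrite (ft_sum _ (s := fun n => s n.+1)) // us big_ord_recl fd0 mul1r.
Qed.

Lemma split_uniq i h u0 u' : e i u0 = 0 -> ht h u' -> u0 + ft i u' = 0 -> u0 = 0.
Proof.
move=> eu /(ldec (ht_efam i)) [s [es hs ->]]; rewrite ft_sum // => h0.
pose t n := if n is n'.+1 then s n' else u0.
apply: (@ker_uniq i h.+2 t _ _ 0%N) => //; first by case.
by rewrite big_ord_recl fd0 mul1r.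
Qed.

End Boson.

(** * Rank one *)

(* Iterated q-commutators of f_i with a vector y of weight c; for y killed by
   e'_i and its mirror they are all killed by the mirror of e'_i, and they vanish
   for m > c. *)
HB.lock Definition zr (B : boson) (i : bI B) (c : int) (y : bU B) (m : nat) : bU B :=
  iteri m (fun n x => (qnum (bV B) (bd i) n.+1)^-1 *:
    (bf i * x - (vq (bV B) ^+ bd i) ^ (c - 2 * n%:Z) *: (x * bf i))) y.

Section RankOne.
Variable B : boson.
Local Notation K := (bK B).
Local Notation U := (bU B).
Local Notation I := (bI B).
Local Notation q := (vq (bV B)).
Local Notation A := (reg (bV B)).
Local Notation f := (@bf B).
Local Notation e := (@be B).
Local Notation st := (@st B).
Local Notation form := (@form B).
Local Notation ft := (@ft B).
Local Notation Q i := (vq (bV B) ^+ bd i).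
Local Notation qn i := (qnum (bV B) (bd i)).
Local Notation qf i := (qfac (bV B) (bd i)).
Local Notation sn i := (snum (bV B) (bd i)).
Local Notation sf i := (sfac (bV B) (bd i)).
Local Notation qb i := (qbin (bV B) (bd i)).
Implicit Types (i j k : I) (u v x y z : U).

Definition zl i c y m : U := st (zr i c (st y) m).

(** The scalar by which e'_i maps z_(m+1) to z_m, as in an sl_2-string ([zr_e]). It vanishes exactly
    for m = c, which ties the end of the string to the weight of y. *)
Definition kappa i (c : int) m : K :=
  Q i ^ (- m%:Z) * (1 - Q i ^ (2 * (c - m%:Z))).

Lemma zr0 i c y : zr i c y 0 = y. Proof. by rewrite zr.unlock. Qed.

Lemma zrS i c y m : zr i c y m.+1 = (qn i m.+1)^-1 *:
  (f i * zr i c y m - Q i ^ (c - 2 * m%:Z) *: (zr i c y m * f i)).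
Proof. by rewrite zr.unlock. Qed.

Lemma f_zr i c y m : f i * zr i c y m =
  qn i m.+1 *: zr i c y m.+1 + Q i ^ (c - 2 * m%:Z) *: (zr i c y m * f i).
Proof. by rewrite zrS scalerA mulfV ?qn0 // scale1r subrK. Qed.

Lemma QX i (m : int) n : (Q i ^ m) ^+ n = Q i ^ (m * n%:Z).
Proof. by rewrite (exprnP (Q i ^ m)) exprz_exp. Qed.

Lemma QV i (m : int) : (Q i ^ m)^-1 = Q i ^ (- m). Proof. exact: invr_expz. Qed.

(** The recursion left by one step of [zr_e]; a rational identity once Q_i, Q_i^m and Q_i^c are
    taken as independent variables. *)
Lemma kappa_rec i c m : Q i ^ (- 2 : int) * kappa i c m * qn i m.+1 +
    (1 - Q i ^ (2 * (c - 2 * m.+1%:Z))) = qn i m.+2 * kappa i c m.+1.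
Proof.
rewrite /kappa !qnE.
have := snumE (bV B) (bd i) m.+2; have := snumE (bV B) (bd i) m.+1.
have := Q2_neq1 (bV B) (bd_gt0 i).
have e1 : Q i ^ (- m.+1%:Z) = (Q i ^ m%:Z)^-1 * (Q i)^-1.
  by rewrite -invr_expz -invfM -exprSzr.
have Q1 : (Q i)^-1 = Q i ^ (-1 : int) by rewrite exprN1.
have e2 : Q i ^ (2 * (c - m%:Z)) = (Q i ^ c) ^+ 2 * (Q i ^ m%:Z)^-1 ^+ 2.
  by rewrite QV !QX -QD; congr (_ ^ _); lia.
have e3 : Q i ^ (2 * (c - 2 * m.+1%:Z)) =
    (Q i ^ c) ^+ 2 * (Q i ^ m%:Z)^-1 ^+ 4 * (Q i)^-1 ^+ 4.
  by rewrite Q1 QV !QX -!QD; congr (_ ^ _); lia.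
have e4 : Q i ^ (2 * (c - m.+1%:Z)) =
    (Q i ^ c) ^+ 2 * (Q i ^ m%:Z)^-1 ^+ 2 * (Q i)^-1 ^+ 2.
  by rewrite Q1 QV !QX -!QD; congr (_ ^ _); lia.
have e5 : (Q i ^+ 2) ^+ m.+1 = (Q i ^ m%:Z) ^+ 2 * Q i ^+ 2.
  by move: (Q i) => x; rewrite [LHS]exprSr exprAC.
have e6 : (Q i ^+ 2) ^+ m.+2 = (Q i ^ m%:Z) ^+ 2 * Q i ^+ 4.
  by move: (Q i) => x; rewrite -exprnP -!exprM -exprD; congr (_ ^+ _); lia.
have e7 : Q i ^ (- 2 : int) = (Q i)^-1 ^+ 2 by rewrite Q1 QX.
have e8 : Q i ^ (- m%:Z) = (Q i ^ m%:Z)^-1 by rewrite invr_expz.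
rewrite e1 e2 e3 e4 e5 e6 e7 e8.
move: (Qz0 i m%:Z) (Qn0 i) {Q1 e1 e2 e3 e4 e5 e6 e7 e8}.
move: (sn i m.+1) (sn i m.+2) (Q i ^ c) => s1 s2 yc.
move: (Q i ^ m%:Z) => x; move: (Q i) => Q X0 Q0 Q2 E1 E2.
have -> : s1 = (1 - x ^+ 2 * Q ^+ 2) / (1 - Q ^+ 2) by rewrite -E1 mulrAC divff ?mul1r.
have -> : s2 = (1 - x ^+ 2 * Q ^+ 4) / (1 - Q ^+ 2) by rewrite -E2 mulrAC divff ?mul1r.
by field; rewrite X0 Q0.
Qed.

Lemma kappa0 i c : 1 - Q i ^ (2 * c) = kappa i c 0.
Proof. by rewrite /kappa oppr0 expr0z mul1r subr0. Qed.

Lemma kappa_neq0 i c m : c != m%:Z -> kappa i c m != 0.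
Proof.
move=> cm; rewrite mulf_neq0 ?Qz0 //.
have key (z : int) : 0 < z -> 1 - Q i ^ z != 0.
  by move=> z0; apply/unit1_neq0/unit1_1BQ => //; apply: bd_gt0.
have [h|h|h] := ltrgtP (c - m%:Z) 0.
- have : 1 - Q i ^ (- (2 * (c - m%:Z))) != 0 by apply: key; lia.
  apply: contraNneq => /eqP; rewrite subr_eq0 => /eqP h1.
  by rewrite -invr_expz -h1 invr1 subrr.
- by apply: key; lia.
- by move: cm; rewrite -subr_eq0 h.
Qed.

Section Vec.
Variables (i : I) (h : nat) (cc : I -> int) (y : U).
Hypotheses (ey : e i y = 0) (ry : er i y = 0) (hy : hom h cc y).
Local Notation c := (cc i).
Local Notation z := (zr i c y).

Lemma zr_hom m : hom (h + m) (fun l => cc l - m%:Z * cart l i) (z m).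
Proof.
elim: m => [|m IH]; first by rewrite addn0 zr0; apply: hom_eq hy => l; lia.
rewrite addnS zrS; apply/homZ/homB; last apply: homZ.
- by apply: hom_eq (hom_f i IH) => l; lia.
- by apply: hom_eq (hom_Mf i IH) => l; lia.
Qed.

Lemma zr_wt m : c - m%:Z * cart i i = c - 2 * m%:Z.
Proof. by rewrite cart_diag mulrC. Qed.

(** The exponent c - 2m in [zr] is the weight of z_m at i, chosen for this: [er] maps f_i z_m to
    Q_i^(c-2m) z_m and z_m f_i to z_m. *)
Lemma zr_er m : er i (z m) = 0.
Proof.
elim: m => [|m IH]; first by rewrite zr0.
rewrite zrS linearZ linearB /=.
rewrite (er_f i i (zr_hom m)) IH mulr0 add0r eqxx mulr1n linearZ /= er_Mff IH.
by rewrite mul0r scaler0 add0r zr_wt subrr scaler0.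
Qed.

Lemma zr_e m : e i (z m.+1) = kappa i c m *: z m.
Proof.
have step n : qn i n.+1 *: e i (z n.+1) = Q i ^ (- 2 : int) *: (f i * e i (z n))
    - Q i ^ (c - 2 * n%:Z) *: (e i (z n) * f i)
    + (1 - Q i ^ (2 * (c - 2 * n%:Z))) *: z n.
  rewrite -linearZ.
  have -> : qn i n.+1 *: z n.+1 = f i * z n - Q i ^ (c - 2 * n%:Z) *: (z n * f i).
    by rewrite f_zr addrK.
  rewrite linearB /= eff linearZ /= (e_f i i (zr_hom n)) eqxx mulr1n zr_wt.
  rewrite scalerDr scalerA -QD.
  have -> : c - 2 * n%:Z + (c - 2 * n%:Z) = 2 * (c - 2 * n%:Z) by lia.
  move: (Q i ^ (2 * _)) (Q i ^ (c - _)) (Q i ^ (- 2 : int)) => a1 a2 a3.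
  by rewrite scalerBl scale1r opprD addrACA.
elim: m => [|m IH].
  apply: (scalerI (qn0 i 0)); rewrite step zr0 ey mulr0 mul0r !scaler0 subr0 add0r mulr0 subr0 kappa0.
  have -> : qn i 1 = 1 by rewrite qnE oppr0 expr0z mul1r snum.unlock big_ord1 expr0.
  by rewrite scale1r.
apply: (scalerI (qn0 i m.+1)); rewrite step IH -scalerAr -scalerAl f_zr !scalerDr !scalerA -kappa_rec scalerDl.
have -> : Q i ^ (- 2 : int) * kappa i c m * Q i ^ (c - 2 * m%:Z) =
    Q i ^ (c - 2 * m.+1%:Z) * kappa i c m.
  by rewrite mulrAC -QD; congr (_ ^ _ * _); lia.
by rewrite addrK -!scalerDl.
Qed.

(** Move f_i to the right of z_(a-k), one factor at a time; the two contributions to a term add up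
    by [qnumD] applied to a + 1 = (k + 1) + (a - k). *)
Lemma fd_zr a : fd i a * y =
  \sum_(k < a.+1) Q i ^ (k%:Z * (c - a%:Z + k%:Z)) *: (z (a - k) * fd i k).
Proof.
elim: a => [|a IH].
  by rewrite big_ord1 /= zr0 fd0 mulr1 mul1r mul0r expr0z scale1r.
apply: (scalerI (qn0 i a)); rewrite scalerAl -f_fd -mulrA IH mulr_sumr.
pose T (k : nat) : U := (Q i ^ (k%:Z * (c - a.+1%:Z + k%:Z))) *: (z (a.+1 - k) * fd i k).
have E (k : 'I_a.+1) : f i * (Q i ^ (k%:Z * (c - a%:Z + k%:Z)) *: (z (a - k) * fd i k)) =
    (Q i ^ (k%:Z) * qn i (a.+1 - k)) *: T k
    + (Q i ^ (- (a - k)%N%:Z) * qn i k.+1) *: T k.+1.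
  have ka : (k <= a)%N by rewrite -ltnS.
  rewrite -scalerAr mulrA f_zr mulrDl scalerDr -!scalerAl -mulrA f_fd -scalerAr.
  rewrite /T subSS subSn // !scalerA; congr (_ *: _ + _ *: _).
    by rewrite mulrAC -QD; congr (_ ^ _ * _); lia.
  rewrite [RHS]mulrAC -!QD; congr (_ ^ _ * _).
  have -> : (a - k)%N%:Z = a%:Z - k%:Z by lia.
  lia.
rewrite (eq_bigr _ (fun (k : 'I_a.+1) _ => E k)) big_split /= scaler_sumr.
rewrite -[RHS]/(\sum_(k < a.+2) qn i a.+1 *: T k) {IH}; move: T E => T _.
rewrite big_ord_recl [X in _ + X]big_ord_recr [RHS]big_ord_recl [in RHS]big_ord_recr /=.
rewrite -!addrA subn0 expr0z mul1r; congr (_ + _).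
rewrite addrA -big_split /= subnn oppr0 expr0z mul1r; congr (_ + _).
apply: eq_bigr => k _; rewrite -scalerDl; congr (_ *: _).
have ka : (k < a)%N := ltn_ord k.
rewrite /bump /= !add1n subSS.
have ea : a.+1 = (k.+1 + (a - k))%N by lia.
by rewrite [X in _ = qn i X]ea qnumD ?bd_gt0 // (exprnP (Q i)) exprnN.
Qed.

Lemma fd_zr_fd a b : fd i a * y * fd i b =
  \sum_(k < a.+1) (Q i ^ (k%:Z * (c - a%:Z + k%:Z)) * qb i k b) *:
     (z (a - k) * fd i (k + b)).
Proof.
rewrite fd_zr mulr_suml; apply: eq_bigr => k _.
by rewrite -scalerAl -mulrA fdM -scalerAr scalerA.
Qed.

(** By [fnil] the power C + 1 of f_i times y is right divisible by f_i, as are the terms k > 0 of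
    [fd_zr], hence also z_(C+1); being killed by [er], it is orthogonal to everything. If z_(n+1) is
    the first zero, e'_i z_(n+1) = 0 forces [kappa i c n] = 0, that is c = n. *)
Lemma zr_vanish : y != 0 -> exists n : nat,
  c = n%:Z /\ forall m, (n < m)%N -> z m = 0.
Proof.
move=> y0.
have [C HC] := fnil i y; have [u' Hu'] := HC C.+1.
have [u zu] : exists u, z C.+1 = u * f i.
  have /eqP := fd_zr C.+1; rewrite big_ord_recl mul0r expr0z scale1r subn0 fd0.
  rewrite mulr1 -subr_eq eq_sym => /eqP ->.
  rewrite fdE -scalerAl Hu' subSnn expr1 scalerAl.
  pose G (k : 'I_C.+1) : U := (qn i k.+1)^-1 *:
    (Q i ^ ((lift ord0 k)%:Z * (c - C.+1%:Z + (lift ord0 k)%:Z)) *: (z (C.+1 - lift ord0 k) * fd i k)).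
  exists ((qf i C.+1)^-1 *: u' - \sum_k G k).
  rewrite mulrBl mulr_suml; congr (_ - _); apply: eq_bigr => k _.
  rewrite /G -!scalerAl -mulrA fd_f -scalerAr [in RHS]scalerA [in RHS]scalerA.
  by rewrite mulrAC mulVf ?qn0 // mul1r.
(* Split w by powers of f_i on the right: the part in ker [er] is orthogonal to u f_i, and the
   others to any vector killed by [er]. *)
have zC : z C.+1 = 0.
  apply: form_nondeg => w; rewrite formC.
  elim/hom_ind: w => [w|v v' h1 h2|a v h1]; last 2 first.
  - by rewrite formDl h1 h2 addr0.
  - by rewrite formZl h1 mulr0.
  have [s [es _ ->]] := rdec i (hom_ht (hom_fw w)).
  rewrite form_suml big1 // => -[[|n] nw] _ /=.
    by rewrite fd0 mulr1 zu formC formMf es form0r.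
  by rewrite fdE -scalerAr formZl exprSr mulrA formMf zr_er form0r mulr0.
have ex : exists m, z m == 0 by exists C.+1; rewrite zC.
case: (ex_minnP ex) => -[|n]; first by rewrite zr0 (negPf y0).
move=> /eqP zn minn; exists n; split.
  apply/eqP/negPn/negP => cn; have := kappa_neq0 i cn.
  have := congr1 (e i) zn; rewrite zr_e linear0 => /eqP.
  rewrite scaler_eq0 => /orP[/eqP->|/minn]; first by rewrite eqxx.
  by rewrite ltnn.
move=> m; elim: m => // m IH; rewrite ltnS leq_eqVlt => /orP[/eqP <- //|/IH zm].
by rewrite zrS zm mulr0 mul0r scaler0 subr0 scaler0.
Qed.

Definition Mspan N : U -> Prop :=
  span (@predT K) (fun u => exists a b, (a + b)%N = N /\ u = fd i a * y * fd i b).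

Definition Tlat N : U -> Prop :=
  span A (fun u => exists a b, (a + b)%N = N /\ u = fd i a * y * fd i b).

Lemma Mspan_fd N u : Mspan N u -> Mspan N.+1 (f i * u) /\ Mspan N.+1 (u * f i).
Proof.
elim=> {u} [|u [a [b [ab ->]]]|u v _ [hu hu'] _ [hv hv']|a u _ _ [hu hu']].
- by rewrite mulr0 mul0r; split; exact: span0.
- split.
    rewrite !mulrA f_fd -!scalerAl; apply: spanZ => //.
    by apply: spanX; exists a.+1, b; rewrite addSn ab.
  rewrite -!mulrA fd_f -!scalerAr; apply: spanZ => //.
  by apply: spanX; exists a, b.+1; rewrite addnS ab mulrA.
- by rewrite mulrDr mulrDl; split; apply: spanD.
- by rewrite -scalerAr -scalerAl; split; apply: spanZ.
Qed.

Lemma zr_Mspan a b : Mspan (a + b) (z a * fd i b).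
Proof.
elim: b => [|b IH]; last first.
  have := (Mspan_fd IH).2; rewrite -mulrA fd_f -scalerAr addnS.
  by move=> /(spanZ (a := (qn i b.+1)^-1) isT); rewrite scalerA mulVf ?qn0 // scale1r.
rewrite addn0 fd0 mulr1; elim: a => [|a IH].
  by rewrite zr0; apply: spanX; exists 0%N, 0%N; rewrite fd0 mul1r mulr1.
have [h1 h2] := Mspan_fd IH; rewrite zrS; apply: spanZ => //.
by apply: spanD h1 _; rewrite -scaleN1r; apply/spanZ/spanZ.
Qed.

Lemma Mspan_zr N u : Mspan N u ->
  span (@predT K) (fun u => exists a b, (a + b)%N = N /\ u = z a * fd i b) u.
Proof.
apply: span_sub => // _ [a [b [ab ->]]]; rewrite fd_zr_fd.
apply: span_sum => k _; apply: spanZ => //; apply: spanX.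
by exists (a - k)%N, (k + b)%N; split=> //; have := ltn_ord k; lia.
Qed.

Section Dominant.
Variables (n : nat) (cn : c = n%:Z).

Definition Zlat N : U -> Prop :=
  span A (fun u => exists a b, (a + b)%N = N /\ u = z a * fd i b).

(** The pole k b of the q-binomial is absorbed: the total exponent of Q_i is k (n - a - b + k),
    positive in the range a + b <= n. *)
Lemma coef_qreg a b (k : nat) : (a + b <= n)%N -> (0 < k)%N ->
  qreg (bV B) (Q i ^ (k%:Z * (c - a%:Z + k%:Z)) * qb i k b).
Proof.
move=> ab k0; rewrite qbinE ?bd_gt0 // mulrA -QD.
apply: qregMr; last by apply/unit1_reg/unit1_sbin/bd_gt0.
apply: qreg_Q; first exact: bd_gt0.
have -> : k%:Z * (c - a%:Z + k%:Z) + (- (k * b)%N%:Z) =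
  k%:Z * (c - a%:Z - b%:Z + k%:Z) by rewrite PoszM; lia.
by apply: mulr_gt0; lia.
Qed.

Lemma fd_z_fd a b : (a + b <= n)%N -> exists t,
  [/\ span A (fun u => exists a' b',
         [/\ (a' + b')%N = (a + b)%N, (a' < a)%N & u = z a' * fd i b']) t
    & fd i a * y * fd i b = z a * fd i b + q *: t].
Proof.
move=> ab; rewrite fd_zr_fd big_ord_recl mul0r expr0z mul1r subn0 add0n.
have -> : qb i 0 b = 1.
  by rewrite qbin.unlock qfac0 mul1r mulfV // qf0.
rewrite scale1r.
exists (\sum_(k < a) ((Q i ^ (k.+1%:Z * (c - a%:Z + k.+1%:Z)) * qb i k.+1 b) / q) *:
    (z (a - k.+1) * fd i (k.+1 + b))); split.
  apply: span_sum => k _; apply: spanZ; first exact: coef_qreg.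
  apply: spanX; exists (a - k.+1)%N, (k.+1 + b)%N; split=> //.
    by have := ltn_ord k; lia.
  by have := ltn_ord k; lia.
congr (_ + _); rewrite scaler_sumr; apply: eq_bigr => k _.
by rewrite scalerA [q * _]mulrC divfK ?vq_neq0.
Qed.

(** The system of [fd_z_fd] is triangular in a with ones on the diagonal; it is inverted by
    induction on a. *)
Lemma z_Tlat a b : (a + b <= n)%N -> Tlat (a + b) (z a * fd i b).
Proof.
move: a {2}a.+1 (ltnSn a) b => a m; elim: m a => // m IH a am b ab.
have [t [ht E]] := fd_z_fd ab.
have -> : z a * fd i b = fd i a * y * fd i b - q *: t by rewrite E addrK.
apply: spanB; first by apply: spanX; exists a, b.
apply: spanZ; first exact: vq_reg.
apply: span_sub ht => // _ [a' [b' [e1 e2 ->]]]; rewrite -e1.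
by apply: IH; [lia|rewrite e1].
Qed.

Lemma z_fd_fd a b : (a + b <= n)%N -> exists2 t, Tlat (a + b) t &
  z a * fd i b = fd i a * y * fd i b + q *: t.
Proof.
move=> ab; have [t [ht ->]] := fd_z_fd ab.
exists (- t); last by rewrite scalerN addrK.
apply: spanN; apply: span_sub ht => // _ [a' [b' [e1 e2 ->]]]; rewrite -e1.
by apply: z_Tlat; rewrite e1.
Qed.

Lemma fd_fd_Zlat a b : (a + b <= n)%N -> exists2 t, Zlat (a + b) t &
  fd i a * y * fd i b = z a * fd i b + q *: t.
Proof.
move=> ab; have [t [ht ->]] := fd_z_fd ab; exists t => //.
by apply: span_sub ht => // _ [a' [b' [e1 e2 ->]]]; apply: spanX; exists a', b'.
Qed.

End Dominant.
End Vec.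

(** The ratio of the norms of z_m and y, see [form_zr]. The powers of Q_i in [kappa] and in the
    q-integers cancel, so for m <= c every factor has value 1 at q = 0. *)
Definition nz i c m : K := \prod_(l < m) (kappa i c l / qn i l.+1).

Lemma unit1_nz i (n : nat) m : (m <= n)%N -> unit1 (bV B) (nz i n%:Z m).
Proof.
move=> mn; apply: unit1_prod => l _; rewrite /kappa qnE.
rewrite -mulf_div divff ?Qz0 // mul1r.
apply: unit1M; last by apply/unit1V/unit1_snum; first exact: bd_gt0.
by apply: unit1_1BQ; [exact: bd_gt0|have := ltn_ord l; lia].
Qed.

Lemma form_zrS i h cc y m x : e i y = 0 -> er i y = 0 -> hom h cc y ->
  er i x = 0 -> form (zr i (cc i) y m.+1) x =
  (qn i m.+1)^-1 * form (zr i (cc i) y m) (e i x).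
Proof.
move=> ey ry hy rx; rewrite zrS formZl formBl formZl formf formMf rx form0r.
by rewrite mulr0 subr0.
Qed.

Lemma form_zr i h h' cc cc' y y' m m' :
    e i y = 0 -> er i y = 0 -> hom h cc y ->
    e i y' = 0 -> er i y' = 0 -> hom h' cc' y' ->
  form (zr i (cc i) y m) (zr i (cc' i) y' m') =
  (m == m')%:R * (nz i (cc' i) m * form y y').
Proof.
move=> ey ry hy ey' ry' hy'; elim: m m' => [|m IH] [|m'].
- by rewrite !zr0 /nz big_ord0 !mul1r.
- by rewrite formC zr0 (form_zrS _ ey' ry' hy' ry) ey form0r mulr0 mul0r.
- by rewrite zr0 (form_zrS _ ey ry hy ry') ey' form0r mulr0 mul0r.
- rewrite (form_zrS _ ey ry hy) ?(zr_er ry' hy') // (zr_e ey' hy') formZr IH eqSS.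
  case: eqP => [<-|_]; last by rewrite !(mul0r, mulr0).
  by rewrite !mul1r /nz big_ord_recr /=; ring.
Qed.

Lemma form_Mfd_ker i m n u v : er i u = 0 -> er i v = 0 ->
  form (u * fd i m) (v * fd i n) = (m == n)%:R * ((sf i m)^-1 * form u v).
Proof.
move=> /(congr1 st); rewrite /er stK linear0 => eu.
move=> /(congr1 st); rewrite /er stK linear0 => ev.
by rewrite -form_st !st_Mfd form_fd_ker // form_st.
Qed.

Lemma zrZ i c a y m : zr i c (a *: y) m = a *: zr i c y m.
Proof.
elim: m => [|m IH]; first by rewrite !zr0.
rewrite !zrS IH -scalerAr -scalerAl scalerA mulrC -scalerA -scalerBr scalerA mulrC.
by rewrite -scalerA.
Qed.

Lemma zr00 i c m : zr i c 0 m = 0.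
Proof. by have := zrZ i c 0 0 m; rewrite !scale0r. Qed.

Lemma Tlat_st i y N u : Tlat i y N u -> Tlat i (st y) N (st u).
Proof.
apply: span_linear => _ [a [b [ab ->]]]; apply: spanX; exists b, a.
by rewrite addnC st_Mfd st_fdM mulrA.
Qed.

Lemma Mspan_st i y N u : Mspan i y N u -> Mspan i (st y) N (st u).
Proof.
apply: span_linear => _ [a [b [ab ->]]]; apply: spanX; exists b, a.
by rewrite addnC st_Mfd st_fdM mulrA.
Qed.

(** * The mirrored expansions, with powers of f_i on the left *)

Section VecLeft.
Variables (i : I) (h : nat) (cc : I -> int) (y : U).
Hypotheses (ey : e i y = 0) (ry : er i y = 0) (hy : hom h cc y).
Local Notation c := (cc i).
Local Notation z := (zl i c y).

Let esy : e i (st y) = 0.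
Proof. by rewrite -[LHS]stK -/(er i y) ry linear0. Qed.

Let rsy : er i (st y) = 0.
Proof. by rewrite /er stK ey linear0. Qed.

Let hsy : hom h cc (st y). Proof. exact: hom_st. Qed.

Lemma zl_e m : e i (z m) = 0.
Proof. by rewrite -[LHS]stK -/(er i _) (zr_er rsy hsy) linear0. Qed.

Lemma zl_Mspan a b : Mspan i y (a + b) (fd i a * z b).
Proof.
have := Mspan_st (zr_Mspan i cc (st y) b a).
by rewrite stK st_Mfd addnC.
Qed.

Lemma Mspan_zl N u : Mspan i y N u ->
  span (@predT K) (fun u => exists a b, (a + b)%N = N /\ u = fd i a * z b) u.
Proof.
move=> /Mspan_st /(Mspan_zr cc) /(span_linear (g := st)) h1.
rewrite -[u]stK; apply: h1 => _ [a [b [ab ->]]]; apply: spanX.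
by exists b, a; rewrite addnC st_Mfd.
Qed.

Lemma Mspan_ft N u : Mspan i y N u -> Mspan i y N.+1 (ft i u).
Proof.
move=> /Mspan_zl; apply: span_linear => _ [a [b [<- ->]]].
by rewrite ftd ?zl_e //; exact: (zl_Mspan a.+1 b).
Qed.

Lemma Mspan_ht N u : Mspan i y N u -> ht (h + N) u.
Proof.
apply: span_sub => // _ [a [b [<- ->]]]; rewrite -mulrA addnA addnAC.
by apply/ht_fd/ht_Mfd; apply: hom_ht hy.
Qed.

Section Dominant.
Variables (n : nat) (cn : c = n%:Z).

Lemma fd_zl a b : (a + b <= n)%N -> exists t,
  [/\ span A (fun u => exists a' b',
         [/\ (a' + b')%N = (a + b)%N, (b' < b)%N & u = fd i a' * z b']) t
    & fd i a * y * fd i b = fd i a * z b + q *: t].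
Proof.
rewrite addnC => ab; have [t [ht E]] := fd_z_fd (st y) cn ab.
exists (st t); split; last first.
  have E0 : st (fd i a * y * fd i b) = fd i b * st y * fd i a.
    by rewrite st_Mfd st_fdM mulrA.
  by rewrite -[LHS]stK E0 E linearD linearZ /= st_Mfd.
apply: span_linear ht => _ [a' [b' [e1 e2 ->]]]; apply: spanX; exists b', a'.
by rewrite st_Mfd; split=> //; lia.
Qed.

Lemma zl_Tlat a b : (a + b <= n)%N -> Tlat i y (a + b) (fd i a * z b).
Proof.
rewrite addnC => ab; have := Tlat_st (z_Tlat (st y) cn ab).
by rewrite stK st_Mfd.
Qed.

Lemma zl_fd a b : (a + b <= n)%N -> exists2 t, Tlat i y (a + b) t &
  fd i a * z b = fd i a * y * fd i b + q *: t.
Proof.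
rewrite addnC => ab; have [t ht E] := z_fd_fd (st y) cn ab.
exists (st t); first by have := Tlat_st ht; rewrite stK.
have := congr1 st E; rewrite st_Mfd => ->.
by rewrite linearD linearZ /= st_Mfd st_fdM stK mulrA.
Qed.

Lemma zl_vanish m : (n < m)%N -> z m = 0.
Proof.
move=> nm; have [y0|/eqP y0] := pselect (st y = 0).
  by rewrite /zl y0 zr00 linear0.
have [n' [cn' H]] := zr_vanish esy rsy hsy y0.
by rewrite /zl H ?linear0 //; move: cn'; rewrite cn => -[<-].
Qed.

Lemma zr_vanish_lt m : (n < m)%N -> zr i c y m = 0.
Proof.
move=> nm; have [->|y0] := eqVneq y 0; first exact: zr00.
have [n' [cn' H]] := zr_vanish ey ry hy y0.
by apply: H; move: cn'; rewrite cn => -[<-].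
Qed.

(** On the vectors f_i^(a) z_b, ft_i just raises a; the bound N < n keeps the passage to these
    vectors and back within A. *)
Lemma Tlat_ft N u : (N < n)%N -> Tlat i y N u -> Tlat i y N.+1 (ft i u).
Proof.
move=> Nn; apply: span_linear => _ [a [b [ab ->]]]; subst N.
have [t [tT ->]] := fd_zl (ltnW Nn).
rewrite linearD linearZ /=; apply: spanD.
  by rewrite ftd ?zl_e //; apply: (zl_Tlat (a := a.+1)).
apply: spanZ; first exact: vq_reg.
apply: span_linear tT => _ [a' [b' [e1 e2 ->]]].
rewrite ftd ?zl_e // -e1; apply: (zl_Tlat (a := a'.+1)).
by rewrite addSn e1.
Qed.

Lemma ft_fd_fd a b : (a + b < n)%N -> exists2 t, Tlat i y (a + b).+1 t &
  ft i (fd i a * y * fd i b) = fd i a.+1 * y * fd i b + q *: t.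
Proof.
move=> Nn; have [t [tT ->]] := fd_zl (ltnW Nn).
have [t' t'T E] := @zl_fd a.+1 b Nn.
exists (t' + ft i t); last first.
  by rewrite linearD linearZ /= ftd ?zl_e // E scalerDr addrA.
apply: spanD t'T _; apply: (Tlat_ft (N := (a + b)%N)) => //.
apply: span_sub tT => // _ [a' [b' [e1 e2 ->]]].
by rewrite -e1; apply: zl_Tlat; rewrite e1 ltnW.
Qed.

(** Beyond degree n the term without f_i on the right is z_(N+1) = 0, and every z_a f_i^(b+1) is in
    the image of ft*_i. The equality is exact, but says nothing about the lattice. *)
Lemma Mspan_fs N u : (n < N.+1)%N -> Mspan i y N.+1 u ->
  exists2 v, Mspan i y N v & u = fs i v.
Proof.
move=> nN /(Mspan_zr cc); elim=> {u} [|_ [a [[|b] [ab ->]]]|u v _ [u' hu ->] _ [v' hv ->]|a u _ _ [u' hu ->]].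
- by exists 0; [exact: span0|rewrite linear0].
- exists 0; first exact: span0.
  by rewrite linear0 zr_vanish_lt ?mul0r //; lia.
- exists (zr i c y a * fd i b); last by rewrite fsd // (zr_er ry hy).
  have := zr_Mspan i cc y a b.
  by have -> : (a + b = N)%N by lia.
- by exists (u' + v'); [exact: spanD|rewrite linearD].
- by exists (a *: u'); [exact: spanZ|rewrite linearZ].
Qed.

Lemma Mspan_ftP N u : (n < N.+1)%N -> Mspan i y N.+1 u ->
  exists2 v, Mspan i y N v & u = ft i v.
Proof.
move=> nN /Mspan_zl; elim=> {u} [|_ [[|a] [b [ab ->]]]|u v _ [u' hu ->] _ [v' hv ->]|a u _ _ [u' hu ->]].
- by exists 0; [exact: span0|rewrite linear0].
- exists 0; first exact: span0.
  by rewrite linear0 zl_vanish ?mulr0 //; lia.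
- exists (fd i a * z b); last by rewrite ftd // zl_e.
  have := zl_Mspan a b.
  by have -> : (a + b = N)%N by lia.
- by exists (u' + v'); [exact: spanD|rewrite linearD].
- by exists (a *: u'); [exact: spanZ|rewrite linearZ].
Qed.

End Dominant.
End VecLeft.
End RankOne.

Section Loop.
Variable B : boson.
Local Notation K := (bK B).
Local Notation U := (bU B).
Local Notation I := (bI B).
Local Notation q := (vq (bV B)).
Local Notation A := (reg (bV B)).
Local Notation ev := (ev (bV B)).
Local Notation f := (@bf B).
Local Notation e := (@be B).
Local Notation st := (@st B).
Local Notation form := (@form B).
Local Notation ft := (@ft B).
Local Notation L := (@L B).
Local Notation sf i := (sfac (bV B) (bd i)).
Local Notation qreg := (qreg (bV B)).
Local Notation pos := (pos (bV B)).
Local Notation unit1 := (unit1 (bV B)).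
Implicit Types (i j : I) (u v x y z g : U) (h k m n : nat).

(** * The loop *)

Definition qL h u : Prop := exists2 v, L h v & u = q *: v.

Lemma ft1 i : ft i 1 = f i.
Proof. by have := ftd 0 (be1 i); rewrite fd0 fd1 !mulr1. Qed.

(* The induction hypothesis in degree h.  By [good_last] every word is, modulo q,
   in the image of some mirrored operator. *)
Record good h : Prop := Good {
  good_st : forall u, L h u -> L h (st u);
  good_reg : forall u v, L h u -> L h v -> form u v \in A;
  good_ge0 : forall u, L h u -> 0 <= ev (form u u);
  good_rad : forall u, L h u -> ev (form u u) = 0 -> qL h u;
  good_tw : forall w, size w = h -> ev (form (tw w) (tw w)) = 1;
  good_last : forall w, size w = h -> if h is h'.+1 then
    exists i g, L h' g /\ qL h (tw w - fs i g) else True;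
  good_full : forall u, ht h u -> exists m : nat, L h (q ^+ m *: u)
}.

Lemma LZ h a u : a \in A -> L h u -> L h (a *: u). Proof. exact: spanZ. Qed.
Lemma LD h u v : L h u -> L h v -> L h (u + v). Proof. exact: spanD. Qed.
Lemma LB h u v : L h u -> L h v -> L h (u - v). Proof. exact: spanB. Qed.
Lemma LN h u : L h u -> L h (- u). Proof. exact: spanN. Qed.
Lemma L0 h : L h 0. Proof. exact: span0. Qed.

Lemma L_ft i h u : L h u -> L h.+1 (ft i u).
Proof.
apply: span_linear => _ [w hw ->]; apply: spanX; exists (i :: w) => //.
by rewrite /= hw.
Qed.

Lemma L_tw w : L (size w) (tw w).
Proof. by apply: spanX; exists w. Qed.

Lemma qLD h u v : qL h u -> qL h v -> qL h (u + v).
Proof.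
by move=> [u' hu ->] [v' hv ->]; exists (u' + v'); rewrite ?scalerDr //; apply: LD.
Qed.

Lemma qLZ h a u : a \in A -> qL h u -> qL h (a *: u).
Proof.
move=> Aa [v hv ->]; exists (a *: v); first exact: LZ.
by rewrite !scalerA mulrC.
Qed.

Lemma qLN h u : qL h u -> qL h (- u).
Proof. by move=> [v hv ->]; exists (- v); rewrite ?scalerN //; apply: LN. Qed.

Lemma qLB h u v : qL h u -> qL h v -> qL h (u - v).
Proof. by move=> hu hv; apply: qLD hu (qLN hv). Qed.

Lemma qL0 h : qL h 0.
Proof. by exists 0; [exact: L0|rewrite scaler0]. Qed.

Lemma qL_ft i h u : qL h u -> qL h.+1 (ft i u).
Proof. by move=> [v hv ->]; exists (ft i v); rewrite ?linearZ //; apply: L_ft. Qed.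

Lemma LZq h a u : qreg a -> L h u -> qL h (a *: u).
Proof.
move=> Aa hu; exists ((a / q) *: u); first exact: LZ.
by rewrite scalerA [q * _]mulrC divfK ?vq_neq0.
Qed.

Lemma qform_reg h u v : good h -> qL h u -> L h v -> qreg (form u v).
Proof.
move=> G [u' hu ->] hv; rewrite formZl; apply: qregMr; first exact: qregq.
exact: (good_reg G).
Qed.

Lemma good0 : good 0.
Proof.
have L0P u : L 0 u -> exists2 a, a \in A & u = a *: 1.
  elim=> {u} [|_ [w /size0nil -> ->]|u v _ [a Aa ->] _ [b Ab ->]|a u Aa _ [b Ab ->]].
  - by exists 0; rewrite ?rpred0 // scale0r.
  - by exists 1; rewrite ?rpred1 // scale1r.
  - by exists (a + b); rewrite ?rpredD // scalerDl.
  - by exists (a * b); rewrite ?rpredM // scalerA.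
have L1 : L 0 1 by apply: (L_tw [::]).
split=> [u|u v|u|u|w|//|u].
- by move=> /L0P[a Aa ->]; rewrite linearZ /= st1; apply: LZ.
- move=> /L0P[a Aa ->] /L0P[b Ab ->].
  by rewrite formZl formZr form1 mulr1 rpredM.
- move=> /L0P[a Aa ->]; rewrite formZl formZr form1 mulr1 evM //.
  by rewrite -expr2 sqr_ge0.
- move=> /L0P[a Aa ->]; rewrite formZl formZr form1 mulr1 evM //.
  move=> /eqP; rewrite -expr2 sqrf_eq0 => /eqP a0.
  by apply: LZq => //; apply/qregP.
- by move=> /size0nil ->; rewrite form1 ev1.
- move=> /ht0P[a ->]; have [->|a0] := eqVneq a 0.
    by exists 0%N; rewrite scale0r scaler0; apply: L0.
  have [m [b [Ab _ ->]]] := val_exists (bV B) a0.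
  exists `|m|%N; rewrite scalerA; apply: LZ L1.
  rewrite mulrA rpredM // exprnP -expfzDr ?vq_neq0 // reg_expz //.
  by have := ler_norm (- m); rewrite normrN abszE; lia.
Qed.

Lemma form_ht h k u v : ht h u -> ht k v -> h != k -> form u v = 0.
Proof.
move=> hu; elim: hu k v => {u} [|_ [w <- ->]|u u' _ hu _ hu'|a u _ _ hu] k v hv hk.
- exact: form0l.
- elim: w k v hv hk => [|i w IH] k v hv hk.
    by case: k hv hk => // k hv _; apply: form1_ht hv.
  rewrite /= formf; case: k hv hk => [|k] hv hk.
    by rewrite (ht_e0 i hv) form0r.
  by apply: IH (ht_e i hv) _; rewrite -eqSS.
- by rewrite formDl (hu k) // (hu' k) // addr0.
- by rewrite formZl (hu k) // mulr0.
Qed.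

Lemma form_ht_nondeg h u : ht h u -> (forall v, ht h v -> form u v = 0) -> u = 0.
Proof.
move=> hu H; apply: form_nondeg; elim/hom_ind=> [w|v v' h1 h2|a v h1].
- have hw := hom_ht (hom_fw w).
  have [E|E] := eqVneq h (size w); first by apply: H; rewrite E.
  exact: form_ht hu hw E.
- by rewrite formDr h1 h2 addr0.
- by rewrite formZr h1 mulr0.
Qed.

(** * Norms and the lattice in one degree *)

Section Good.
Variables (h : nat) (G : good h).

(** Scale u into L, pair it nontrivially with some w in L and divide by q while the vector stays in
    q L. Each division lowers the valuation of the pairing, which cannot become negative, so the
    process stops; outside q L the norm has a positive value at 0. *)
Lemma L_val u : ht h u -> u != 0 -> exists (m : int) v,
  [/\ L h v, 0 < ev (form v v) & u = q ^ m *: v].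
Proof.
move=> hu u0.
have [m Lu] := good_full G hu; set u1 := q ^+ m *: u in Lu.
have q0 := vq_neq0 (bV B).
have u10 : u1 != 0 by rewrite scaler_eq0 negb_or u0 andbT expf_neq0.
have [w [Lw w0]] : exists w, L h w /\ form u1 w != 0.
  apply: contrapT => H; move/eqP: u10; apply.
  apply: (form_ht_nondeg (ht_L Lu)) => v hv; apply: contrapT => /eqP v0.
  have [m' Lv] := good_full G hv; apply: H; exists (q ^+ m' *: v).
  by rewrite formZr mulf_neq0 // expf_neq0.
have [N [a [Aa ea E]]] := val_exists (bV B) w0.
have N0 : 0 <= N by apply: (expz_reg Aa ea); rewrite -E; apply: (good_reg G).
have key n v : L h v -> form v w = q ^ n%:Z * a ->
    exists (m : int) v', [/\ L h v', 0 < ev (form v' v') & v = q ^ m *: v'].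
  elim: n v => [|n IH] v Lv Ev.
    exists 0, v; rewrite expr0z scale1r; split=> //.
    rewrite lt_neqAle (good_ge0 G Lv) andbT; apply/eqP => /esym /(good_rad G Lv).
    move=> hv; have := qform_reg G hv Lw; rewrite Ev expr0z mul1r.
    by move=> /qreg_ev a0; rewrite a0 eqxx in ea.
  have [hv|hv] := pselect (qL h v).
    case: hv Lv Ev => v' Lv' -> Lv; rewrite formZl exprSz -mulrA => /(mulfI q0) Ev'.
    have [l [v'' [h1 h2 ->]]] := IH _ Lv' Ev'.
    by exists (1 + l), v''; rewrite scalerA expfzDr // expr1z.
  exists 0, v; rewrite expr0z scale1r; split=> //.
  rewrite lt_neqAle (good_ge0 G Lv) andbT; apply/eqP => /esym /(good_rad G Lv).
  by move/hv.
case: N N0 E => // N _ /(key _ _ Lu) [l [v [Lv vv E]]].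
exists (l - m%:Z), v; split=> //.
rewrite expfzDr // mulrC -scalerA -E /u1 scalerA (exprnP q m) -expfzDr //.
by rewrite addNr expr0z scale1r.
Qed.

Lemma pos_form u : ht h u -> pos (form u u).
Proof.
move=> hu; have [->|u0] := eqVneq u 0; first by rewrite form0l; left.
have [m [v [Lv vv ->]]] := L_val hu u0.
rewrite formZl formZr; do 2!apply: posMq.
by apply: posP; [apply: (good_reg G)|left].
Qed.

Lemma L_of_reg u : ht h u -> form u u \in A -> L h u.
Proof.
move=> hu; have [->|u0] := eqVneq u 0; first by move=> _; exact: L0.
have [m [v [Lv vv ->]]] := L_val hu u0.
rewrite formZl formZr mulrA -expfzDr ?vq_neq0 // => H.
apply: LZ => //; apply: reg_expz.
have : 0 <= m + m by apply: expz_reg H; [apply: (good_reg G)|rewrite gt_eqF].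
lia.
Qed.

Lemma qL_of_qreg u : ht h u -> qreg (form u u) -> qL h u.
Proof.
move=> hu; have [->|u0] := eqVneq u 0; first by move=> _; exact: qL0.
have [m [v [Lv vv ->]]] := L_val hu u0.
rewrite formZl formZr mulrA -expfzDr ?vq_neq0 // => H.
apply: LZq => //; apply: qreg_expz.
have : 0 < m + m by apply: expz_qreg H; [apply: (good_reg G)|rewrite gt_eqF].
lia.
Qed.

Lemma form_eq0 u : ht h u -> form u u = 0 -> u = 0.
Proof.
move=> hu; have [//|u0] := eqVneq u 0.
have [m [v [Lv vv ->]]] := L_val hu u0; rewrite formZl formZr => /eqP.
rewrite !mulf_eq0 !(negPf (expfz_neq0 _ (vq_neq0 _))) /= => /eqP v0.
by move: vv; rewrite v0 ev0 ltxx.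
Qed.

Lemma form_unit_reg a u : unit1 a -> a * form u u \in A -> form u u \in A.
Proof.
move=> Ua H; have -> : form u u = a^-1 * (a * form u u).
  by rewrite mulrA mulVf ?mul1r //; apply: unit1_neq0 Ua.
by rewrite rpredM //; apply/unit1_reg/unit1V.
Qed.

End Good.

(** * From the degrees up to h to degree h + 1 *)

Section GoodBelow.
Variables (h : nat) (GG : forall k, (k <= h)%N -> good k).

Lemma unit1_sfV i n : unit1 (sf i n)^-1.
Proof. by apply/unit1V/unit1_sfac; exact: bd_gt0. Qed.

(** Norms have positive leading coefficients, so a regular sum has regular summands; and a vector of
    regular norm is in L. *)
Lemma L_ldec i k (s : nat -> U) N (c : nat -> K) : (k <= h)%N ->
    (forall n, (n < N)%N -> unit1 (c n)) ->
    (forall n, (n < N)%N -> ht (k - n) (s n)) ->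
    \sum_(n < N) c n * form (s n) (s n) \in A ->
  forall n, (n < N)%N -> L (k - n) (s n).
Proof.
move=> kh Uc hs H n nN.
have kn m : (k - m <= h)%N by apply: leq_trans kh; apply: leq_subr.
apply: (L_of_reg (GG (kn n))); first exact: hs.
apply: (form_unit_reg (Uc n nN)).
apply: (@pos_sum_reg _ (bV B) N (fun n : 'I_N => c n * form (s n) (s n)) _ H (Ordinal nN)).
move=> l; apply: posMu; first exact: Uc.
by apply: (pos_form (GG (kn l))); apply: hs.
Qed.

(** In substance the stability of L(oo) under the lowering operator sending f_i^(n) s_n to f_i^(n-1)
    s_n. *)
Lemma L_comp i k u : (k <= h)%N -> L k u -> exists s : nat -> U,
  [/\ forall n, e i (s n) = 0, forall n, (n <= k)%N -> L (k - n) (s n) &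
      u = \sum_(n < k.+1) fd i n * s n].
Proof.
move=> kh Lu; have [s [es hs us]] := ldec (ht_efam i) (ht_L Lu).
exists s; split=> //; apply: (@L_ldec i k s k.+1 (fun n => (sf i n)^-1)) => // [n _|].
  exact: unit1_sfV.
by rewrite -form_ldec // -us; apply: (good_reg (GG kh)).
Qed.

Lemma L_fd i a k u : (a + k <= h.+1)%N -> e i u = 0 -> L k u -> L (a + k) (fd i a * u).
Proof.
elim: a => [|a IH] ak eu Lu; first by rewrite fd0 mul1r.
by rewrite -(ftd _ eu); apply: L_ft; apply: IH => //; apply: ltnW.
Qed.

Lemma L_fd_sub i a k u : (a <= k)%N -> (k <= h.+1)%N -> e i u = 0 ->
  L (k - a) u -> L k (fd i a * u).
Proof. by move=> ak kh eu Lu; rewrite -(subnKC ak); apply: L_fd; rewrite ?subnKC. Qed.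

Lemma form_ft i k u v : (k <= h)%N -> L k u -> L k v ->
  qreg (form (ft i u) (ft i v) - form u v).
Proof.
move=> kh Lu Lv; have [s [es Ls ->]] := L_comp i kh Lu.
have [t [et Lt ->]] := L_comp i kh Lv.
rewrite form_ft_ldec // form_ldec // -sumrB; apply: qreg_sum => n _.
rewrite -mulrBl; apply: qregMr.
  by apply: unit1B1; apply: unit1_sfV.
have nk : (n <= k)%N by rewrite -ltnS.
apply: (good_reg (GG (leq_trans (leq_subr n k) kh))); [exact: Ls|exact: Lt].
Qed.

Lemma form_ft_reg i k u v : (k <= h)%N -> L k u -> L k v ->
  form (ft i u) (ft i v) \in A.
Proof.
move=> kh Lu Lv; rewrite -(subrK (form u v) (form _ _)) rpredD //.
  exact/qreg_reg/(form_ft i kh).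
exact: (good_reg (GG kh)).
Qed.

Lemma ev_form_ft i k u v : (k <= h)%N -> L k u -> L k v ->
  ev (form (ft i u) (ft i v)) = ev (form u v).
Proof.
move=> kh Lu Lv; have [] := ev_eq (form_ft_reg i kh Lu Lv) (form_ft i kh Lu Lv).
by [].
Qed.

Lemma L_ft_reg i k u : (k <= h)%N -> ht k u ->
  form (ft i u) (ft i u) \in A -> L k u.
Proof.
move=> kh hu; have [s [es hs ->]] := ldec (ht_efam i) hu.
rewrite form_ft_ldec // => H; apply: span_sum => n _.
have nk : (n <= k)%N by rewrite -ltnS.
apply: L_fd_sub => //; first exact: leqW.
apply: (@L_ldec i k s k.+1 (fun n => (sf i n.+1)^-1)) => // m _.
exact: unit1_sfV.
Qed.

Lemma L_st k u : (k <= h)%N -> L k u -> L k (st u).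
Proof. by move=> kh; apply: (good_st (GG kh)). Qed.

Lemma L_fs i k u : (k < h)%N -> L k u -> L k.+1 (fs i u).
Proof. by move=> kh Lu; apply/(L_st kh)/L_ft/L_st => //; apply: ltnW. Qed.

Lemma form_fs i u v : form (fs i u) (fs i v) = form (ft i (st u)) (ft i (st v)).
Proof. exact: form_st. Qed.

Lemma form_fs_reg i k u v : (k <= h)%N -> L k u -> L k v ->
  form (fs i u) (fs i v) \in A.
Proof. by move=> kh Lu Lv; rewrite form_fs (form_ft_reg _ kh) //; apply: L_st. Qed.

Lemma L_fs_reg i k u : (k <= h)%N -> ht k u ->
  form (fs i u) (fs i u) \in A -> L k u.
Proof.
move=> kh hu; rewrite form_fs => /(L_ft_reg kh (ht_st hu)) /(L_st kh).
by rewrite stK.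
Qed.

Lemma L_split i k u : (k < h)%N -> L k.+1 u -> exists u0 u',
  [/\ e i u0 = 0, L k.+1 u0, L k u' & u = u0 + ft i u'].
Proof.
move=> kh Lu; have [s [es Ls us]] := L_comp i kh Lu.
have LS : L k (\sum_(n < k.+1) fd i n * s n.+1).
  apply: span_sum => n _; have nk : (n <= k)%N by rewrite -ltnS.
  have := Ls n.+1 nk; rewrite subSS => Lsn.
  by apply: L_fd_sub => //; rewrite leqW // ltnW.
exists (s 0%N), (\sum_(n < k.+1) fd i n * s n.+1); split=> //.
  exact: (Ls 0%N).
by rewrite (ft_sum _ (s := fun n => s n.+1)) // us big_ord_recl fd0 mul1r.
Qed.

Definition lift_wt i (cc : I -> int) m : I -> int := fun l => cc l + m%:Z * cart l i.

(** Decompose e'_i x, again killed by [er], and integrate: z_m is the image of z_(m+1) divided by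
    [kappa]. Where [kappa] vanishes this fails, but there z_(m+1) = 0, and the leftover e'_i y0
    turns out to have norm 0. *)
Lemma ker_er_dec i k cc x : (k <= h.+1)%N -> hom k cc x -> er i x = 0 ->
  exists ys : nat -> U, [/\ forall m, e i (ys m) = 0, forall m, er i (ys m) = 0,
    forall m, (m <= k)%N -> hom (k - m) (lift_wt i cc m) (ys m) &
    x = \sum_(m < k.+1) zr i (lift_wt i cc m i) (ys m) m].
Proof.
elim: k cc x => [|k IH] cc x kh hx rx.
  exists (fun m => if m is 0%N then x else 0); split.
  - by case=> [|m]; rewrite ?linear0 // (hom_e0 i hx).
  - by case=> [|m]; rewrite ?linear0.
  - case=> // _; rewrite subn0; apply: hom_eq hx => l.
    by rewrite /lift_wt mul0r addr0.
  - by rewrite big_ord1 zr0.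
have rex : er i (e i x) = 0 by apply: e_er0.
have [ys [eys rys hys Eex]] := IH _ _ (ltnW kh) (hom_e i hx) rex.
pose c m := lift_wt i cc m.+1 i.
have cE m : lift_wt i (fun l => cc l + cart l i) m =1 lift_wt i cc m.+1.
  by move=> l; rewrite /lift_wt intS mulrDl mul1r addrA.
pose kp m := kappa i (c m) m.
(* For [kp m] = 0 the convention 0^-1 = 0 drops the term. *)
pose x1 : U := \sum_(m < k.+1) (kp m)^-1 *: zr i (c m) (ys m) m.+1.
have hysc m : (m <= k)%N -> hom (k - m) (lift_wt i cc m.+1) (ys m).
  by move=> mk; apply: hom_eq (hys m mk); apply: cE.
have zrr m l : (m <= k)%N -> er i (zr i (c m) (ys m) l) = 0.
  by move=> mk; apply: zr_er (rys m) (hysc m mk) l.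
have rx1 : er i x1 = 0.
  rewrite linear_sum big1 // => m _ /=.
  by rewrite linearZ /= zrr ?scaler0 // -ltnS.
pose y0 := x - x1.
have ry0 : er i y0 = 0 by rewrite linearB /= rx rx1 subrr.
have hy0 : hom k.+1 cc y0.
  apply: homB hx _; apply: span_sum => m _; apply: homZ.
  have mk : (m <= k)%N by rewrite -ltnS.
  have := zr_hom i (hysc m mk) m.+1.
  rewrite addnS subnK //; apply: hom_eq => l.
  by rewrite /lift_wt addrK.
have Ey0 : e i y0 = \sum_(m < k.+1) (1 - (kp m)^-1 * kp m) *: zr i (c m) (ys m) m.
  rewrite linearB /= Eex linear_sum -sumrB; apply: eq_bigr => m _.
  have mk : (m <= k)%N by rewrite -ltnS.
  rewrite linearZ /= (zr_e (eys m) (hysc m mk)) scalerA scalerBl scale1r.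
  by rewrite cE.
have ey0 : e i y0 = 0.
  apply: (form_eq0 (GG (k := k) kh)); first exact/ht_e/hom_ht/hy0.
  rewrite {1}Ey0 form_suml big1 // => m _; rewrite formZl.
  have mk : (m <= k)%N by rewrite -ltnS.
  have [cm|cm] := eqVneq (c m) m%:Z; last first.
    by rewrite mulVf ?kappa_neq0 // subrr mul0r.
  (* f_i z_m is a multiple of z_(m+1), here 0, plus a multiple of z_m f_i, which is orthogonal to y0
     because [er] kills y0. *)
  rewrite -formf f_zr formDl !formZl formMf ry0 form0r mulr0 addr0.
  by rewrite (zr_vanish_lt (eys m) (rys m) (hysc m mk) cm) ?form0l ?mulr0.
exists (fun m => if m is m'.+1 then (kp m')^-1 *: ys m' else y0); split.
- by case=> [//|m]; rewrite linearZ /= eys scaler0.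
- by case=> [//|m]; rewrite linearZ /= rys scaler0.
- case=> [_|m mk]; first by apply: hom_eq hy0 => l; rewrite /lift_wt mul0r addr0.
  by apply: homZ; rewrite subSS; apply: hysc.
- rewrite big_ord_recl zr0 /= -[LHS](subrK x1) -/y0; congr (_ + _).
  by apply: eq_bigr => m _; rewrite zrZ.
Qed.

Lemma form_rdec i N (s : nat -> U) : (forall n, er i (s n) = 0) ->
  form (\sum_(n < N) s n * fd i n) (\sum_(n < N) s n * fd i n) =
  \sum_(n < N) (sf i n)^-1 * form (s n) (s n).
Proof.
move=> es; rewrite form_suml; apply: eq_bigr => n _.
rewrite form_sumr (bigD1 n) //= form_Mfd_ker // eqxx mul1r big1 ?addr0 //.
move=> m mn; rewrite form_Mfd_ker // eq_sym.
by rewrite (val_eqE m n) (negPf mn) mul0r.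
Qed.

Lemma L_ker_er i k cc x : (k <= h)%N -> hom k cc x -> er i x = 0 -> L k x ->
  exists ys : nat -> U, [/\ forall m, e i (ys m) = 0, forall m, er i (ys m) = 0,
    forall m, (m <= k)%N -> hom (k - m) (lift_wt i cc m) (ys m) /\ L (k - m) (ys m),
    forall m, (m <= k)%N -> ys m = 0 \/ exists n, lift_wt i cc m i = n%:Z /\ (m <= n)%N &
    x = \sum_(m < k.+1) zr i (lift_wt i cc m i) (ys m) m].
Proof.
move=> kh hx rx Lx.
have [ys' [eys' rys' hys' Ex']] := ker_er_dec (leqW kh) hx rx.
(* Components with z_m = 0 are discarded; for the others [zr_vanish] gives m <= n, the range in
   which [nz] has value 1 at q = 0. *)
pose ys m := if `[< zr i (lift_wt i cc m i) (ys' m) m = 0 >] then 0 else ys' m.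
have eys m : e i (ys m) = 0 by rewrite /ys; case: ifP => _ //; rewrite linear0.
have rys m : er i (ys m) = 0 by rewrite /ys; case: ifP => _ //; rewrite linear0.
have hys m : (m <= k)%N -> hom (k - m) (lift_wt i cc m) (ys m).
  by move=> mk; rewrite /ys; case: ifP => _; [exact: span0|exact: hys'].
have dys m : (m <= k)%N -> ys m = 0 \/ exists n, lift_wt i cc m i = n%:Z /\ (m <= n)%N.
  move=> mk; rewrite /ys; case: ifP => [_|/asboolP z0]; first by left.
  right; have y0 : ys' m != 0 by apply: contra_notN z0 => /eqP ->; rewrite zr00.
  have [n [cn Hn]] := zr_vanish (eys' m) (rys' m) (hys' m mk) y0.
  by exists n; split=> //; rewrite leqNgt; apply/negP => /Hn.
have Ex : x = \sum_(m < k.+1) zr i (lift_wt i cc m i) (ys m) m.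
  rewrite {1}Ex'; apply: eq_bigr => m _; rewrite /ys.
  by case: asboolP => // ->; rewrite zr00.
exists ys; split=> // m mk; split; first exact: hys.
(* A zero component need not satisfy m <= n, so its coefficient is set to 1. *)
pose c m := if ys m == 0 then 1 else nz i (lift_wt i cc m i) m.
apply: (@L_ldec i k ys k.+1 c) => // [l lk|l lk|].
- rewrite /c; case: eqP => [_|y0]; first exact: unit1_1.
  by have [//|[n [-> ln]]] := dys l lk; apply: unit1_nz.
- exact/hom_ht/hys.
have <- : form x x = \sum_(n < k.+1) c n * form (ys n) (ys n).
  rewrite {1}Ex form_suml; apply: eq_bigr => l _.
  have lk : (l <= k)%N by rewrite -ltnS.
  rewrite Ex form_sumr (bigD1 l) //= (form_zr _ _ (eys l) (rys l) (hys l lk) (eys l) (rys l) (hys l lk)).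
  rewrite eqxx mul1r big1 ?addr0 => [|l' ll'].
    by rewrite /c; case: eqP => // ->; rewrite form0l !mulr0.
  have lk' : (l' <= k)%N by rewrite -ltnS.
  rewrite (form_zr _ _ (eys l) (rys l) (hys l lk) (eys l') (rys l') (hys l' lk')).
  by rewrite eq_sym (val_eqE l' l) (negPf ll') mul0r.
exact: (good_reg (GG kh)).
Qed.

(** Decompose a word vector along right powers of f_i, then each component, killed by [er], with
    [L_ker_er]. The resulting z_a f_i^(b) are the vectors on which both ft_i and ft*_i can be
    followed. *)
Lemma L_ind i (P : U -> Prop) k : (k <= h)%N -> P 0 ->
    (forall u v, P u -> P v -> P (u + v)) ->
    (forall a u, a \in A -> P u -> P (a *: u)) ->
    (forall k0 a b cc y n, e i y = 0 -> er i y = 0 -> hom k0 cc y -> cc i = n%:Z ->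
       (a <= n)%N -> L k0 y -> (k0 + a + b)%N = k -> P (zr i (cc i) y a * fd i b)) ->
  forall u, L k u -> P u.
Proof.
move=> kh P0 PD PZ Pz u; elim=> {u} [//|_ [w wk ->]|u v _ hu _ hv|a u Aa _ hu];
  [|exact: PD|exact: PZ].
have hw := hom_tw w; have Lw := L_tw w; rewrite wk in hw Lw.
have [s [es hs us]] := hom_rdec i hw.
have Ls n : (n <= k)%N -> L (k - n) (s n).
  rewrite -ltnS; apply: (@L_ldec i k s k.+1 (fun n => (sf i n)^-1)) => // [l _|l lk|].
  - exact: unit1_sfV.
  - exact/hom_ht/hs.
  - by rewrite -form_rdec // -us; apply: (good_reg (GG kh)).
rewrite us; apply: (big_ind P) => // n _.
have nk : (n <= k)%N by rewrite -ltnS.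
have [ys [eys rys hys dys ->]] :=
  L_ker_er (leq_trans (leq_subr n k) kh) (hs n nk) (es n) (Ls n nk).
rewrite mulr_suml; apply: (big_ind P) => // m _.
have mk : (m <= k - n)%N by rewrite -ltnS.
have [hm Lm] := hys m mk.
have [->|[l [cl ml]]] := dys m mk; first by rewrite zr00 mul0r.
apply: (Pz _ _ _ _ _ l (eys m) (rys m) hm cl ml Lm).
by rewrite subnK // subnK.
Qed.

(** L + st L in degree h + 1: the lattice available for error terms until [st_step] identifies it
    with L. *)
Definition SL u : Prop := exists t1 t2,
  [/\ L h.+1 t1, L h.+1 (st t2) & u = t1 + t2].

Lemma SLD u v : SL u -> SL v -> SL (u + v).
Proof.
move=> [t1 [t2 [h1 h2 ->]]] [t3 [t4 [h3 h4 ->]]]; exists (t1 + t3), (t2 + t4).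
by rewrite linearD addrACA; split=> //; apply: LD.
Qed.

Lemma SLZ a u : a \in A -> SL u -> SL (a *: u).
Proof.
move=> Aa [t1 [t2 [h1 h2 ->]]]; exists (a *: t1), (a *: t2).
by rewrite linearZ scalerDr; split=> //; apply: LZ.
Qed.

Lemma SL_L u : L h.+1 u -> SL u.
Proof.
by move=> Lu; exists u, 0; rewrite linear0 addr0; split=> //; apply: L0.
Qed.

Lemma SL_Lst u : L h.+1 (st u) -> SL u.
Proof.
by move=> Lu; exists 0, u; rewrite add0r; split=> //; apply: L0.
Qed.

Section VecGood.
Variables (i : I) (k : nat) (cc : I -> int) (y : U) (n : nat).
Hypotheses (ey : e i y = 0) (ry : er i y = 0) (hy : hom k cc y).
Hypotheses (cn : cc i = n%:Z) (Ly : L k y).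
Local Notation z := (zr i (cc i) y).

Lemma L_zr a b : (a <= n)%N -> (k + a + b <= h)%N -> L (k + a + b) (z a * fd i b).
Proof.
move=> an kh; apply: (L_of_reg (GG kh)); first exact/ht_Mfd/hom_ht/zr_hom.
rewrite form_Mfd_ker ?(zr_er ry hy) // eqxx mul1r.
rewrite (form_zr _ _ ey ry hy ey ry hy) eqxx mul1r cn.
rewrite rpredM ?(unit1_reg (unit1_sfV _ _)) // rpredM ?(unit1_reg (unit1_nz i an)) //.
have kh' : (k <= h)%N by apply: leq_trans kh; rewrite -addnA leq_addr.
exact: (good_reg (GG kh')).
Qed.

End VecGood.

Lemma L_zl i k cc y n a b : e i y = 0 -> er i y = 0 -> hom k cc y ->
  cc i = n%:Z -> L k y -> (b <= n)%N -> (k + b + a <= h)%N ->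
  L (k + b + a) (fd i a * zl i (cc i) y b).
Proof.
move=> ey ry hy cn Ly bn kh.
rewrite -st_Mfd; apply: (L_st kh); apply: (@L_zr i k cc (st y) n) => //.
- by rewrite -[LHS]stK -/(er i y) ry linear0.
- by rewrite /er stK ey linear0.
- exact: hom_st.
- by apply: L_st => //; apply: leq_trans kh; rewrite -addnA leq_addr.
Qed.

(** For a > 0 the vector is obtained by ft_i from degree h, up to errors of the same kind; y
    f_i^(N+1) itself is only seen to be in st L. *)
Lemma Tlat_SL i k cc y n N u : e i y = 0 -> er i y = 0 -> hom k cc y ->
    cc i = n%:Z -> L k y -> (N < n)%N -> (k + N = h)%N ->
  Tlat i y N.+1 u -> SL u.
Proof.
move=> ey ry hy cn Ly Nn kN.
elim=> {u} [|_ [a [b [ab ->]]]|u v _ hu _ hv|a u Aa _ hu].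
- exact/SL_L/L0.
- case: a ab => [|a] ab.
    rewrite add0n in ab; subst b; rewrite fd0 mul1r; apply: SL_Lst.
    rewrite st_Mfd; have := @L_fd i N.+1 k (st y).
    rewrite addnC addnS kN; apply=> //.
      by rewrite -[LHS]stK -/(er i y) ry linear0.
    by apply: L_st => //; rewrite -kN leq_addr.
  apply: SL_L; have abn : (a.+1 + b <= n)%N by rewrite ab.
  have Lz a' b' : (a'.+1 + b' = a.+1 + b)%N -> L h.+1 (fd i a'.+1 * zl i (cc i) y b').
    move=> E; rewrite -(ftd a' (zl_e ey hy b')); apply: L_ft.
    have -> : h = (k + b' + a')%N by lia.
    by apply: (L_zl ey ry hy cn Ly); lia.
  have [t [tT ->]] := fd_zl y cn abn.
  apply: LD; first exact: Lz.
  apply: LZ; first exact: vq_reg.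
  (* The terms of t have b' < b, hence a' > 0: all of them are in the image of ft_i. *)
  apply: span_sub tT => // _ [[|a'] [b' [E lt ->]]]; last exact: Lz.
  by exfalso; lia.
- exact: SLD.
- exact: SLZ.
Qed.

Definition ft_fs_mod i g : Prop := exists g' t,
  [/\ L h g', SL t & ft i (fs i g) = fs i g' + q *: t].

(** On g = z_a f_i^(b), ft*_i raises b. If a + b + 2 <= n, ft_i raises a up to a multiple of q, and
    g' = z_(a+1) f_i^(b). Otherwise everything is in the image of ft*_i, and the preimage is in L
    because its image has regular norm. *)
Lemma ft_fs_mod_same i k g : k.+1 = h -> L k g -> ft_fs_mod i g.
Proof.
move=> kh; have kh' : (k < h)%N by rewrite -kh.
apply: (@L_ind i (ft_fs_mod i) k (ltnW kh')).
- exists 0, 0; rewrite !linear0 addr0; split=> //; [exact: L0|exact/SL_L/L0].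
- move=> u v [g1 [t1 [h1 h2 E1]]] [g2 [t2 [h3 h4 E2]]].
  exists (g1 + g2), (t1 + t2); rewrite !linearD /= E1 E2 addrACA.
  by split=> //; [exact: LD|exact: SLD].
- move=> a u Aa [g1 [t1 [h1 h2 E1]]]; exists (a *: g1), (a *: t1).
  rewrite !linearZ /= E1 scalerDr !scalerA [a * _]mulrC.
  by split=> //; [exact: LZ|exact: SLZ].
move=> k0 a b cc y n ey ry hy cn an Ly Ek.
have Ekh : (k0 + (a + b).+1)%N = h by lia.
rewrite /ft_fs_mod fsd ?(zr_er ry hy) //.
have [Nn|nN] := leqP (a + b).+2 n.
  have ab1 : (a + b.+1 <= n)%N by lia.
  have ab2 : (a.+1 + b.+1 <= n)%N by lia.
  have [t tT ->] := z_fd_fd y cn ab1.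
  have [t' t'T E'] := ft_fd_fd ey hy cn (a := a) (b := b.+1) ab2.
  have [t'' t''Z E''] := fd_fd_Zlat y cn ab2.
  have t''T : Tlat i y (a + b.+1).+1 t''.
    apply: span_sub t''Z => // _ [a' [b' [E ->]]].
    have abn : (a' + b' <= n)%N by rewrite E.
    by have := z_Tlat y cn abn; rewrite E addSn.
  exists (zr i (cc i) y a.+1 * fd i b), (t'' + t' + ft i t).
  rewrite linearD linearZ /= E' E'' fsd ?(zr_er ry hy) // !scalerDr !addrA.
  split=> //.
    have Eh : (k0 + a.+1 + b)%N = h by lia.
    have := L_zr ey ry hy cn Ly (a := a.+1) (b := b); rewrite Eh.
    by apply; lia.
  apply: (@Tlat_SL i k0 cc y n (a + b.+1)) => //; first by lia.
  apply: spanD; first exact: spanD.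
  by apply: (Tlat_ft ey hy cn) => //; lia.
have Lg : L h (fs i (zr i (cc i) y a * fd i b)).
  rewrite -kh; apply: L_fs => //.
  by rewrite -Ek; apply: (L_zr ey ry hy cn Ly) => //; lia.
have := zr_Mspan i cc y a b.+1; rewrite addnS => /(Mspan_ft ey hy) M.
have [v Mv Ev] := Mspan_fs ey ry hy cn nN M.
exists v, 0; rewrite scaler0 addr0; split=> //; last exact/SL_L/L0.
have hv : ht h v by rewrite -Ekh; exact: (Mspan_ht hy Mv).
apply: (L_fs_reg (i := i) _ hv) => //.
rewrite -Ev; rewrite fsd ?(zr_er ry hy) // in Lg.
exact: (form_ft_reg i (leqnn h) Lg Lg).
Qed.

Lemma ft_fs_mod_any i j k g : k.+1 = h -> L k g -> exists g' t,
  [/\ L h g', SL t & ft j (fs i g) = fs i g' + q *: t].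
Proof.
move=> kh Lg; have [<-|ij] := eqVneq i j; first exact: ft_fs_mod_same kh Lg.
exists (ft j g), 0; rewrite (ft_fs ij (ht_L Lg)) scaler0 addr0; split=> //.
- by rewrite -kh; apply: L_ft.
- exact/SL_L/L0.
Qed.

Lemma full_step u : ht h.+1 u -> exists m : nat, L h.+1 (q ^+ m *: u).
Proof.
elim=> {u} [|_ [[//|j w] [wh] ->]|u v _ [m hu] _ [n hv]|a u _ _ [m hu]].
- by exists 0%N; rewrite scaler0; apply: L0.
- have hw : ht h (fw w) by rewrite -wh; apply: hom_ht (hom_fw w).
  have [m Lm] := good_full (GG (leqnn h)) hw.
  have [s [es Ls us]] := L_comp j (leqnn h) Lm.
  (* [bd j * h] clears the poles of [n + 1]_j, of order [bd j * n] with n <= h. *)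
  exists (bd j * h + m)%N; rewrite exprD -scalerA [q ^+ m *: _]scalerAr us.
  rewrite mulr_sumr scaler_sumr; apply: span_sum => n _.
  have nh : (n <= h)%N by rewrite -ltnS.
  rewrite mulrA f_fd -scalerAl scalerA; apply: LZ; last first.
    by apply: L_fd_sub => //; rewrite subSS; apply: Ls.
  rewrite qnE exprM exprnP mulrA -QD rpredM //; last first.
    by apply/unit1_reg/unit1_snum; first exact: bd_gt0.
  by apply: reg_Q; lia.
- exists (m + n)%N; rewrite scalerDr; apply: LD.
    rewrite addnC exprD -scalerA; apply: LZ hu.
    by rewrite rpredX // vq_reg.
  by rewrite exprD -scalerA; apply: LZ hv; rewrite rpredX // vq_reg.
- have [->|a0] := eqVneq a 0.
    by exists 0%N; rewrite scale0r scaler0; apply: L0.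
  have [l [b [Ab _ ->]]] := val_exists (bV B) a0.
  exists (`|l| + m)%N; rewrite scalerA.
  have -> : q ^+ (`|l| + m) * (q ^ l * b) = (q ^ (`|l|%N%:Z + l) * b) * q ^+ m.
    by rewrite expfzDr ?vq_neq0 // -exprnP exprD; ring.
  rewrite -scalerA; apply: LZ hu; rewrite rpredM //; apply: reg_expz.
  by have := ler_norm (- l); rewrite normrN abszE; lia.
Qed.

Lemma L_fs_span k u : (k < h)%N -> L k.+1 u ->
  span A (fun u => exists i g, L k g /\ u = fs i g) u.
Proof.
move=> kh /(L_st kh) /(span_linear (g := st)) H; rewrite -[u]stK.
apply: H => _ [[//|i w] [wk] ->]; apply: spanX; exists i, (st (tw w)).
split; last by rewrite /fs stK.
by apply: L_st; [exact: ltnW|rewrite -wk; exact: L_tw].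
Qed.

(** L is contained in st L + q L: write the tail of a word with a mirrored outermost operator and
    exchange ft_j with it. In degree 1, f_j is fixed by [st]. *)
Lemma L_step u : L h.+1 u -> exists v t,
  [/\ L h.+1 (st v), L h.+1 t & u = v + q *: t].
Proof.
pose P u := exists v t, [/\ L h.+1 (st v), L h.+1 t & u = v + q *: t].
have P0 : P 0.
  by exists 0, 0; rewrite linear0 scaler0 addr0; split=> //; apply: L0.
have PD u1 u2 : P u1 -> P u2 -> P (u1 + u2).
  move=> [v1 [t1 [h1 h2 ->]]] [v2 [t2 [h3 h4 ->]]]; exists (v1 + v2), (t1 + t2).
  by rewrite linearD scalerDr addrACA; split=> //; apply: LD.
have PZ a u1 : a \in A -> P u1 -> P (a *: u1).
  move=> Aa [v [t [h1 h2 ->]]]; exists (a *: v), (a *: t).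
  by rewrite linearZ scalerDr !scalerA [a * _]mulrC; split=> //; apply: LZ.
elim=> {u} [//|_ [[//|j w] [wh] ->]|u v _ hu _ hv|a u Aa _ hu]; last 2 first.
- exact: PD.
- exact: PZ.
have [h0|[k hk]] : h = 0%N \/ exists k, k.+1 = h.
  by case: (h) => [|k]; [left|right; exists k].
  have w0 : w = [::] by apply: size0nil; rewrite wh.
  have tj : tw [:: j] = f j by exact: ft1.
  exists (f j), 0; rewrite w0 tj stf scaler0 addr0; split=> //; last exact: L0.
  by rewrite -tj; have := L_tw [:: j]; rewrite /= h0.
have Lw : L k.+1 (tw w) by rewrite hk -wh; apply: L_tw.
have kh : (k < h)%N by rewrite -hk.
rewrite /=; elim: (L_fs_span kh Lw) => [|_ [i [g [Lg ->]]]|x x' _ hx _ hx'|a x Aa _ hx].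
- by rewrite linear0.
- have [g' [_ [Lg' [t1 [t2 [h1 h2 ->]]] ->]]] := ft_fs_mod_any i j hk Lg.
  exists (fs i g' + q *: t2), t1; split=> //; last by rewrite scalerDr addrAC addrA.
  rewrite linearD linearZ /= /fs stK; apply: LD; last by apply: LZ => //; apply: vq_reg.
  by apply/L_ft/L_st.
- by rewrite linearD; apply: PD.
- by rewrite linearZ; apply: PZ.
Qed.

Lemma L_iter m u : L h.+1 u -> exists v t,
  [/\ L h.+1 (st v), L h.+1 t & u = v + q ^+ m *: t].
Proof.
elim: m u => [|m IH] u Lu.
  by exists 0, u; rewrite linear0 expr0 scale1r add0r; split=> //; apply: L0.
have [v [t [Lv Lt ->]]] := IH u Lu; have [v' [t' [Lv' Lt' ->]]] := L_step Lt.
exists (v + q ^+ m *: v'), t'; split=> //.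
  by rewrite linearD linearZ; apply: LD => //; apply: LZ => //; rewrite rpredX ?vq_reg.
by rewrite scalerDr scalerA -exprSr addrA.
Qed.

(** A Nakayama argument: finitely many words generate L in degree h + 1, so one power q^m maps st L
    into L, and [L_iter] pushes the error term into q^m L. *)
Lemma st_step u : L h.+1 u -> L h.+1 (st u).
Proof.
have [m Hm] : exists m : nat, forall t, L h.+1 t -> L h.+1 (st (q ^+ m *: t)).
  have key (w : h.+1.-tuple I) : exists m : nat, L h.+1 (q ^+ m *: st (tw w)).
    apply: full_step; apply: ht_st; have := L_tw w; rewrite size_tuple.
    exact: ht_L.
  have [g Hg] := choice key; exists (\max_w g w)%N => t.
  elim=> {t} [|_ [w wh ->]|x x' _ hx _ hx'|a x Aa _ hx].
  - by rewrite scaler0 linear0; apply: L0.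
  - have wt : size w == h.+1 by rewrite wh.
    rewrite linearZ /=; have := Hg (Tuple wt) => /= Lw.
    have le : (g (Tuple wt) <= \max_w g w)%N by apply: leq_bigmax.
    rewrite -(subnK le) exprD -scalerA; apply: LZ => //.
    by rewrite rpredX ?vq_reg.
  - by rewrite scalerDr linearD; apply: LD.
  - by rewrite scalerA mulrC -scalerA linearZ; apply: LZ.
move=> Lu; have [v [t [Lv Lt ->]]] := L_iter m Lu.
by rewrite linearD; apply: LD => //; apply: Hm.
Qed.

Lemma SL_step u : SL u -> L h.+1 u.
Proof. by move=> [t1 [t2 [h1 /st_step h2 ->]]]; rewrite stK in h2; apply: LD. Qed.

Lemma fs_step i u : L h u -> L h.+1 (fs i u).
Proof. by move=> Lu; apply/st_step/L_ft/L_st. Qed.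

(** The decomposition of [L_split] one degree higher, where regular norms are not yet available;
    membership of u0 in L is left out, as it follows when u is in L. *)
Definition splitP i u : Prop := exists u0 u',
  [/\ e i u0 = 0, L h u' & u = u0 + ft i u'].

Lemma splitPD i u v : splitP i u -> splitP i v -> splitP i (u + v).
Proof.
move=> [u0 [u1 [h1 h2 ->]]] [v0 [v1 [h3 h4 ->]]]; exists (u0 + v0), (u1 + v1).
by rewrite !linearD /= h1 h3 addr0 addrACA; split=> //; apply: LD.
Qed.

Lemma splitPZ i a u : a \in A -> splitP i u -> splitP i (a *: u).
Proof.
move=> Aa [u0 [u1 [h1 h2 ->]]]; exists (a *: u0), (a *: u1).
by rewrite !linearZ /= h1 scaler0 scalerDr; split=> //; apply: LZ.
Qed.

Lemma splitP0 i : splitP i 0.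
Proof. by exists 0, 0; rewrite !linear0 addr0; split=> //; apply: L0. Qed.

Lemma splitP_zl i k cc y n a b : e i y = 0 -> er i y = 0 -> hom k cc y ->
    cc i = n%:Z -> L k y -> (b <= n)%N -> (k + b + a)%N = h.+1 ->
  splitP i (fd i a * zl i (cc i) y b).
Proof.
move=> ey ry hy cn Ly bn; case: a => [|a] E.
  exists (zl i (cc i) y b), 0; rewrite fd0 mul1r linear0 addr0; split=> //.
  - exact: (zl_e ey hy).
  - exact: L0.
exists 0, (fd i a * zl i (cc i) y b); rewrite linear0 add0r; split=> //.
  have <- : (k + b + a)%N = h by lia.
  by apply: (L_zl ey ry hy cn Ly); lia.
by rewrite ftd // (zl_e ey hy).
Qed.

Lemma splitP_Tlat i k cc y n N u : e i y = 0 -> er i y = 0 -> hom k cc y ->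
    cc i = n%:Z -> L k y -> (N <= n)%N -> (k + N)%N = h.+1 ->
  Tlat i y N u -> splitP i u.
Proof.
move=> ey ry hy cn Ly Nn kN; elim=> {u} [|_ [a [b [ab ->]]]|u v _ hu _ hv|a u Aa _ hu].
- exact: splitP0.
- have abn : (a + b <= n)%N by rewrite ab.
  have zlP a' b' : (a' + b' = a + b)%N -> splitP i (fd i a' * zl i (cc i) y b').
    by move=> E; apply: (splitP_zl ey ry hy cn Ly); lia.
  have [t [tT ->]] := fd_zl y cn abn.
  apply: splitPD; first exact: zlP.
  apply: splitPZ; first exact: vq_reg.
  elim: tT => {t} [|_ [a' [b' [E lt ->]]]|x x' _ hx _ hx'|d x Ad _ hx].
  + exact: splitP0.
  + exact: zlP.
  + exact: splitPD.
  + exact: splitPZ.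
- exact: splitPD.
- exact: splitPZ.
Qed.

(** The congruence for ft_j v' makes v0 congruent to ft*_i (g - g') modulo q L, so that its norm at
    0 is one in degree h. This is how positivity reaches ker e'_j, which ft_j does not see. *)
Definition fs_split j i g : Prop := exists v0 v' g' t,
  [/\ e j v0 = 0, L h v', fs i g = v0 + ft j v' &
      [/\ L h g', L h.+1 t & ft j v' = fs i g' + q *: t]].

Lemma fs_split_same i x : L h x -> fs_split i i x.
Proof.
apply: (@L_ind i (fs_split i i) h (leqnn h)).
- by exists 0, 0, 0, 0; rewrite !linear0 !addr0; split; [|exact: L0| |split=> //; exact: L0].
- move=> u v [v0 [v' [g' [t [h1 h2 E1 [h3 h4 E2]]]]]] [w0 [w' [k' [t' [h5 h6 E3 [h7 h8 E4]]]]]].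
  exists (v0 + w0), (v' + w'), (g' + k'), (t + t'); rewrite !linearD /= h1 h5 E1 E3 E2 E4.
  split; [by rewrite addr0|exact: LD|by rewrite addrACA|split; [exact: LD|exact: LD|]].
  by rewrite addrACA.
- move=> a u Aa [v0 [v' [g' [t [h1 h2 E1 [h3 h4 E2]]]]]].
  exists (a *: v0), (a *: v'), (a *: g'), (a *: t).
  rewrite !linearZ /= h1 E1 E2 scaler0 !scalerDr !scalerA [a * q]mulrC.
  by split=> //; [exact: LZ|split=> //; exact: LZ].
move=> k0 a b cc y n ey ry hy cn an Ly Ek.
set g := zr i (cc i) y a * fd i b.
have Lg : L h g by rewrite -Ek; apply: (L_zr ey ry hy cn Ly) => //; rewrite Ek.
have Eg : fs i g = zr i (cc i) y a * fd i b.+1 by rewrite fsd // (zr_er ry hy).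
have Lfg : L h.+1 (fs i g) by apply: fs_step.
(* Beyond n, ft*_i g is exactly in the image of ft_i: v0 = 0 and g' = g. *)
have [Nn|nN] := leqP (a + b.+1) n; last first.
  have := zr_Mspan i cc y a b.+1; rewrite -Eg addnS => Mg.
  rewrite addnS in nN; have [v Mv Ev] := Mspan_ftP ey ry hy cn nN Mg.
  exists 0, v, g, 0; rewrite linear0 scaler0 addr0 add0r; split=> //.
    have hv : ht h v by rewrite -Ek -addnA; exact: (Mspan_ht hy Mv).
    by apply: (L_ft_reg (leqnn h) hv (i := i)); rewrite -Ev; apply: (form_fs_reg i (leqnn h)).
  by split=> //; exact: L0.
have [t tT E1] := z_fd_fd y cn Nn.
have [t2 [t2Z E2]] := fd_zl y cn Nn.
have t2T : Tlat i y (a + b.+1) t2.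
  apply: span_sub t2Z => // _ [a' [b' [E _ ->]]].
  have abn : (a' + b' <= n)%N by rewrite E.
  by have := zl_Tlat y cn abn; rewrite E.
have kN : (k0 + (a + b.+1))%N = h.+1 by lia.
have [x0 [x' [ex0 Lx' Ex]]] := splitP_Tlat ey ry hy cn Ly Nn kN (spanD tT t2T).
have E : fs i g = fd i a * zl i (cc i) y b.+1 + q *: (x0 + ft i x').
  by rewrite Eg E1 E2 -Ex scalerDr -addrA [q *: t + _]addrC.
have Ltt : L h.+1 (t + t2).
  apply: SL_step; have kN' : (k0 + (a + b))%N = h by lia.
  apply: (Tlat_SL ey ry hy cn Ly _ kN'); first by rewrite -addnS.
  by rewrite -addnS; apply: spanD.
have Lx0 : L h.+1 x0.
  have -> : x0 = t + t2 - ft i x' by rewrite Ex addrK.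
  by apply: LB => //; apply: L_ft.
(* The main term f_i^(a) z_(b+1) is in ker e'_i if a = 0 and in the image of ft_i if a > 0;
   accordingly g' is 0 or g. *)
have [a0|[a' ea]] : a = 0%N \/ exists a', a = a'.+1.
  by case: (a) => [|a']; [left|right; exists a'].
  exists (zl i (cc i) y b.+1 + q *: x0), (q *: x'), 0, (ft i x').
  rewrite linearD !linearZ /= (zl_e ey hy) ex0 scaler0 addr0 linear0 add0r; split=> //.
  - by apply: LZ => //; apply: vq_reg.
  - by rewrite E a0 fd0 mul1r scalerDr addrA.
  - by split=> //; [exact: L0|exact: L_ft].
exists (q *: x0), (fd i a' * zl i (cc i) y b.+1 + q *: x'), g, (- x0).
have Ef : ft i (fd i a' * zl i (cc i) y b.+1 + q *: x') = fs i g - q *: x0.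
  rewrite linearD linearZ /= ftd ?(zl_e ey hy) // E ea scalerDr addrCA.
  by rewrite [q *: x0 + _]addrC addrK.
rewrite linearZ /= ex0 scaler0; split=> //.
- apply: LD; last by apply: LZ => //; apply: vq_reg.
  have <- : (k0 + b.+1 + a')%N = h by lia.
  by apply: (L_zl ey ry hy cn Ly); lia.
- by rewrite Ef addrC subrK.
- by split=> //; [exact: LN|rewrite Ef scalerN].
Qed.

Lemma fs_split_any j i g : L h g -> fs_split j i g.
Proof.
move=> Lg; have [<-|ij] := eqVneq i j; first exact: fs_split_same.
have [h0|[k hk]] : h = 0%N \/ exists k, k.+1 = h.
  by case: (h) => [|k]; [left|right; exists k].
  exists (fs i g), 0, 0, 0; rewrite !linear0 !addr0; split=> //; last first.
  - by split=> //; exact: L0.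
  - exact: L0.
  - rewrite (e_fs ij (ht_L Lg)) (ht_e0 j) ?linear0 //.
    by rewrite -h0; apply: ht_L.
rewrite -hk in Lg; have kh : (k < h)%N by rewrite -hk.
have [g0 [g' [eg0 Lg0 Lg' Eg]]] := L_split j kh Lg.
exists (fs i g0), (fs i g'), (ft j g'), 0.
rewrite Eg linearD /= (ft_fs ij (ht_L Lg')) scaler0 addr0; split=> //.
- by rewrite (e_fs ij (ht_L Lg0)) eg0 linear0.
- by rewrite -hk; apply: L_fs.
- by split; rewrite // -?hk; [exact: L_ft|exact: L0].
Qed.

Lemma top_fs_span u : L h.+1 u -> span A (fun u => exists i g, L h g /\ u = fs i g) u.
Proof.
move=> /st_step /(span_linear (g := st)) H; rewrite -[u]stK.
apply: H => _ [[//|i w] [wk] ->]; apply: spanX; exists i, (st (tw w)).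
split; last by rewrite /fs stK.
by apply: L_st => //; rewrite -wk; exact: L_tw.
Qed.

Lemma top_split j u : L h.+1 u -> splitP j u.
Proof.
move=> /top_fs_span; elim=> {u} [|_ [i [g [Lg ->]]]|u v _ hu _ hv|a u Aa _ hu].
- exact: splitP0.
- by have [v0 [v' [g' [t [h1 h2 E _]]]]] := fs_split_any j i Lg; exists v0, v'.
- exact: splitPD.
- exact: splitPZ.
Qed.

Lemma form_ft_ker i k b v : ht k b -> e i v = 0 -> form (ft i b) v = 0.
Proof.
move=> hb ev; have [s [es hs ->]] := ldec (ht_efam i) hb.
rewrite ft_sum // form_suml big1 // => n _.
by rewrite -[v]mul1r -(fd0 i) form_fd_ker // mul0r.
Qed.

(** The component of v in ker e'_j is orthogonal to the image of ft_j, so pairing with a word that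
    starts with j is a computation in degree h. *)
Lemma top_reg u v : L h.+1 u -> L h.+1 v -> form u v \in A.
Proof.
elim=> {u} [|_ [[//|j w] [wh] ->]|u u' _ hu _ hu'|a u Aa _ hu] Lv.
- by rewrite form0l rpred0.
- have Lw : L h (tw w) by rewrite -wh; apply: L_tw.
  have [v0 [v' [ev0 Lv' ->]]] := top_split j Lv.
  rewrite /= formDr (form_ft_ker (ht_L Lw)) // add0r.
  exact: (form_ft_reg j (leqnn h)).
- by rewrite formDl rpredD ?hu ?hu'.
- by rewrite formZl rpredM ?hu.
Qed.

Lemma top_tw w : size w = h.+1 -> ev (form (tw w) (tw w)) = 1.
Proof.
case: w => // j w [wh]; have Lw : L h (tw w) by rewrite -wh; apply: L_tw.
by rewrite /= (ev_form_ft j (leqnn h)) // (good_tw (GG (leqnn h))).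
Qed.

Lemma top_last w : size w = h.+1 -> exists i g, L h g /\ qL h.+1 (tw w - fs i g).
Proof.
case: w => // j w [wh].
have [h0|[k hk]] : h = 0%N \/ exists k, k.+1 = h.
  by case: (h) => [|k]; [left|right; exists k].
  have -> : w = [::] by apply: size0nil; rewrite wh.
  exists j, 1; split; first by have := L_tw [::]; rewrite /= h0.
  by rewrite /fs st1 /= ft1 stf subrr; apply: qL0.
have := good_last (GG (leqnn h)) wh; rewrite -{1}hk => -[i [g [Lg qr]]].
have [g' [t [Lg' /SL_step Lt E]]] := ft_fs_mod_any i j hk Lg.
exists i, g'; split=> //; have -> : tw (j :: w) - fs i g' = ft j (tw w - fs i g) + q *: t.
  by rewrite linearB /= E opprD addrA subrK.
by apply: qLD; [exact: qL_ft|exists t].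
Qed.

(** The integral form has a splitting of its own, and splittings are unique. *)
Lemma split_RU i w (u0 u' : U) : size w = h.+1 -> e i u0 = 0 -> ht h u' ->
  tw w = u0 + ft i u' -> RU u0.
Proof.
move=> wh eu0 hu' Ew; have := htRU_tw w; rewrite wh.
move=> /(ker_split (htRU_efam i)) [v0 [v' [ev0 [_ Rv0] [hv' _] Ev]]].
suff -> : u0 = v0 by [].
apply/eqP; rewrite -subr_eq0; apply/eqP.
apply: (@split_uniq B i h _ (u' - v')); first by rewrite linearB /= eu0 ev0 subrr.
  exact: htB.
by rewrite linearB /= addrACA -opprD -Ew -Ev subrr.
Qed.

Lemma rat_int01 (x y : rat) : x \is a Num.int -> 0 <= x -> 0 <= y -> y + x = 1 ->
  x = 0 \/ x = 1 /\ y = 0.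
Proof.
move=> /intrP [n ->] h1 h2 h3; have : (n <= 1)%R.
  by rewrite -(ler_int rat) mulr1z; lra.
move: h1; rewrite ler0z => h1 n1.
have [n_eq|] : n = 0 \/ n = 1 by lia.
- by left; rewrite n_eq.
- by move=> n_eq; right; split=> //; move: h3; rewrite n_eq mulr1z => h3; lra.
Qed.

Lemma ev_form_qL u v : L h.+1 v -> qL h.+1 (u - v) ->
  ev (form u u) = ev (form v v).
Proof.
move=> Lv [r Lr Er]; have -> : u = v + q *: r by rewrite -Er addrC subrK.
have -> : form (v + q *: r) (v + q *: r) =
    form v v + q * (form v r + form r v + q * form r r).
  by rewrite formDl !formDr !formZl !formZr; ring.
have Aq := vq_reg (bV B).
by rewrite evD ?(rpredD, rpredM, top_reg) // evM ?(rpredD, rpredM, top_reg) //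
  ev_vq mul0r addr0.
Qed.

(** The two parts are orthogonal and their norms at 0 add up to 1. The norm of w0 is nonnegative
    because w0 is congruent to ft*_i (g - g'), and that of w' is a nonnegative integer; so one of
    the parts vanishes modulo q. *)
Lemma tw_split j w : size w = h.+1 -> exists w0 w',
  [/\ e j w0 = 0, L h w', L h.+1 w0, tw w = w0 + ft j w' &
      qL h w' \/ qL h.+1 w0 /\ ev (form w' w') = 1].
Proof.
move=> wh; have Lw : L h.+1 (tw w) by rewrite -wh; apply: L_tw.
have [i [g [Lg [z Lz Ez]]]] := top_last wh.
have [v0 [v' [g' [t [ev0 Lv' E1 [Lg' Lt E2]]]]]] := fs_split_any j i Lg.
have [z0 [z' [ez0 Lz' E3]]] := top_split j Lz.
(* q z is the error in [top_last]; its own splitting is added to that of ft*_i g. *)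
pose w' := v' + q *: z'; pose w0 := v0 + q *: z0.
have Ew : tw w = w0 + ft j w'.
  rewrite -[LHS](subrK (fs i g)) Ez E1 E3 /w0 /w' (linearD (ft j)) (linearZ_LR (ft j)) /= scalerDr.
  by rewrite [LHS]addrC addrACA.
have Lw' : L h w' by apply: LD => //; apply: LZ => //; apply: vq_reg.
have Lw0 : L h.+1 w0.
  have -> : w0 = tw w - ft j w' by rewrite Ew addrK.
  by apply: LB => //; apply: L_ft.
have ew0 : e j w0 = 0 by rewrite linearD linearZ /= ev0 ez0 scaler0 addr0.
have qr : qL h.+1 (w0 - fs i (g - g')).
  exists (z0 - t); last rewrite linearB /=.
    have -> : z0 = z - ft j z' by rewrite E3 addrK.
    by do !apply: LB => //; apply: L_ft.
  have -> : fs i g - fs i g' = v0 + q *: t.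
    by rewrite E1 E2 addrCA [LHS]addrC addKr.
  by rewrite /w0 opprD addrACA subrr add0r -scalerBr.
exists w0, w'; split=> //.
have Lg2 : L h (g - g') by apply: LB.
have Ls2 : L h (st (g - g')) by apply: L_st.
have evw0 : ev (form w0 w0) = ev (form (st (g - g')) (st (g - g'))).
  rewrite -[RHS](ev_form_ft i (leqnn h) Ls2 Ls2) -form_fs.
  by apply: ev_form_qL qr; apply: fs_step.
have Gh := GG (leqnn h).
have hw' := ht_L Lw'.
have RU0 := split_RU wh ew0 hw' Ew.
have RUf : RU (ft j w').
  have -> : ft j w' = tw w - w0 by rewrite Ew [w0 + _]addrC addrK.
  by apply: spanB RU0; exact: (htRU_tw w).2.
have fA := form_ft_reg j (leqnn h) Lw' Lw'.
have int1 : ev (form w' w') \is a Num.int.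
  by rewrite -(ev_form_ft j (leqnn h) Lw' Lw'); apply: zint_ev => //; apply: form_RU.
have sum1 : ev (form w0 w0) + ev (form w' w') = 1.
  rewrite -(top_tw wh) -(ev_form_ft j (leqnn h) Lw' Lw') -(evD (top_reg Lw0 Lw0) fA).
  have Eo := form_ft_ker hw' ew0.
  congr (ev _).
  rewrite Ew (formDl w0) (formDr w0 w0) (formDr (ft j w') w0) Eo.
  by rewrite [form w0 (ft j w')]formC Eo addr0 add0r.
have [] := rat_int01 int1 (good_ge0 Gh Lw') _ sum1.
- by rewrite evw0 (good_ge0 Gh).
- by move=> w'0; left; apply: (good_rad Gh).
move=> [w'1 w00]; right; split=> //.
have : qL h (st (g - g')) by apply: (good_rad Gh) => //; rewrite -evw0.
move=> /(qL_ft i) [r Lr Er].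
have -> : w0 = (w0 - fs i (g - g')) + fs i (g - g') by rewrite subrK.
apply: qLD qr _; exists (st r); first exact: st_step.
by rewrite /fs Er linearZ.
Qed.

(* The value at 0 of the scalar product is an integer, and by positivity of the
   norms of b + u' and b - u' it lies in {-1, 0, 1}; the extreme cases force
   b = u' or b = - u' modulo q. *)
Lemma tw_gram w1 w2 : size w1 = h.+1 -> size w2 = h.+1 ->
  [\/ ev (form (tw w1) (tw w2)) = 0, qL h.+1 (tw w1 - tw w2) |
      qL h.+1 (tw w1 + tw w2)].
Proof.
case: w1 => // j w1 [wh1] wh2.
have [u0 [u' [eu0 Lu' Lu0 Ew H]]] := tw_split j wh2.
have Gh := GG (leqnn h).
have Lb : L h (tw w1) by rewrite -wh1; apply: L_tw.
set b := tw w1 in Lb *.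
have Ef : form (tw (j :: w1)) (tw w2) = form (ft j b) (ft j u').
  by rewrite Ew formDr /= (form_ft_ker (ht_L Lb) eu0) add0r.
have Eev : ev (form (tw (j :: w1)) (tw w2)) = ev (form b u').
  by rewrite Ef (ev_form_ft j (leqnn h)).
case: H => [qu'|[qu0 u'1]].
  by apply: Or31; rewrite Eev formC; apply: qreg_ev; apply: qform_reg Gh qu' Lb.
have int1 : ev (form b u') \is a Num.int.
  rewrite -Eev; apply: zint_ev; first by rewrite Ef (form_ft_reg j (leqnn h)).
  by apply: form_RU; [exact: (htRU_tw (j :: w1)).2|exact: (htRU_tw w2).2].
have b1 : ev (form b b) = 1 by apply: (good_tw Gh).
have rA := good_reg Gh.
have evp : ev (form (b + u') (b + u')) = 2 + 2 * ev (form b u').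
  rewrite formDl !formDr [form u' b]formC !evD ?rpredD ?rA // b1 u'1; ring.
have evm : ev (form (b - u') (b - u')) = 2 - 2 * ev (form b u').
  rewrite formBl !formBr [form u' b]formC !evB ?rpredB ?rA // b1 u'1; ring.
have Lp : L h (b + u') by apply: LD.
have Lm : L h (b - u') by apply: LB.
have := good_ge0 Gh Lp; have := good_ge0 Gh Lm; rewrite evp evm.
case/intrP: int1 => n En; rewrite En => h1 h2.
have n1 : (n <= 1)%R by rewrite -(ler_int rat) mulr1z; lra.
have n2 : (- 1 <= n)%R by rewrite -(ler_int rat) mulrN1z; lra.
have [n0|[n0|n0]] : n = 0 \/ n = 1 \/ n = -1 by lia.
- by apply: Or31; rewrite Eev En n0.
- apply: Or32; have /(qL_ft j) qm : qL h (b - u').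
    by apply: (good_rad Gh) => //; rewrite evm En n0; ring.
  have -> : tw (j :: w1) - tw w2 = ft j (b - u') - u0.
    by rewrite Ew linearB /= opprD addrA addrAC.
  exact: qLB.
- apply: Or33; have /(qL_ft j) qm : qL h (b + u').
    by apply: (good_rad Gh) => //; rewrite evp En n0; ring.
  have -> : tw (j :: w1) + tw w2 = ft j (b + u') + u0.
    by rewrite Ew linearD /= addrCA addrC.
  exact: qLD.
Qed.

(** * Orthogonal expansions modulo q *)

Definition tsum (s : seq (K * seq I)) : U := \sum_(p <- s) p.1 *: tw p.2.

Definition words_ok (s : seq (K * seq I)) : Prop :=
  forall p, p \in s -> p.1 \in A /\ size p.2 = h.+1.

Fixpoint ortho (s : seq (K * seq I)) : Prop :=
  if s is p :: s' then
    (forall p', p' \in s' -> ev (form (tw p.2) (tw p'.2)) = 0) /\ ortho s'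
  else True.

Lemma words_ok_cons p s : words_ok (p :: s) <->
  [/\ p.1 \in A, size p.2 = h.+1 & words_ok s].
Proof.
split=> [H|[h1 h2 H] p']; first split.
- by case: (H p); rewrite ?mem_head.
- by case: (H p); rewrite ?mem_head.
- by move=> p' ps; apply: H; rewrite inE ps orbT.
by rewrite inE => /orP[/eqP ->|/H].
Qed.

Lemma tsum_cons p s : tsum (p :: s) = p.1 *: tw p.2 + tsum s.
Proof. by rewrite /tsum big_cons. Qed.

Lemma L_top_tw w : size w = h.+1 -> L h.+1 (tw w).
Proof. by move=> <-; apply: L_tw. Qed.

Lemma L_tsum s : words_ok s -> L h.+1 (tsum s).
Proof.
elim: s => [|p s IH]; first by rewrite /tsum big_nil => _; apply: L0.
rewrite words_ok_cons tsum_cons => -[h1 h2 /IH h3]; apply: LD => //.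
by apply: LZ => //; apply: L_top_tw.
Qed.

(** By [tw_gram] the new word is either orthogonal to the head at q = 0, and is passed on, or equal
    to plus or minus the head modulo q, and only changes its coefficient. The last clause keeps the
    head orthogonal to the new tail. *)
Lemma ortho_insert a w s : a \in A -> size w = h.+1 -> words_ok s -> ortho s ->
  exists s', [/\ words_ok s', ortho s', qL h.+1 (a *: tw w + tsum s - tsum s') &
    forall p, p \in s' -> p.2 = w \/ exists2 p', p' \in s & p.2 = p'.2].
Proof.
move=> Aa wh; elim: s => [|p s IH] Ws Os.
  exists [:: (a, w)]; split=> //.
  - by apply/words_ok_cons; split.
  - by rewrite /tsum big_nil big_seq1 /= addr0 subrr; apply: qL0.
  - by move=> p; rewrite inE => /eqP ->; left.
have [Ap ph Ws'] := (words_ok_cons p s).1 Ws; case: Os => Op Os'.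
have upd b : b \in A -> qL h.+1 (a *: tw w - b *: tw p.2) ->
    exists s', [/\ words_ok s', ortho s',
      qL h.+1 (a *: tw w + tsum (p :: s) - tsum s') &
      forall p', p' \in s' -> p'.2 = w \/ exists2 p'', p'' \in p :: s & p'.2 = p''.2].
  move=> Ab qb; exists ((p.1 + b, p.2) :: s); split=> //.
  - by apply/words_ok_cons; split; rewrite ?rpredD.
  - rewrite !tsum_cons /= scalerDl.
    have -> : a *: tw w + (p.1 *: tw p.2 + tsum s) -
      (p.1 *: tw p.2 + b *: tw p.2 + tsum s) = a *: tw w - b *: tw p.2; last by [].
    by move: (a *: tw w) (p.1 *: tw p.2) (b *: tw p.2) (tsum s) => x y z t;
       rewrite [y + z + t]addrAC opprD addrA addrK.
  - move=> p'; rewrite inE => /orP[/eqP ->|ps]; right.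
      by exists p; rewrite ?mem_head.
    by exists p'; rewrite ?inE ?ps ?orbT.
case: (tw_gram ph wh) => [E0|qm|qp].
- have [s' [W' O' q' H']] := IH Ws' Os'; exists (p :: s'); split.
  + by apply/words_ok_cons.
  + split=> // p' /H' [->//|[p'' ps ->]]; exact: Op.
  + rewrite !tsum_cons addrCA opprD addrACA subrr add0r; exact: q'.
  + move=> p'; rewrite inE => /orP[/eqP ->|/H' [->|[p'' ps ->]]].
    * by right; exists p; rewrite ?mem_head.
    * by left.
    * by right; exists p''; rewrite ?inE ?ps ?orbT.
- apply: (upd a) => //; rewrite -scalerBr -opprB scalerN; apply: qLN.
  exact: qLZ.
- apply: (upd (- a)); rewrite ?rpredN // scaleNr opprK -scalerDr addrC.
  exact: qLZ.
Qed.

Lemma ortho_exists u : L h.+1 u -> exists s,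
  [/\ words_ok s, ortho s & qL h.+1 (u - tsum s)].
Proof.
have merge s t : words_ok s -> words_ok t -> ortho t -> exists s',
    [/\ words_ok s', ortho s' & qL h.+1 (tsum s + tsum t - tsum s')].
  elim: s => [|p s IH] Ws Wt Ot.
    by exists t; rewrite /tsum big_nil add0r subrr; split=> //; apply: qL0.
  have [Ap ph Ws'] := (words_ok_cons p s).1 Ws.
  have [s1 [W1 O1 q1]] := IH Ws' Wt Ot.
  have [s2 [W2 O2 q2 _]] := ortho_insert Ap ph W1 O1.
  exists s2; split=> //; rewrite tsum_cons.
  have -> : p.1 *: tw p.2 + tsum s + tsum t - tsum s2 =
    (p.1 *: tw p.2 + tsum s1 - tsum s2) + (tsum s + tsum t - tsum s1).
    move: (p.1 *: tw p.2) (tsum s) (tsum t) (tsum s2) (tsum s1) => x y z t2 t1.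
    rewrite [RHS]addrACA -opprD [x + t1 + _]addrAC [t2 + t1]addrC opprD.
    by rewrite [RHS]addrA addrK addrA.
  exact: qLD.
elim=> {u} [|_ [w wh ->]|u v _ [s [Ws Os qs]] _ [t [Wt Ot qt]]|a u Aa _ [s [Ws Os qs]]].
- by exists [::]; rewrite /tsum big_nil subr0; split=> //; apply: qL0.
- exists [:: (1, w)]; split=> //; first by apply/words_ok_cons; split; rewrite ?rpred1.
  by rewrite /tsum big_seq1 scale1r subrr; apply: qL0.
- have [s' [W' O' q']] := merge s t Ws Wt Ot; exists s'; split=> //.
  have -> : u + v - tsum s' = (u - tsum s) + (v - tsum t) + (tsum s + tsum t - tsum s').
    by rewrite [u - _ + _]addrACA -opprD addrA subrK.
  by apply: qLD => //; apply: qLD.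
- exists [seq (a * p.1, p.2) | p <- s]; split.
  + by move=> _ /mapP [p /Ws [h1 h2] ->]; split=> //=; rewrite rpredM.
  + elim: s Os {Ws qs} => //= p s IH [h1 h2]; split; last exact: IH.
    by move=> p0 /mapP [p1 ps1 E]; rewrite E /= (h1 _ ps1).
  + have -> : tsum [seq (a * p.1, p.2) | p <- s] = a *: tsum s.
      rewrite /tsum big_map scaler_sumr; apply: eq_bigr => p _.
      by rewrite scalerA.
    by rewrite -scalerBr; apply: qLZ.
Qed.

Lemma ortho_form s : words_ok s -> ortho s ->
  ev (form (tsum s) (tsum s)) = \sum_(p <- s) ev p.1 ^+ 2.
Proof.
elim: s => [|p s IH]; first by rewrite /tsum !big_nil form0l ev0.
rewrite words_ok_cons => -[Ap ph Ws] [Op Os].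
have Lp := L_top_tw ph; have Ls := L_tsum Ws.
have E0 : ev (form (tw p.2) (tsum s)) = 0.
  elim: s Ws Op {IH Os Ls} => [|p' s IH]; first by rewrite /tsum big_nil form0r ev0.
  rewrite words_ok_cons => -[Ap' ph' Ws] H.
  have Lp' := L_top_tw ph'.
  rewrite tsum_cons formDr formZr evD ?rpredM ?top_reg //; last exact: L_tsum.
  rewrite evM ?top_reg // H ?mem_head // mulr0 add0r; apply: IH => // p'' ps.
  by apply: H; rewrite inE ps orbT.
have LA := top_reg.
rewrite tsum_cons big_cons formDl !formDr !formZl !formZr.
rewrite [form (tsum s) (tw p.2)]formC.
rewrite !evD ?(rpredD, rpredM, LA) // !evM ?rpredM ?LA // E0 (IH Ws Os).
rewrite (top_tw ph); ring.
Qed.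

(** By [ortho_form] the norm at 0 is a sum of squares of rationals; if it is 0, all coefficients lie
    in qA. *)
Lemma top_form u : L h.+1 u -> 0 <= ev (form u u) /\ (ev (form u u) = 0 -> qL h.+1 u).
Proof.
move=> Lu; have [s [Ws Os [r Lr Er]]] := ortho_exists Lu.
have Ls := L_tsum Ws.
have -> : ev (form u u) = \sum_(p <- s) ev p.1 ^+ 2.
  rewrite -(ortho_form Ws Os).
  by apply: ev_form_qL => //; exists r.
split; first by apply: sumr_ge0 => p _; apply: sqr_ge0.
move=> E0; have -> : u = tsum s + q *: r by rewrite -Er addrC subrK.
apply: qLD; last by exists r.
elim: s Ws E0 {Os Er Ls} => [|p s IH]; first by rewrite /tsum !big_nil => *; apply: qL0.
rewrite words_ok_cons tsum_cons big_cons => -[Ap ph Ws] E0.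
have h1 := sqr_ge0 (ev p.1).
have h2 : 0 <= \sum_(p <- s) ev p.1 ^+ 2 by apply: sumr_ge0 => p' _; apply: sqr_ge0.
apply: qLD; last by apply: IH => //; lra.
apply: LZq; last exact: L_top_tw.
apply/qregP; split=> //; apply/eqP; rewrite -sqrf_eq0; apply/eqP; lra.
Qed.

Lemma good_step : good h.+1.
Proof.
split.
- exact: st_step.
- exact: top_reg.
- by move=> u /top_form [].
- by move=> u /top_form [].
- exact: top_tw.
- exact: top_last.
- exact: full_step.
Qed.

End GoodBelow.

Lemma good_all h : good h.
Proof.
suff H : forall k, (k <= h)%N -> good k by apply: H.
elim: h => [|h IH] k; first by rewrite leqn0 => /eqP ->; exact: good0.
by rewrite leq_eqVlt => /orP[/eqP -> |/IH //]; apply: good_step.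
Qed.

End Loop.

Section Monomials.
Variable B : boson.
Local Notation K := (bK B).
Local Notation U := (bU B).
Local Notation I := (bI B).
Local Notation q := (vq (bV B)).
Local Notation A := (reg (bV B)).
Local Notation ev := (ev (bV B)).
Local Notation e := (@be B).
Local Notation form := (@form B).
Local Notation ft := (@ft B).
Local Notation Q i := (vq (bV B) ^+ bd i).
Local Notation sf i := (sfac (bV B) (bd i)).
Local Notation qb i := (qbin (bV B) (bd i)).
Local Notation sb i := (sbin (bV B) (bd i)).
Local Notation qreg := (qreg (bV B)).
Local Notation unit1 := (unit1 (bV B)).
Implicit Types (i j : I) (u v x y : U) (h k m n a : nat).

(** * Monomials of norm 1 modulo q *)

Definition mon (s : seq (I * nat)) : U := foldr (fun p u => fd p.1 p.2 * u) 1 s.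

Definition mon_word (s : seq (I * nat)) : seq I :=
  flatten [seq nseq p.2 p.1 | p <- s].

Lemma ht_mon s : ht (size (mon_word s)) (mon s).
Proof.
elim: s => [|[i a] s IH]; first exact: hom_ht (hom1 B).
by rewrite /mon_word /= size_cat size_nseq addnC; apply: ht_fd.
Qed.

Lemma RU_mon s : RU (mon s).
Proof. by apply: spanX; exists s. Qed.

Lemma form_coef i a N (c : nat -> K) (s : nat -> U) : (forall n, e i (s n) = 0) ->
  form (\sum_(n < N) c n *: (fd i (a + n) * s n))
       (\sum_(n < N) c n *: (fd i (a + n) * s n)) =
  \sum_(n < N) c n ^+ 2 * ((sf i (a + n))^-1 * form (s n) (s n)).
Proof.
move=> es; have E n : c n *: (fd i (a + n) * s n) = fd i (a + n) * (c n *: s n).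
  by rewrite scalerAr.
under eq_bigr do rewrite E.
rewrite (@form_sum_ker B i N (addn a) (addn a) (fun n => c n *: s n)
  (fun n => c n *: s n)) //; first last.
- by move=> n; rewrite linearZ /= es scaler0.
- by move=> n; rewrite linearZ /= es scaler0.
- exact: addnI.
by apply: eq_bigr => n _; rewrite formZl formZr; ring.
Qed.

Lemma fd_sum i a N (s : nat -> U) :
  fd i a * (\sum_(n < N) fd i n * s n) = \sum_(n < N) qb i a n *: (fd i (a + n) * s n).
Proof.
by rewrite mulr_sumr; apply: eq_bigr => n _; rewrite mulrA fdM -scalerAl.
Qed.

Lemma ft_iter i a N (s : nat -> U) : (forall n, e i (s n) = 0) ->
  iter a (ft i) (\sum_(n < N) fd i n * s n) = \sum_(n < N) fd i (a + n) * s n.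
Proof.
move=> es; elim: a => [//|a IH]; rewrite iterS IH linear_sum.
by apply: eq_bigr => n _; rewrite /= ftd.
Qed.

Lemma qbVE i a n : (qb i a n)^-1 = Q i ^ (a * n)%N%:Z * (sb i a n)^-1.
Proof. by rewrite qbinE ?bd_gt0 // invfM QV opprK. Qed.

Lemma qb_neq0 i a n : qb i a n != 0.
Proof. exact/qbin_neq0/bd_gt0. Qed.

Lemma reg_qbV i a n : (qb i a n)^-1 \in A.
Proof.
rewrite qbVE rpredM ?reg_Q //.
by apply/unit1_reg/unit1V/unit1_sbin; exact: bd_gt0.
Qed.

Lemma qreg_qbV i a n : (0 < a)%N -> (0 < n)%N -> qreg (qb i a n)^-1.
Proof.
move=> a0 n0; rewrite qbVE; apply: qregMr.
  by apply: qreg_Q; [exact: bd_gt0|rewrite ltz_nat muln_gt0 a0].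
by apply/unit1_reg/unit1V/unit1_sbin; exact: bd_gt0.
Qed.

Section Step.
Variables (i : I) (a k : nat) (s : nat -> U).
Hypotheses (es : forall n, e i (s n) = 0).
Hypotheses (hs : forall n, (n <= k)%N -> ht (k - n) (s n)).
Local Notation x := (\sum_(n < k.+1) fd i n * s n).

Let T n : K := qb i a n ^+ 2 * ((sf i (a + n))^-1 * form (s n) (s n)).

Let formT n : form (s n) (s n) = (qb i a n)^-1 ^+ 2 * (sf i (a + n) * T n).
Proof.
rewrite /T; have := qb_neq0 i a n; have := sfac_neq0 (bV B) (bd_gt0 i) (a + n).
by move=> h1 h2; field; rewrite h1 h2.
Qed.

Let posT n : (n <= k)%N -> pos (bV B) (T n).
Proof.
move=> nk; have hp := pos_form (good_all B (k - n)) (hs nk).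
have posQ (z : int) c : pos (bV B) c -> pos (bV B) (Q i ^ z * c).
  by move=> hc; rewrite Q_expz; apply: posMq.
have -> : T n = Q i ^ (- (a * n)%N%:Z) * (Q i ^ (- (a * n)%N%:Z) *
    (sb i a n * (sb i a n * ((sf i (a + n))^-1 * form (s n) (s n))))).
  by rewrite /T qbinE ?bd_gt0 //; ring.
have us : unit1 (sb i a n) by apply: unit1_sbin; exact: bd_gt0.
do 2!apply: (posQ); do 2!apply: (posMu us).
by apply: posMu hp; apply: unit1_sfV.
Qed.

Let form_fdx : form (fd i a * x) (fd i a * x) = \sum_(n < k.+1) T n.
Proof. by rewrite fd_sum form_coef. Qed.

Let form_x : form x x = \sum_(n < k.+1) (sf i n)^-1 * form (s n) (s n).
Proof. exact: form_ldec. Qed.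

Let sf_reg n : sf i n \in A.
Proof. by apply/unit1_reg/unit1_sfac; exact: bd_gt0. Qed.

Let sfV_reg n : (sf i n)^-1 \in A.
Proof. exact/unit1_reg/unit1_sfV. Qed.

(* The inverse q-binomials are regular at q = 0. *)
Lemma form_fd_qreg : qreg (form (fd i a * x) (fd i a * x)) -> qreg (form x x).
Proof.
rewrite form_fdx form_x => /pos_sum_qreg H; apply: qreg_sum => n _.
apply: qregMl => //; rewrite formT; apply: qregMl; first by rewrite rpredX ?reg_qbV.
apply: qregMl => //; apply: H => m; apply: posT.
by rewrite -ltnS.
Qed.

(** For n > 0 the norm of s_n lies in qA, so the norm of x and [T 0] have the same value at 0. It is
    an integer between 0 and 1, nonzero by assumption; so it is 1, and nothing is left for the [T n]
    with n > 0. *)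
Lemma form_fd_unit1 : (0 < a)%N -> RU x -> ~ qreg (form x x) ->
  unit1 (form (fd i a * x) (fd i a * x)) ->
  unit1 (form x x) /\ qL (a + k) (fd i a * x - iter a (ft i) x).
Proof.
move=> a0 Rx nx [fA fE]; rewrite form_fdx in fA fE.
have TA n : (n <= k)%N -> T n \in A.
  rewrite -ltnS => nk; apply: (@pos_sum_reg _ (bV B) _ (fun n : 'I_k.+1 => T n) _ fA (Ordinal nk)).
  by move=> m; apply: posT; rewrite -ltnS.
have T0 n : (n <= k)%N -> 0 <= ev (T n) by move=> nk; apply: pos_ev; [apply: posT|apply: TA].
have sA n : (n <= k)%N -> form (s n) (s n) \in A.
  by move=> nk; rewrite formT rpredM ?rpredX ?reg_qbV // rpredM ?sf_reg ?TA.
have sq n : (0 < n)%N -> (n <= k)%N -> qreg (form (s n) (s n)).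
  move=> n0 nk; rewrite formT; apply: qregMr; last by rewrite rpredM ?TA.
  by rewrite expr2; apply: qregMl; [exact: reg_qbV|exact: qreg_qbV].
have qb0 : qb i a 0 = 1.
  by rewrite qbin_sym qbin.unlock add0n qfac0 mul1r divff // qf0.
have xA : form x x \in A.
  by rewrite form_x rpred_sum // => n _; rewrite rpredM // sA // -ltnS.
have x0 : qreg (form x x - form (s 0%N) (s 0%N)).
  rewrite form_x big_ord_recl sfac0 invr1 mul1r addrC addKr.
  by apply: qreg_sum => n _; apply: qregMl => //; apply: (sq) => //; exact: (ltn_ord n).
have T0x : qreg (form x x - T 0).
  have -> : form x x - T 0 = (form x x - form (s 0%N) (s 0%N)) +
      (1 - (sf i a)^-1) * form (s 0%N) (s 0%N).
    by rewrite /T qb0 expr1n mul1r addn0 mulrBl mul1r addrA subrK.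
  apply: qregD x0 _; apply: qregMr; last exact: sA.
  by apply: unit1B1; [exact: unit1_1|exact: unit1_sfV].
have [_ evT0] := ev_eq xA T0x.
have evx0 : 0 <= ev (form x x) by rewrite -evT0 T0.
have sumT : \sum_(n < k.+1) ev (T n) = 1.
  by rewrite -fE ev_sum // => n; apply: TA; rewrite -ltnS.
have intx : ev (form x x) \is a Num.int.
  by apply: zint_ev => //; apply: form_RU.
have restT : 0 <= \sum_(n < k) ev (T (lift ord0 n)).
  by apply: sumr_ge0 => n _; apply: T0; exact: (ltn_ord n).
rewrite big_ord_recl evT0 in sumT.
have [ex|[ex rest0]] := rat_int01 intx evx0 restT (etrans (addrC _ _) sumT).
  by case: nx; apply/qregP.
split=> //; have T_q n : (0 < n)%N -> (n <= k)%N -> qreg (T n).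
  case: n => // n _ nk; apply/qregP; split; first exact: TA.
  have := rest0 => /eqP; rewrite psumr_eq0 => [/allP /(_ (Ordinal nk)) H|m _]; last first.
    by apply: T0; exact: (ltn_ord m).
  by apply/eqP; apply: H; rewrite mem_index_enum.
apply: (qL_of_qreg (good_all B _)).
  have hx : ht k x.
    apply: span_sum => n _; have nk : (n <= k)%N by rewrite -ltnS.
    by have := ht_fd i n (hs nk); rewrite subnK.
  apply: htB; first by rewrite addnC; apply: ht_fd.
  by elim: (a) => [//|b IH]; rewrite iterS; apply: ht_ft.
rewrite fd_sum ft_iter // -sumrB.
under eq_bigr do rewrite -[X in _ - X]scale1r -scalerBl.
rewrite (form_coef a k.+1 (fun n => qb i a n - 1) es).
apply: qreg_sum => -[[|n] nk] _ /=.
  by rewrite qb0 subrr expr0n mul0r; apply: qreg0.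
(* The q-binomial has a pole, but its square is already part of [T n.+1], which lies in qA; the
   remaining factor is regular. *)
have -> : (qb i a n.+1 - 1) ^+ 2 * ((sf i (a + n.+1))^-1 * form (s n.+1) (s n.+1)) =
   (1 - (qb i a n.+1)^-1) ^+ 2 * T n.+1.
  rewrite /T; have h1 := qb_neq0 i a n.+1.
  by have h2 := sfac_neq0 (bV B) (bd_gt0 i) (a + n.+1); field; rewrite h1 h2.
apply: qregMl; last exact: T_q.
by rewrite rpredX // rpredB ?rpred1 ?reg_qbV.
Qed.

End Step.

Lemma mon_not_qreg s : ~ qreg (form (mon s) (mon s)).
Proof.
elim: s => [|[i a] s IH] /=.
  by rewrite form1 => /qreg_ev /eqP; rewrite ev1 oner_eq0.
have [t [et ht Et]] := ldec (ht_efam i) (ht_mon s).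
by rewrite Et => /(form_fd_qreg et ht); rewrite -Et.
Qed.

(** Each step replaces f_i^(a) by the a-th iterate of ft_i modulo q, and [form_fd_unit1] hands the
    norm condition to the tail. *)
Lemma mon_tw s : unit1 (form (mon s) (mon s)) ->
  qL (size (mon_word s)) (mon s - tw (mon_word s)).
Proof.
elim: s => [|[i a] s IH]; first by rewrite subrr => _; apply: qL0.
have -> : mon_word ((i, a) :: s) = nseq a i ++ mon_word s by [].
rewrite [mon _]/=; case: a => [|a]; first by rewrite fd0 mul1r.
have [t [et ht Et]] := ldec (ht_efam i) (ht_mon s).
have := form_fd_unit1 et ht (ltn0Sn a); rewrite -Et.
move=> H /(H (RU_mon s) (@mon_not_qreg s)) [/IH q1 q2].
have tw_it b : tw (nseq b i ++ mon_word s) = iter b (ft i) (tw (mon_word s)).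
  by elim: b => [//|b IHb] /=; rewrite -IHb.
have it_q b : qL (b + size (mon_word s)) (iter b (ft i) (mon s) - iter b (ft i) (tw (mon_word s))).
  by elim: b => [//|b IHb]; rewrite !iterS -linearB; apply: qL_ft.
rewrite size_cat size_nseq tw_it -(subrK (iter a.+1 (ft i) (mon s)) (fd i a.+1 * mon s)) -addrA.
exact: qLD.
Qed.

End Monomials.

Local Open Scope quotient_scope.
Local Open Scope classical_set_scope.

(** * The field Q(q) *)

Lemma frac_dec (R : idomainType) (c : {fraction R}) : exists p s : R,
  s != 0 /\ c = tofrac p / tofrac s.
Proof.
elim/quotW: c => x; exists \n_x, \d_x; split; first exact: denom_ratioP.
apply: (@mulIf _ (tofrac \d_x)); first by rewrite tofrac_eq0 denom_ratioP.
rewrite mulfVK ?tofrac_eq0 ?denom_ratioP //.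
rewrite !piE; apply/eqP; rewrite FracField.equivf_def.
rewrite /FracField.mulf !numden_Ratio ?oner_eq0 ?mulf_neq0 ?denom_ratioP //;
  by rewrite ?mulr1 ?oner_neq0 // mulrC.
Qed.

Section FieldIdentities.
Variables (F : fieldType).
Implicit Types (x y z t u v : F).

Lemma sub_frac x y z t : y != 0 -> t != 0 ->
  x / y - z / t = (x * t - z * y) / (y * t).
Proof. by move=> y0 t0; field; rewrite y0 t0. Qed.

Lemma sub_frac_expr x y z t u v : y != 0 -> t != 0 -> u != 0 -> v != 0 ->
  x / (u * y) - z / (v * t) = (x * v * t - z * u * y) / (u * v * (y * t)).
Proof. by move=> y0 t0 u0 v0; field; rewrite y0 t0 u0 v0. Qed.

Lemma eq_frac x y z t : y != 0 -> t != 0 -> x / y = z / t -> x * t = z * y.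
Proof. by move=> y0 t0 /eqP; rewrite eqr_div // => /eqP. Qed.

Lemma frac_exprK x u n : u != 0 -> x = u * (u ^+ n * (x / u ^+ n.+1)).
Proof. by move=> u0; rewrite [RHS]mulrA -exprS mulrC divfK // expf_neq0. Qed.

Lemma frac_mul_exprS x y u n : u != 0 ->
  x * u / (u ^+ n.+1 * y) = x / (u ^+ n * y).
Proof. by move=> u0; rewrite exprS -[u * _ * y]mulrA invfM mulrA mulfK. Qed.

End FieldIdentities.

Section RationalFunctions.
Implicit Types (c : ratfun) (p s : {poly rat}).

Lemma horner0_neq0 p : p.[0] != 0 -> tofrac p != 0 :> ratfun.
Proof. by rewrite tofrac_eq0; apply: contra_neq => ->; rewrite horner0. Qed.

Lemma q_neq0 : q != 0.
Proof. by rewrite tofrac_eq0 polyX_eq0. Qed.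

Definition regp : pred ratfun := fun c => `[< regular0 c >].

Lemma regP p s : s.[0] != 0 -> tofrac p / tofrac s \in regp.
Proof. by move=> s0; apply/asboolP; exists (p, s). Qed.

Lemma reg_dec c : c \in regp -> exists p s, s.[0] != 0 /\ c = tofrac p / tofrac s.
Proof. by move=> /asboolP[[p s] /= s0 ->]; exists p, s. Qed.

Lemma reg_closed : subring_closed regp.
Proof.
split.
- have := @regP 1 1; rewrite !tofrac1 divr1; apply.
  by rewrite hornerC oner_neq0.
- move=> a b /reg_dec[p [s [s0 ->]]] /reg_dec[p' [s' [s'0 ->]]].
  have -> : tofrac p / tofrac s - tofrac p' / tofrac s' =
      tofrac (p * s' - p' * s) / tofrac (s * s') :> ratfun.
    by rewrite tofracB !tofracM sub_frac ?horner0_neq0.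
  by apply: regP; rewrite hornerM mulf_neq0.
- move=> a b /reg_dec[p [s [s0 ->]]] /reg_dec[p' [s' [s'0 ->]]].
  rewrite mulf_div -!tofracM; apply: regP.
  by rewrite hornerM mulf_neq0.
Qed.
HB.instance Definition _ := GRing.isSubringClosed.Build ratfun regp reg_closed.

(** [ev0E] shows independence of the fraction chosen. Outside A the value is the default 0. *)
Definition value0 c : rat :=
  xget 0 [set x | exists p s, [/\ s.[0] != 0, c = tofrac p / tofrac s & x = p.[0] / s.[0]]].

Lemma ev0E p s : s.[0] != 0 -> value0 (tofrac p / tofrac s) = p.[0] / s.[0].
Proof.
move=> s0; rewrite /value0; case: xgetP => [x _ [p' [s' [s'0 E ->]]]|H].
  have h1 := horner0_neq0 s0; have h2 := horner0_neq0 s'0.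
  have : p * s' = p' * s.
    apply/eqP; rewrite -tofrac_eq !tofracM; apply/eqP.
    exact: (eq_frac h1 h2 E).
  move=> /(congr1 (horner_eval 0)); rewrite /horner_eval !hornerM => E'.
  by apply/eqP; rewrite eqr_div // E' mulrC [s.[0] * _]mulrC mulrC.
by exfalso; apply: (H (p.[0] / s.[0])); exists p, s.
Qed.

Lemma ev01 : value0 1 = 1.
Proof.
have := @ev0E 1 1; rewrite !tofrac1 !hornerC !divr1; apply; exact: oner_neq0.
Qed.

Lemma tofrac_reg p : tofrac p \in regp /\ value0 (tofrac p) = p.[0].
Proof.
have h : (1 : {poly rat}).[0] != 0 by rewrite hornerC oner_neq0.
have := regP p h; have := ev0E p h; rewrite tofrac1 !divr1 hornerC divr1.
by [].
Qed.

Lemma q_reg : q \in regp. Proof. exact: (tofrac_reg 'X).1. Qed.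

Lemma ev0q : value0 q = 0.
Proof. by rewrite (tofrac_reg 'X).2 hornerX. Qed.

Lemma ev0D : {in regp &, {morph value0 : a b / a + b}}.
Proof.
move=> a b /reg_dec[p [s [s0 ->]]] /reg_dec[p' [s' [s'0 ->]]].
have -> : tofrac p / tofrac s + tofrac p' / tofrac s' =
    tofrac (p * s' + p' * s) / tofrac (s * s') :> ratfun.
  by rewrite tofracD !tofracM addf_div ?horner0_neq0.
rewrite !ev0E ?hornerM ?mulf_neq0 // hornerD !hornerM.
by field; rewrite s0 s'0.
Qed.

Lemma ev0M : {in regp &, {morph value0 : a b / a * b}}.
Proof.
move=> a b /reg_dec[p [s [s0 ->]]] /reg_dec[p' [s' [s'0 ->]]].
rewrite mulf_div -!tofracM !ev0E ?hornerM ?mulf_neq0 //.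
by field; rewrite s0 s'0.
Qed.

Lemma root0_mulX (R : idomainType) (p : {poly R}) : p.[0] = 0 ->
  exists p' : {poly R}, p = p' * 'X.
Proof.
by elim/poly_ind: p => [|p c _]; [exists 0; rewrite mul0r|
  rewrite hornerMXaddC mulr0 add0r => ->; exists p; rewrite addr0].
Qed.

Lemma reg_divq0 c : c \in regp -> value0 c = 0 -> c / q \in regp.
Proof.
move=> /reg_dec[p [s [s0 ->]]]; rewrite ev0E // => /eqP.
rewrite mulf_eq0 invr_eq0 (negPf s0) orbF => /eqP /root0_mulX [p' ->].
by rewrite tofracM mulrAC mulfK ?q_neq0 // regP.
Qed.

Lemma regV0 c : c \in regp -> value0 c != 0 -> c^-1 \in regp.
Proof.
move=> /reg_dec[p [s [s0 ->]]]; rewrite ev0E // mulf_eq0 negb_or => /andP[p0 _].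
by rewrite invf_div regP.
Qed.

Lemma poly_val p : p != 0 -> exists n p1, p1.[0] != 0 /\
  tofrac p = q ^+ n * tofrac p1 :> ratfun.
Proof.
move=> p0; have [n [p1]] := multiplicity_XsubC p 0; rewrite p0 /= => r0 E.
exists n, p1; split; first by move: r0; rewrite /root.
by rewrite E subr0 tofracM tofracXn mulrC.
Qed.

Lemma val_exists0 c : c != 0 -> exists (m : int) a,
  [/\ a \in regp, value0 a != 0 & c = q ^ m * a].
Proof.
have [p [s [s0 ->]]] := frac_dec c => pq0.
have p0 : p != 0 by apply: contra_neq pq0 => ->; rewrite tofrac0 mul0r.
have [n [p1 [p10 ->]]] := poly_val p0; have [m [s1 [s10 ->]]] := poly_val s0.
exists (n%:Z - m%:Z), (tofrac p1 / tofrac s1); split.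
- exact: regP.
- by rewrite ev0E // mulf_neq0 ?invr_neq0.
- by rewrite expfzDr ?q_neq0 // -exprnN -exprnP invfM mulrACA.
Qed.

Local Notation toQ := (map_poly (intr : int -> rat)).

(** Polynomials with constant term 1 are invertible in Z[[q]], so these fractions have integral
    Laurent series; the description also makes inverses of elements of value 1 easy. *)
Definition zintp : pred ratfun := fun c =>
  `[< exists (p s : {poly int}) n, s.[0] = 1 /\
      c = tofrac (toQ p) / (q ^+ n * tofrac (toQ s)) >].

Lemma toQ0 (s : {poly int}) : (toQ s).[0] = s.[0]%:~R.
Proof. by rewrite -[0 in LHS](rmorph0 intr) horner_map. Qed.

Lemma toQ_neq0 (s : {poly int}) : s.[0] = 1 -> tofrac (toQ s) != 0 :> ratfun.
Proof. by move=> s1; apply: horner0_neq0; rewrite toQ0 s1 oner_neq0. Qed.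

Lemma zintP (p s : {poly int}) n : s.[0] = 1 ->
  tofrac (toQ p) / (q ^+ n * tofrac (toQ s)) \in zintp.
Proof. by move=> s1; apply/asboolP; exists p, s, n. Qed.

Lemma zint_closed : subring_closed zintp.
Proof.
split.
- have := @zintP 1 1 0; rewrite !rmorph1 expr0 !mul1r invr1; apply.
  by rewrite hornerC.
- move=> a b /asboolP[p [s [n [s1 ->]]]] /asboolP[p' [s' [n' [s'1 ->]]]].
  have -> : tofrac (toQ p) / (q ^+ n * tofrac (toQ s)) -
      tofrac (toQ p') / (q ^+ n' * tofrac (toQ s')) =
      tofrac (toQ (p * 'X^n' * s' - p' * 'X^n * s)) /
      (q ^+ (n + n') * tofrac (toQ (s * s'))).
    rewrite exprD !(rmorphB, rmorphM) /= !map_polyXn !tofracXn.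
    by rewrite sub_frac_expr ?toQ_neq0 ?expf_neq0 ?q_neq0.
  by apply: zintP; rewrite hornerM s1 s'1.
- move=> a b /asboolP[p [s [n [s1 ->]]]] /asboolP[p' [s' [n' [s'1 ->]]]].
  rewrite mulf_div mulrACA -exprD -!tofracM -!rmorphM; apply: zintP.
  by rewrite hornerM s1 s'1.
Qed.
HB.instance Definition _ := GRing.isSubringClosed.Build ratfun zintp zint_closed.

(** As long as a factor q is left in the denominator, regularity forces the numerator to vanish at
    0, and q cancels. *)
Lemma reg_zint_dec c : c \in regp -> c \in zintp -> exists r s : {poly int},
  s.[0] = 1 /\ c = tofrac (toQ r) / tofrac (toQ s).
Proof.
move=> Ac /asboolP[p [s [n [s1 E]]]]; elim: n p E => [|n IH] p E.
  by exists p, s; rewrite E expr0 mul1r.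
have sn0 := toQ_neq0 s1.
have Ec : c * tofrac (toQ s) = tofrac (toQ p) / q ^+ n.+1.
  by rewrite E invfM mulrA mulfVK.
have : value0 (tofrac (toQ p)) = 0.
  have -> : tofrac (toQ p) = q * (q ^+ n * (c * tofrac (toQ s))).
    by rewrite Ec; apply: frac_exprK q_neq0.
  have rA : q ^+ n * (c * tofrac (toQ s)) \in regp.
    by rewrite !rpredM ?rpredX ?q_reg // (tofrac_reg _).1.
  by rewrite ev0M ?q_reg // ev0q mul0r.
rewrite (tofrac_reg _).2 toQ0 => /eqP; rewrite intr_eq0 => /eqP.
move=> /root0_mulX [p' Ep]; apply: (IH p'); rewrite E Ep rmorphM /= map_polyX tofracM.
exact: frac_mul_exprS q_neq0.
Qed.

Lemma zint_ev0 c : c \in regp -> c \in zintp -> value0 c \is a Num.int.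
Proof.
move=> Ac Zc; have [r [s [s1 ->]]] := reg_zint_dec Ac Zc.
rewrite ev0E !toQ0 s1 ?oner_neq0 // divr1; exact: intr_int.
Qed.

Lemma zintV0 c : c \in regp -> c \in zintp -> value0 c = 1 -> c^-1 \in zintp.
Proof.
move=> Ac Zc; have [r [s [s1 ->]]] := reg_zint_dec Ac Zc.
rewrite ev0E !toQ0 s1 ?oner_neq0 // divr1 => /eqP.
rewrite -[1](rmorph1 intr) eqr_int => /eqP r1.
by rewrite invf_div; have := zintP s 0 r1; rewrite expr0 mul1r.
Qed.

Lemma q_zint : q \in zintp.
Proof.
have s1 : (1 : {poly int}).[0] = 1 by rewrite hornerC.
have := zintP 'X 0 s1; rewrite map_polyX rmorph1 expr0 mul1r tofrac1 divr1.
by [].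
Qed.

Lemma qV_zint : q^-1 \in zintp.
Proof.
have s1 : (1 : {poly int}).[0] = 1 by rewrite hornerC.
have := zintP 1 1 s1; rewrite rmorph1 expr1 !tofrac1 mulr1 mul1r.
by [].
Qed.

Definition ratfun_valued : valued ratfun :=
  @Valued ratfun q (GRing.SubringClosed.clone ratfun regp _)
    (GRing.SubringClosed.clone ratfun zintp _) value0 q_neq0 q_reg ev01 ev0q ev0D ev0M
    reg_divq0 regV0 val_exists0 q_zint qV_zint zint_ev0 zintV0.

End RationalFunctions.

(** * The negative half *)

Section SerreSum.
Variables (K : fieldType) (A : lalgType K) (c : nat -> K).

Definition serre_sum (x y : A) (b : nat) : A :=
  \sum_(k < b.+1) (-1) ^+ k *:
    ((c k)^-1 *: x ^+ k * y * ((c (b - k))^-1 *: x ^+ (b - k))).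

End SerreSum.

Section SerreSumMorphism.
Variables (K : fieldType) (A B : lalgType K) (h : A -> B).
Hypothesis hD : forall x y, h (x + y) = h x + h y.
Hypothesis hZ : forall a x, h (a *: x) = a *: h x.
Hypothesis h1 : h 1 = 1.

Fact lin0 : h 0 = 0.
Proof. by rewrite -(scale0r 0) hZ scale0r. Qed.

Fact lin_sum (J : Type) (s : seq J) (F : J -> A) :
  h (\sum_(j <- s) F j) = \sum_(j <- s) h (F j).
Proof. exact: (big_morph _ hD lin0). Qed.

Lemma serre_sum_morph c x y b : (forall x y, h (x * y) = h x * h y) ->
  h (serre_sum c x y b) = serre_sum c (h x) (h y) b.
Proof.
move=> hM; have hX z n : h (z ^+ n) = h z ^+ n.
  by elim: n => [|n IH]; rewrite ?expr0 // !exprS hM IH.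
by rewrite lin_sum; apply: eq_bigr => k _; rewrite hZ !hM !hZ !hX.
Qed.

(** Reversing products exchanges k and b - k, whence the sign. The Serre relations are thus
    symmetric under reversal, which gives U_q^- its anti-involution. *)
Lemma serre_sum_antimorph c x y b : (forall x y, h (x * y) = h y * h x) ->
  h (serre_sum c x y b) = (-1) ^+ b *: serre_sum c (h x) (h y) b.
Proof.
move=> hM; have hX z n : h (z ^+ n) = h z ^+ n.
  by elim: n => [|n IH]; rewrite ?expr0 // exprS hM IH -exprSr.
rewrite lin_sum [RHS]scaler_sumr (reindex_inj rev_ord_inj) /=.
apply: eq_bigr => k _; have kb : (k <= b)%N by rewrite -ltnS.
rewrite hZ !hM !hZ !hX subSS mulrA subKn //.
by rewrite scalerA -signr_odd oddB // signr_addb !signr_odd.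
Qed.

End SerreSumMorphism.

Section Descent.
Variables (K : fieldType) (A U : lalgType K) (pr : A -> U) (rp : U -> A) (h : A -> U).
Hypothesis prK : forall u, pr (rp u) = u.
Hypothesis prD : forall x y, pr (x + y) = pr x + pr y.
Hypothesis prZ : forall a x, pr (a *: x) = a *: pr x.
Hypothesis prM : forall x y, pr (x * y) = pr x * pr y.
Hypothesis h_pr : forall x y, pr x = pr y -> h x = h y.

Lemma descent_linear : (forall x y, h (x + y) = h x + h y) ->
  (forall a x, h (a *: x) = a *: h x) -> linear (h \o rp).
Proof.
move=> hD hZ a u v /=; rewrite -hZ -hD; apply: h_pr.
by rewrite prD prZ !prK.
Qed.

Lemma descent_antimorph : (forall x y, h (x * y) = h y * h x) ->
  forall u v, h (rp (u * v)) = h (rp v) * h (rp u).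
Proof. by move=> hM u v; rewrite -hM; apply: h_pr; rewrite prM !prK. Qed.

End Descent.

Lemma antimorph_involutive (K : fieldType) (U : lalgType K) (J : Type)
    (g : J -> U) (s : {linear U -> U}) :
  (forall P : U -> Prop, P 1 -> (forall j u, P u -> P (g j * u)) ->
    (forall u v, P u -> P v -> P (u + v)) -> (forall a u, P u -> P (a *: u)) ->
    forall u, P u) ->
  s 1 = 1 -> (forall u v, s (u * v) = s v * s u) -> (forall j, s (g j) = g j) ->
  forall u, s (s u) = u.
Proof.
move=> gen s1 sM sg; apply: (gen (fun u => s (s u) = u)) => [|j u IH|u v IHu IHv|a u IH].
- by rewrite !s1.
- by rewrite !sM !sg IH.
- by rewrite !linearD IHu IHv.
- by rewrite !linearZ /= IH.
Qed.

Section FreeAlgebra.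
Variables (I : choiceType) (K : fieldType) (U : algType K) (g : I -> U).
Local Notation free_alg := {malg K[{fmonom I}]}.
Implicit Types (x y : free_alg) (k : {fmonom I}).

Definition fvar i : free_alg := << fmu i >>.

Lemma malgU_scale c k : << c *g k >> = c *: << k >> :> free_alg.
Proof. by rewrite -mul_malgC malgM_def fgmulUU mul1m mulr1. Qed.

Lemma malgU_prod k : << k >> = \prod_(i <- fmonom_val k) fvar i :> free_alg.
Proof.
case: k => w /=; elim: w => [|i w IH].
  by rewrite big_nil; congr (mkmalgU _ 1); apply: val_inj; rewrite /= fm1.
rewrite big_cons -IH /fvar malgM_def fgmulUU mulr1; congr (mkmalgU _ 1).
by apply: val_inj; rewrite /= fmM fmU.
Qed.

Definition antimap : free_alg -> U :=
  mmap (in_alg U) (fun k => \prod_(i <- rev (fmonom_val k)) g i).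

Lemma antimapD x y : antimap (x + y) = antimap x + antimap y.
Proof. exact: (@mmapD _ _ _ (in_alg U)). Qed.

Lemma antimapB x y : antimap (x - y) = antimap x - antimap y.
Proof. exact: (@mmapB _ _ _ (in_alg U)). Qed.

Lemma antimap0 : antimap 0 = 0.
Proof. exact: (@mmap0 _ _ _ (in_alg U)). Qed.

Lemma antimapU c k :
  antimap << c *g k >> = c *: \prod_(i <- rev (fmonom_val k)) g i.
Proof. by rewrite /antimap (@mmapU _ _ _ (in_alg U)) /= -scalerAl mul1r. Qed.

Lemma antimap_sum (J : Type) (s : seq J) (F : J -> free_alg) :
  antimap (\sum_(j <- s) F j) = \sum_(j <- s) antimap (F j).
Proof. exact: (big_morph _ antimapD antimap0). Qed.

Lemma antimapM x y : antimap (x * y) = antimap y * antimap x.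
Proof.
have mono c k d l : antimap (<< c *g k >> * << d *g l >>) =
    antimap << d *g l >> * antimap << c *g k >>.
  rewrite malgM_def fgmulUU !antimapU fmM rev_cat big_cat /=.
  by rewrite -scalerAl -scalerAr scalerA mulrC.
have monol c k : antimap (<< c *g k >> * y) = antimap y * antimap << c *g k >>.
  rewrite [y]monalgE mulr_sumr !antimap_sum mulr_suml.
  by apply: eq_bigr => l _; apply: mono.
rewrite [x]monalgE mulr_suml !antimap_sum mulr_sumr.
by apply: eq_bigr => k _; apply: monol.
Qed.

Lemma antimap1 : antimap 1 = 1.
Proof. by rewrite antimapU fm1 scale1r big_nil. Qed.

Lemma antimapZ c x : antimap (c *: x) = c *: antimap x.
Proof. by rewrite -mul_malgC antimapM antimapU fm1 big_nil -scalerAr mulr1. Qed.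

Lemma antimap_gen i : antimap (fvar i) = g i.
Proof. by rewrite antimapU fmU scale1r big_seq1. Qed.

Lemma antimap_serre c i j b :
  antimap (serre_sum c (fvar i) (fvar j) b) = (-1) ^+ b *: serre_sum c (g i) (g j) b.
Proof.
by rewrite (serre_sum_antimorph antimapD antimapZ antimap1 _ _ _ _ antimapM) !antimap_gen.
Qed.

End FreeAlgebra.

Section Quotient.
Variables (I : choiceType) (K : fieldType) (U : algType K).
Local Notation free_alg := {malg K[{fmonom I}]}.
Variables (pr : free_alg -> U).
Hypothesis prD : forall x y, pr (x + y) = pr x + pr y.
Hypothesis prM : forall x y, pr (x * y) = pr x * pr y.
Hypothesis prZ : forall c x, pr (c *: x) = c *: pr x.
Hypothesis pr1 : pr 1 = 1.

Fact quotient_ind (P : U -> Prop) : (forall u, exists x, u = pr x) ->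
  P 1 -> (forall j u, P u -> P (pr (fvar K j) * u)) ->
  (forall u v, P u -> P v -> P (u + v)) -> (forall a u, P u -> P (a *: u)) ->
  forall u, P u.
Proof.
move=> surj P1 Pf PD PZ u; have [x ->] := surj u; rewrite [x]monalgE (lin_sum prD prZ).
have P0 : P 0 by rewrite -(scale0r 1); apply: PZ.
apply: (big_ind P) => // k _; rewrite malgU_scale prZ malgU_prod; apply: PZ.
elim: (fmonom_val k) => [|j w IH]; first by rewrite big_nil pr1.
by rewrite big_cons prM; apply: Pf.
Qed.

End Quotient.

Section NegativeHalf.
Variable D : root_datum.
Local Notation free_alg := {malg ratfun[{fmonom D}]}.
Local Notation U := (Uminus D).
Local Notation proj := (\pi_(Uminus D) : free_alg -> Uminus D).
Implicit Types (i j : D) (u v : U) (x y : free_alg).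

Lemma proj_mul x y : proj (x * y) = proj x * proj y.
Proof. exact: projM. Qed.

Lemma proj_scale c x : proj (c *: x) = c *: proj x.
Proof. exact: projZ. Qed.

Lemma proj_one : proj 1 = 1.
Proof. by []. Qed.

Lemma proj_zero : proj 0 = 0.
Proof. exact: lin0 proj_scale. Qed.

Lemma Uminus_ind (P : U -> Prop) : P 1 -> (forall j u, P u -> P (fgen j * u)) ->
  (forall u v, P u -> P v -> P (u + v)) -> (forall a u, P u -> P (a *: u)) ->
  forall u, P u.
Proof.
apply: (quotient_ind (@projD D) proj_mul proj_scale proj_one) => u.
by exists (repr u); rewrite reprK.
Qed.

Lemma serre_rel_sum i j : serre_rel i j =
  serre_sum (qfact i) (free_gen i) (free_gen j) `|1 - coroot i (alpha j)|%N.
Proof. by []. Qed.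

Lemma serre_eq i j : i != j ->
  serre_sum (qfact i) (fgen i) (fgen j) `|1 - coroot i (alpha j)|%N = 0.
Proof.
move=> ij; have /projP : serre_ideal (serre_rel i j - 0).
  by rewrite subr0; have := SerreGen 1 1 ij; rewrite mul1r mulr1.
rewrite serre_rel_sum => E; apply: etrans (etrans E proj_zero).
exact/esym/(serre_sum_morph (@projD D) proj_scale proj_one _ _ _ _ proj_mul).
Qed.

Definition fstar : free_alg -> U := antimap (@fgen D).

Lemma fstar_ideal x : serre_ideal x -> fstar x = 0.
Proof.
elim=> [i j u v ij||u v _ hu _ hv].
- rewrite /fstar !antimapM; suff -> : antimap (@fgen D) (serre_rel i j) = 0.
    by rewrite mul0r mulr0.
  by rewrite serre_rel_sum antimap_serre serre_eq // scaler0.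
- exact: antimap0.
- by rewrite /fstar antimapD -!/(fstar _) hu hv addr0.
Qed.

Lemma repr_proj u : proj (repr u) = u.
Proof. exact: reprK. Qed.

Lemma fstar_proj x y : proj x = proj y -> fstar x = fstar y.
Proof.
move=> /projP /fstar_ideal; rewrite [fstar _]antimapB => /eqP.
by rewrite subr_eq0 => /eqP.
Qed.

(** [repr] is only a set-theoretic section; linearity holds because [fstar] kills the Serre
    ideal. *)
Definition ustar : U -> U := fstar \o (fun u : U => repr u : free_alg).

Fact ustar_linear : linear ustar.
Proof.
exact: (descent_linear repr_proj (@projD D) proj_scale fstar_proj
          (antimapD _) (antimapZ _)).
Qed.
HB.instance Definition _ := GRing.isLinear.Build ratfun U U _ ustar ustar_linear.

Lemma ustarM u v : ustar (u * v) = ustar v * ustar u.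
Proof. exact: (descent_antimorph repr_proj proj_mul fstar_proj (antimapM _)). Qed.

Lemma ustar1 : ustar 1 = 1.
Proof. by rewrite -[RHS](antimap1 (@fgen D)); apply: fstar_proj; apply: repr_proj. Qed.

Lemma ustar_gen i : ustar (fgen i) = fgen i.
Proof.
by rewrite -[RHS](antimap_gen (@fgen D)); apply: fstar_proj; apply: repr_proj.
Qed.

Lemma ustarK u : ustar (ustar u) = u.
Proof. exact: (antimorph_involutive Uminus_ind ustar1 ustarM ustar_gen). Qed.

End NegativeHalf.

(** * Right divisibility by powers of a generator *)

Section AdNilpotent.
Variables (K : fieldType) (U : algType K) (x : U).
Implicit Types (u v y : U).

(** C is uniform in N, which makes the property stable under products and reduces it to generators;
    the truncated N - C makes small N harmless. *)
Definition adnil (C : nat) u : Prop :=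
  forall N, exists u', x ^+ N * u = u' * x ^+ (N - C).

Lemma adnil_leq C C' u : (C <= C')%N -> adnil C u -> adnil C' u.
Proof.
move=> CC' h N; have [u' ->] := h N.
exists (u' * x ^+ (N - C - (N - C'))); rewrite -mulrA -exprD.
by congr (_ * _ ^+ _); lia.
Qed.

Lemma adnil1 : adnil 0 1.
Proof. by move=> N; exists 1; rewrite mulr1 mul1r subn0. Qed.

Lemma adnil_base : adnil 0 x.
Proof. by move=> N; exists x; rewrite subn0 -exprSr exprS. Qed.

Lemma adnilM C C' u v : adnil C u -> adnil C' v -> adnil (C + C') (u * v).
Proof.
move=> hu hv N; have [u' E] := hu N; have [v' E'] := hv (N - C)%N.
by exists (u' * v'); rewrite mulrA E -!mulrA E' subnDA.
Qed.

Lemma adnilD C C' u v : adnil C u -> adnil C' v -> adnil (maxn C C') (u + v).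
Proof.
move=> /(adnil_leq (leq_maxl C C')) hu /(adnil_leq (leq_maxr C C')) hv N.
have [u' E] := hu N; have [v' E'] := hv N.
by exists (u' + v'); rewrite mulrDr E E' mulrDl.
Qed.

Lemma adnilZ C a u : adnil C u -> adnil C (a *: u).
Proof.
move=> hu N; have [u' E] := hu N.
by exists (a *: u'); rewrite -scalerAr E scalerAl.
Qed.

(* The Serre relation expresses x^b y through x^k y x^(b-k) with k < b; each use
   moves powers of x to the right and strictly lowers the power on the left. *)
Lemma adnil_serre (c : nat -> K) y b : (forall n, c n != 0) -> serre_sum c x y b = 0 ->
  adnil b y.
Proof.
move=> c0; rewrite /serre_sum big_ord_recr /= subnn expr0.
set s := \sum_(k < b) _ => E.
pose d := (-1) ^+ b * ((c b)^-1 * (c 0)^-1).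
have d0 : d != 0 by rewrite mulf_neq0 ?signr_eq0 // mulf_neq0 ?invr_eq0.
have key : x ^+ b * y = \sum_(k < b)
    (- d^-1 * (-1) ^+ k * ((c k)^-1 * (c (b - k)%N)^-1)) *: (x ^+ k * y * x ^+ (b - k)).
  have /eqP : s + d *: (x ^+ b * y) = 0.
    by rewrite -E -!scalerAl -scalerAr mulr1 !scalerA -mulrA.
  rewrite addrC addr_eq0 => /eqP E'; apply: (scalerI d0); rewrite E'.
  rewrite scaler_sumr -sumrN; apply: eq_bigr => k _.
  rewrite -!scalerAl -!scalerAr !scalerA -scaleNr; congr (_ *: _).
  by rewrite !mulrA mulrN mulfV // !mulNr mul1r.
move=> N; elim/ltn_ind: N => N IH.
have [Nb|bN] := ltnP N b.
  by exists (x ^+ N * y); rewrite (eqP (ltnW Nb)) expr0 mulr1.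
have {1}-> : N = (N - b + b)%N by rewrite subnK.
rewrite exprD -mulrA key mulr_sumr.
have h (k : 'I_b) : exists u', x ^+ (N - b + k) * y = u' * x ^+ (N - b + k - b).
  by apply: IH; have := ltn_ord k; lia.
have [u' E'] := choice h.
exists (\sum_(k < b) (- d^-1 * (-1) ^+ k * ((c k)^-1 * (c (b - k)%N)^-1)) *:
   (u' k * x ^+ (N - b + k - b + (b - k) - (N - b)))).
rewrite mulr_suml; apply: eq_bigr => k _.
rewrite -scalerAr -scalerAl; congr (_ *: _).
rewrite !mulrA -exprD E' -!mulrA -!exprD; congr (_ * _ ^+ _).
by have := ltn_ord k; lia.
Qed.

Lemma adnil_gen (J : eqType) (g : J -> U) :
  (forall P : U -> Prop, P 1 -> (forall j u, P u -> P (g j * u)) ->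
    (forall u v, P u -> P v -> P (u + v)) -> (forall a u, P u -> P (a *: u)) ->
    forall u, P u) ->
  (forall j, exists C, adnil C (g j)) -> forall u, exists C, adnil C u.
Proof.
move=> gen hg; apply: gen => [|j u [C hu]|u v [C hu] [C' hv]|a u [C hu]].
- by exists 0; apply: adnil1.
- by have [C' hj] := hg j; exists (C' + C)%N; apply: adnilM.
- by exists (maxn C C'); apply: adnilD.
- by exists C; apply: adnilZ.
Qed.

End AdNilpotent.

Section Instance.
Variable D : root_datum.
Local Notation V := ratfun_valued.
Implicit Types i j : D.

Lemma coroot_diag i : coroot i (alpha i) = 2.
Proof.
have := coroot_form i (alpha i); rewrite wform_alpha => E.
apply: (@intr_inj rat); rewrite E mulfK //.
by rewrite pnatr_eq0 muln_eq0 /= -lt0n half_norm_gt0.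
Qed.

Lemma coroot_sym i j :
  (half_norm i)%:Z * coroot i (alpha j) = (half_norm j)%:Z * coroot j (alpha i).
Proof.
apply: (@intr_inj rat); rewrite !rmorphM /= !coroot_form !wform_alpha.
rewrite (wform_sym (alpha j)) -!pmulrn !natrM.
have h k : (half_norm k)%:R != 0 :> rat by rewrite pnatr_eq0 -lt0n half_norm_gt0.
by field; rewrite !h.
Qed.

Lemma qint_qnum i n : qint i n = qnum V (half_norm i) n.
Proof. by rewrite qnum.unlock. Qed.

Lemma qfact_qfac i n : qfact i n = qfac V (half_norm i) n.
Proof. by rewrite qfac.unlock; apply: eq_bigr => k _; apply: qint_qnum. Qed.

Lemma qfact_neq0 i n : qfact i n != 0.
Proof. rewrite qfact_qfac; exact/qfac_neq0/half_norm_gt0. Qed.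

Lemma fgen_adnil i j : exists C, adnil (fgen i) C (fgen j).
Proof.
have [<-|ij] := eqVneq i j; first by exists 0; apply: adnil_base.
by eexists; apply: (adnil_serre _ (serre_eq ij)); apply: qfact_neq0.
Qed.

End Instance.

(** * The canonical basis *)

Section Combinations.
Variables (K : fieldType) (U : lmodType K) (S : subringClosed K) (X : U -> Prop).

Definition combs (u : U) : Prop :=
  exists2 s : seq (K * U), (forall p, p \in s -> p.1 \in S /\ X p.2) &
    u = \sum_(p <- s) p.1 *: p.2.

Lemma combs_span u : span S X u -> combs u.
Proof.
elim=> {u} [|u Xu|u v _ [s hs ->] _ [t ht ->]|a u aS _ [s hs ->]].
- by exists [::]; rewrite ?big_nil.
- exists [:: (1, u)]; last by rewrite big_seq1 scale1r.
  by move=> p; rewrite inE => /eqP ->; rewrite rpred1.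
- exists (s ++ t); last by rewrite big_cat.
  by move=> p; rewrite mem_cat => /orP[/hs|/ht].
exists [seq (a * p.1, p.2) | p <- s].
  by move=> p /mapP [p' /hs [h1 h2] ->]; rewrite rpredM.
by rewrite big_map scaler_sumr; apply: eq_bigr => p _; rewrite scalerA.
Qed.

Lemma span_combs u : combs u -> span S X u.
Proof.
case=> s hs ->; rewrite big_seq; apply: span_sum => p /hs [h1 h2].
by apply: spanZ => //; apply: spanX.
Qed.

Lemma combsD u v : combs u -> combs v -> combs (u + v).
Proof. by move=> /span_combs hu /span_combs hv; apply/combs_span/spanD. Qed.

Lemma combsB u v : combs u -> combs v -> combs (u - v).
Proof. by move=> /span_combs hu /span_combs hv; apply/combs_span/spanB. Qed.

Lemma coset_shift (c : K) (x y z : U) : combs z -> x = y + c *: z ->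
  [set t | exists2 z', combs z' & t = x + c *: z'] =
  [set t | exists2 z', combs z' & t = y + c *: z'].
Proof.
move=> hz ->; apply/seteqP; split=> t [z' hz' ->].
  by exists (z + z'); [apply: combsD|rewrite scalerDr addrA].
exists (z' - z); first exact: combsB.
by rewrite -addrA -scalerDr addrC [z + _]addrC subrK addrC.
Qed.

End Combinations.

Section MonomialProduct.
Variable B : boson.

Lemma mon_zip r (i : r.-tuple (bI B)) (a : r.-tuple nat) :
  \prod_(k < r) fd (tnth i k) (tnth a k) = mon (zip i a).
Proof.
have -> : mon (zip i a) = \prod_(p <- zip i a) fd p.1 p.2.
  by rewrite unlock /mon; elim: (zip i a) => //= p s ->.
rewrite (big_tuple _ _ (zip_tuple i a)) /=; apply: eq_bigr => k _.
have s0 : (0 < size i)%N by rewrite size_tuple (leq_ltn_trans _ (ltn_ord k)).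
have -> : tnth (zip_tuple i a) k = (tnth i k, tnth a k); last by [].
rewrite (tnth_nth (tnth i k, 0%N)) /= nth_zip ?size_tuple //.
by rewrite -!tnth_nth.
Qed.

End MonomialProduct.

(** * Bar-invariance of divided powers *)

Section BarInvariance.
Variables (K : fieldType) (V : valued K) (U : algType K) (beta : {rmorphism U -> U}).
Hypothesis beta_q : beta (vq V)%:A = (vq V)^-1%:A.

(** On scalars the bar involution is given only by its value on q. A relation avoids constructing q
    -> q^-1 on the whole field; just the quantum integers have to be followed. *)
Definition bar_to (c c' : K) : Prop := beta c%:A = c'%:A.

Fact bar_to1 : bar_to 1 1.
Proof. by rewrite /bar_to scale1r rmorph1. Qed.

Fact bar_toM a a' b b' : bar_to a a' -> bar_to b b' -> bar_to (a * b) (a' * b').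
Proof.
have AM c c' : (c * c')%:A = c%:A * c'%:A :> U by rewrite -scalerAl mul1r scalerA.
by rewrite /bar_to !AM rmorphM => -> ->.
Qed.

Fact bar_toB a a' b b' : bar_to a a' -> bar_to b b' -> bar_to (a - b) (a' - b').
Proof. by rewrite /bar_to !scalerBl rmorphB => -> ->. Qed.

Fact bar_toX a a' n : bar_to a a' -> bar_to (a ^+ n) (a' ^+ n).
Proof.
move=> h; elim: n => [|n IH]; first exact: bar_to1.
by rewrite !exprS; apply: bar_toM.
Qed.

Fact bar_toV a a' : a != 0 -> a' != 0 -> bar_to a a' -> bar_to a^-1 a'^-1.
Proof.
have AM c c' : (c * c')%:A = c%:A * c'%:A :> U by rewrite -scalerAl mul1r scalerA.
move=> a0 a'0 h; have E : a'%:A * a'^-1%:A = 1 :> U by rewrite -AM mulfV // scale1r.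
have E' : beta a^-1%:A * (a'%:A * a'^-1%:A) = a'^-1%:A.
  by rewrite mulrA -h -rmorphM -AM mulVf // scale1r rmorph1 mul1r.
by rewrite /bar_to -E' E mulr1.
Qed.

Section QuantumNumbers.
Variables (d : nat).
Hypothesis d_gt0 : (0 < d)%N.

(** Numerator and denominator both change sign under q -> q^-1. *)
Fact bar_qnum n : bar_to (qnum V d n) (qnum V d n).
Proof.
have Q0 : vq V ^+ d != 0 by rewrite expf_neq0 // vq_neq0.
have hQ : bar_to (vq V ^+ d) (vq V ^+ d)^-1.
  by rewrite -exprVn; apply: bar_toX.
have hQV : bar_to (vq V ^+ d)^-1 (vq V ^+ d).
  by rewrite -[X in bar_to _ X]invrK; apply: bar_toV; rewrite ?invr_eq0.
have hB := QBV_neq0 V d_gt0.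
have hBV : (vq V ^+ d)^-1 - vq V ^+ d != 0 by rewrite -opprB oppr_eq0.
rewrite qnum.unlock /=; set Q := vq V ^+ d in hQ hQV hB hBV *.
have {2}-> : (Q ^+ n - Q ^- n) / (Q - Q^-1) = (Q ^- n - Q ^+ n) / (Q^-1 - Q).
  by rewrite -opprB -[Q - _]opprB invrN mulrNN.
apply: bar_toM; last by apply: bar_toV => //; apply: bar_toB.
by rewrite -exprVn; apply: bar_toB; apply: bar_toX.
Qed.

Fact bar_divpow x n : beta x = x ->
  beta ((qfac V d n)^-1 *: x ^+ n) = (qfac V d n)^-1 *: x ^+ n.
Proof.
move=> bx; have h : bar_to (qfac V d n) (qfac V d n).
  elim: n => [|n IH]; first by rewrite qfac0; apply: bar_to1.
  by rewrite qfacS; apply: bar_toM => //; apply: bar_qnum.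
have hV : bar_to (qfac V d n)^-1 (qfac V d n)^-1 by apply: bar_toV; rewrite ?qfac_neq0.
have E : (qfac V d n)^-1 *: x ^+ n = (qfac V d n)^-1%:A * x ^+ n.
  by rewrite -scalerAl mul1r.
by rewrite E rmorphM rmorphXn bx hV.
Qed.

End QuantumNumbers.

End BarInvariance.

Section Lattices.
Variable D : root_datum.
Local Notation U := (Uminus D).
Local Notation A := (reg ratfun_valued).

Lemma regularP c : c \in A <-> regular0 c.
Proof. by split=> [/asboolP|h]; last exact/asboolP. Qed.

Lemma unit1_one_plus_qA c : one_plus_qA c -> unit1 ratfun_valued c.
Proof.
case=> d /regularP Ad ->; apply: unit1_qreg; apply: qregMr => //; exact: qregq.
Qed.

Lemma Linf_combs (ft : D -> {linear U -> U}) :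
  Linf ft = combs A (range (ftilde_word ft)).
Proof.
by apply/seteqP; split=> u [s hs ->]; exists s => // p /hs [h1 h2];
  split=> //; apply/regularP.
Qed.

Lemma submodule_gen1 (S : set ratfun) (X : set U) u : S 1 -> X u ->
  submodule_gen S X u.
Proof.
move=> S1 Xu; exists [:: (1, u)]; last by rewrite big_seq1 scale1r.
by move=> p; rewrite inE => /eqP ->.
Qed.

Lemma monomial_integral r (i : r.-tuple D) (a : r.-tuple nat) :
  integral_form (monomial i a).
Proof.
apply: (big_ind (@integral_form D)); first exact: Int1.
  exact: IntM.
by move=> k _; apply: IntGen.
Qed.

Lemma bar_monomial (bar : {rmorphism U -> U}) r (i : r.-tuple D) (a : r.-tuple nat) :
  is_bar bar -> bar (monomial i a) = monomial i a.
Proof.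
case=> _ barq barf; rewrite /monomial rmorph_prod; apply: eq_bigr => k _.
rewrite /divpow qfact_qfac.
exact: (@bar_divpow _ ratfun_valued _ _ barq _ (half_norm_gt0 _) _ _ (barf _)).
Qed.

End Lattices.

(** * The negative half as an instance of the abstract setting *)

Section UminusBoson.
Variables (D : root_datum) (e' ft : D -> {linear Uminus D -> Uminus D}).
Variable form : {biscalar (Uminus D)}.
Hypotheses (He' : is_eprime e') (Hft : is_ftilde e' ft).
Hypothesis Hform : is_kashiwara_form e' form.
Local Notation V := ratfun_valued.

Fact Uminus_ft i n u : e' i u = 0 ->
  ft i ((qfac V (half_norm i) n)^-1 *: fgen i ^+ n * u) =
  (qfac V (half_norm i) n.+1)^-1 *: fgen i ^+ n.+1 * u.
Proof. by move=> /(Hft n); rewrite /divpow !qfact_qfac. Qed.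

Definition Uminus_boson : boson :=
  @Boson ratfun V (Defs.index D) (Uminus D) (@half_norm D) (@half_norm_gt0 D)
    (fun i j => coroot i (alpha j)) (@coroot_diag D) (@coroot_sym D) (@fgen D) e'
    (@ustar D) (fun u v => form u v) ft (proj1 He') (proj2 He') (@Uminus_ind D)
    (@ustarM D) (@ustar1 D) (@ustar_gen D) (@ustarK D)
    (let: And4 h _ _ _ := Hform in h) (let: And4 _ h _ _ := Hform in h)
    (let: And4 _ _ h _ := Hform in h)
    (fun u v w => linearDl form w u v) (fun a u v => linearZl_LR form v a u)
    (let: And4 _ _ _ h := Hform in h) Uminus_ft
    (fun i => adnil_gen (@Uminus_ind D) (fgen_adnil i)).

Lemma fd_divpow i n : @fd Uminus_boson i n = divpow i n.
Proof. by rewrite fdE /divpow qfact_qfac. Qed.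

End UminusBoson.

Theorem proposition3p4 (D : root_datum)
    (e' ft : D -> {linear Uminus D -> Uminus D})
    (form : {biscalar (Uminus D)})
    (bar : {rmorphism Uminus D -> Uminus D})
    (He' : is_eprime e') (Hft : is_ftilde e' ft)
    (Hform : is_kashiwara_form e' form) (Hbar : is_bar bar)
    (r : nat) (i : r.-tuple D) (a : r.-tuple nat)
    (Hi : reduced i) (Ha : tight_cone i a)
    (Horth : one_plus_qA (form (monomial i a) (monomial i a))) :
  canonical_basis ft bar (monomial i a).
Proof.
pose B := Uminus_boson He' Hft Hform; pose w := @mon_word B (zip i a).
have monE : monomial i a = @mon B (zip i a).
  by rewrite -mon_zip; apply: eq_bigr => k _; rewrite fd_divpow.
have [z Lz Ez] : qL (size w) (@mon B (zip i a) - @tw B w).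
  by apply: mon_tw; rewrite -monE; apply: unit1_one_plus_qA.
pose X := range (ftilde_word ft); pose A := reg ratfun_valued.
have Xz : span A X z.
  by apply: span_sub Lz => // _ [v _ ->]; apply: spanX; exists v.
have Em : monomial i a = ftilde_word ft w + q *: z.
  by rewrite monE; apply/eqP; rewrite addrC -subr_eq; apply/eqP.
have Lm : Linf ft (monomial i a).
  rewrite Linf_combs; apply: combs_span; rewrite Em; apply: spanD.
    by apply: spanX; exists w.
  by apply: spanZ Xz; apply: q_reg.
exists (Lclass ft (ftilde_word ft w)); first by exists w.
split; first split; first split.
- apply: submodule_gen1; last exact: monomial_integral.
  by exists 1; rewrite // /ratconst polyC1 tofrac1.
- exact: Lm.
(* Being bar-invariant, the monomial is its own preimage in L(oo). *)
- by exists (monomial i a) => //; apply: bar_monomial.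
rewrite /Lclass Linf_combs; apply: coset_shift Em.
exact: combs_span.
Qed.
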